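(* Suppose $\bar V$ is such that the set $\Lambda(\bar V)$ is contained between the lines $\theta=\pm\pi$. Then the set $$\left\{(\theta,\omega,x):\ V^{\mathrm{PLL}}(\theta,\omega)\le\bar V,\ V^{\mathrm{CC}}(x)\le\bar V\right\}$$ is an estimation of the lock-in domain of the origin of the system $$\dot x=Ax,\qquad \dot\theta=-k_p f(\theta,\omega,x)+\omega,\qquad \dot\omega=-k_i f(\theta,\omega,x);$$ that is, this set is forward-invariant and every solution starting in it converges to the origin without crossing the lines $\theta=\pm\pi$.
   Context: Notation: $\theta,\omega\in\mathbb{R}$, $x\in\mathbb{R}^4$; $A\in\mathbb{R}^{4\times4}$ is Hurwitz; $k_p>0$, $k_i>0$, $\mu\in\mathbb{R}$, $\mu\neq0$, $\nu\in\mathbb{R}^4$ are constants; $$f(\theta,\omega,x)=\frac{g(\theta,\omega)-h(\omega)^T x}{\mu-\nu^T x},$$ where $g:\mathbb{R}^2\to\mathbb{R}$ and $h:\mathbb{R}\to\mathbb{R}^4$ are given smooth functions, $g$ is $2\pi$-periodic in $\theta$, $g(0,0)=0$, the matrix $h(\omega)\nu^T-\nu h(\omega)^T$ does not depend on $\omega$, and $\nabla_x f$ vanishes nowhere on the domain of $f$. The $(\theta,\omega)$-equations are called the PLL, the $x$-equation the CC. Standing assumption: the Jacobian at $(0,0)$ of the PLL with $x=0$ has non-real eigenvalues with negative real parts. $V^{\mathrm{CC}}(x)=x^TPx$, where $P$ is symmetric positive definite and $A^TP+PA+\gamma P$ is negative definite for some $\gamma>0$; hence $\frac{d}{dt}V^{\mathrm{CC}}\le-\gamma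 V^{\mathrm{CC}}$ along solutions. For $V\ge0$ such that $\{V^{\mathrm{CC}}(x)\le V\}$ contains no point with $\nu^Tx=\mu$, the $V$-comparison system is $\dot\theta=-k_pf_*(\theta,\omega)+\omega$, $\dot\omega=-k_if_*(\theta,\omega)$, with $$f_*(\theta,\omega)=\begin{cases}\min_{V^{\mathrm{CC}}(x)\le V} f(\theta,\omega,x), & \omega\ge0,\\ \max_{V^{\mathrm{CC}}(x)\le V} f(\theta,\omega,x), & \omega<0.\end{cases}$$ Standing assumption: $\bar V>0$ is such that for every $V\in[0,\bar V]$ the $V$-comparison system is defined and has a stable limit cycle going clockwise around the origin (for $V=0$ it reduces to the zero equilibrium), and this limit cycle changes smoothly with $V$ on $[0,\bar V]$. $\Lambda(V)$ denotes the closed region bounded by this limit cycle, and its boundary $\partial\Lambda(V)$ is the limit cycle itself ($\Lambda(0)=\{(0,0)\}$). These limit cycles do not intersect each other, so $\Lambda(V_1)\subset\operatorname{int}\Lambda(V_2)$ for $0\le V_1<V_2\le\bar V$. The function $V^{\mathrm{PLL}}$ is defined on $\Lambda(\bar V)$ by $V^{\mathrm{PLL}}(\theta,\omega)=V$ for all $(\theta,\omega)\in\partial\Lambda(V)$, $V\in[0,\bar V]$; thus $\Lambda(V)=\{V^{\mathrm{PLL}}\le V\}$. A condition on $V^{\mathrm{PLL}}(\theta,\omega)$ includes that $V^{\mathrm{PLL}}$ is defined there. The lock-in domain of the origin is the set of initial conditions $(\theta,\omega,x)$ from which the solution converges to the origin without crossing the lines $\theta=\pm\pi$. An estimation of the lock-in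 domain is a forward-invariant set contained in the lock-in domain. *)

(* Defs.v *)
From HB Require Import structures.
From mathcomp Require Import all_boot all_order all_algebra.
From mathcomp Require Import complex.
From mathcomp Require Import all_classical all_reals all_analysis.
Set Implicit Arguments.
Unset Strict Implicit.
Unset Printing Implicit Defensive.
Import Order.TTheory GRing.Theory Num.Theory.
Import numFieldNormedType.Exports.
Local Open Scope classical_set_scope.
Local Open Scope ring_scope.

Section Generic.
Context {R : realType}.

(* In finite dimension, [Ck k f] says that f is of class C^k: iterated
   directional derivatives up to order k exist and are continuous. *)
Fixpoint Ck (U W : normedModType R) (k : nat) (f : U -> W) : Prop :=
  match k with
  | 0%N => continuous f
  | k'.+1 => (forall x, differentiable f x) /\
             (forall v, Ck k' (fun x => 'D_v f x))
  end.

Definition smooth (U W : normedModType R) (f : U -> W) := forall k, Ck k f.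

Definition cdot n (u v : 'cV[R]_n) : R := (u^T *m v) 0 0.

Definition quad n (M : 'M[R]_n) (x : 'cV[R]_n) : R := (x^T *m M *m x) 0 0.

Definition pos_def n (M : 'M[R]_n) := forall x, x != 0 -> 0 < quad M x.
Definition neg_def n (M : 'M[R]_n) := forall x, x != 0 -> quad M x < 0.

Definition complex_eigenvalue n (M : 'M[R]_n) (l : R[i]) : bool :=
  eigenvalue (map_mx (real_complex R) M) l.

Definition hurwitz n (M : 'M[R]_n) :=
  forall l, complex_eigenvalue M l -> complex.Re l < 0.

Definition gradient n (phi : 'cV[R]_n.+1 -> R) (x : 'cV[R]_n.+1) :
    'cV[R]_n.+1 :=
  \col_i 'D_(delta_mx i 0) phi x.

Definition jacobian_plane (F : R * R -> R * R) (p : R * R) : 'M[R]_2 :=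
  \matrix_(i < 2, j < 2)
    let dF := 'D_(if j == 0 then (1, 0) else (0, 1)) F p in
    if i == 0 then dF.1 else dF.2.

(* Least and greatest element of a set of reals; only meaningful when it is
   attained (below: a continuous function on a nonempty compact set). *)
Definition minimum (S : set R) : R := xget 0 (S `&` lbound S).
Definition maximum (S : set R) : R := xget 0 (S `&` ubound S).

Definition frontier (T : topologicalType) (A : set T) : set T :=
  closure A `\` interior A.

(* The interval [0, tau), tau being finite or +oo. *)
Definition upto (tau : \bar R) : set R := [set t | 0 <= t /\ (t%:E < tau)%E].

(* Solutions of a planar ODE whose right-hand side may be discontinuous:
   continuous functions satisfying the equation on the interval D except at
   isolated instants (such as those at which a discontinuity line is
   crossed). *)
Definition pw_solution (F : R * R -> R * R) (D : set R) (z : R -> R * R) :=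
  {within D, continuous z} /\
  forall a b, `[a, b] `<=` D ->
    exists2 E : set R, finite_set E &
      forall t, a < t < b -> ~ E t -> is_derive t 1 z (F (z t)).

Definition tube (C : set (R * R)) (e : R) : set (R * R) :=
  [set p | exists2 c, C c & `|p - c| < e].

(* The T-periodic curve z winds exactly once clockwise around the origin: in
   polar coordinates its continuous angle a decreases by 2 pi in a period. *)
Definition clockwise_around_origin (z : R -> R * R) (T : R) :=
  exists r a : R -> R,
    [/\ continuous r, continuous a,
        forall t, 0 < r t /\ z t = (r t * cos (a t), r t * sin (a t)) &
        a T = a 0 - 2 * pi].

Definition clockwise_periodic_orbit (F : R * R -> R * R) (C : set (R * R)) :=
  exists (z : R -> R * R) (T : R),
    [/\ 0 < T, pw_solution F setT z, forall t, z (t + T) = z t,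
        {in `[0, T[ &, injective z} &
        range z = C /\ clockwise_around_origin z T].

(* Asymptotic orbital stability; the attraction clause makes a periodic orbit
   isolated, that is, a limit cycle. *)
Definition orbitally_stable (F : R * R -> R * R) (C : set (R * R)) :=
  (forall e, 0 < e -> exists2 d, 0 < d &
     forall tau z, pw_solution F (upto tau) z -> tube C d (z 0) ->
       forall t, upto tau t -> tube C e (z t)) /\
  (exists2 d, 0 < d &
     forall z, pw_solution F (upto +oo%E) z -> tube C d (z 0) ->
       forall e, 0 < e -> \forall t \near +oo, tube C e (z t)).

Definition stable_clockwise_limit_cycle F C :=
  clockwise_periodic_orbit F C /\ orbitally_stable F C.

(* The closed region bounded by C: the curve together with the bounded
   connected components of its complement. *)
Definition closed_region (C : set (R * R)) : set (R * R) :=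
  C `|` [set p | bounded_set (connected_component (~` C) p)].

(* The closed curves C V, 0 <= V <= Vb, change smoothly with V: they have
   1-periodic parametrizations phi V depending continuously on V in [0, Vb]
   and C^oo on V in (0, Vb] (C^oo on (0, Vb] being expressed by a C^oo
   extension to V > 0).  Only continuity is asked at V = 0: there the cycles
   shrink to a point, at the rate sqrt V, so that no parametrization is
   differentiable with respect to V. *)
Definition smooth_family (C : R -> set (R * R)) (Vb : R) :=
  exists phi : R -> R -> R * R,
    [/\ forall V, 0 <= V <= Vb ->
          range (phi V) = C V /\ forall s, phi V (s + 1) = phi V s,
        forall V, 0 < V <= Vb -> {in `[0, 1[ &, injective (phi V)},
        {within [set q : R * R | 0 <= q.1 <= Vb],
           continuous (fun q : R * R => phi q.1 q.2)},
        forall k s V, 0 < V -> derivable (derive1n k (phi ^~ s)) V 1 &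
        forall k (q : R * R), 0 < q.1 ->
          {for q, continuous (fun q : R * R => derive1n k (phi ^~ q.2) q.1)}].

End Generic.

Record params (R : realType) := Params {
  A_ : 'M[R]_4;
  kp : R;
  ki : R;
  mu : R;
  nu : 'cV[R]_4;
  g_ : R -> R -> R;
  h_ : R -> 'cV[R]_4 }.

Section System.
Context {R : realType}.
Implicit Types (s : params R) (P : 'M[R]_4) (V Vb : R).

Definition f_dom s (x : 'cV[R]_4) : bool := cdot (nu s) x != mu s.

(* Only meaningful when [f_dom s x]. *)
Definition f_ s (theta omega : R) (x : 'cV[R]_4) : R :=
  (g_ s theta omega - cdot (h_ s omega) x) / (mu s - cdot (nu s) x).

Definition pll_field s (x : 'cV[R]_4) (p : R * R) : R * R :=
  (- kp s * f_ s p.1 p.2 x + p.2, - ki s * f_ s p.1 p.2 x).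

(* States are ((theta, omega), x). *)
Definition full_field s (q : R * R * 'cV[R]_4) : R * R * 'cV[R]_4 :=
  (pll_field s q.2 q.1, A_ s *m q.2).

Definition admissible s :=
  [/\ hurwitz (A_ s), 0 < kp s, 0 < ki s & mu s != 0] /\
  [/\ smooth (fun p : R * R => g_ s p.1 p.2), smooth (h_ s),
      forall theta omega, g_ s (theta + 2 * pi) omega = g_ s theta omega &
      g_ s 0 0 = 0] /\
  [/\ forall w1 w2, h_ s w1 *m (nu s)^T - nu s *m (h_ s w1)^T
                    = h_ s w2 *m (nu s)^T - nu s *m (h_ s w2)^T,
      forall theta omega x, f_dom s x -> gradient (f_ s theta omega) x != 0 &
      forall l, complex_eigenvalue (jacobian_plane (pll_field s 0) (0, 0)) l ->
        complex.Im l != 0 /\ complex.Re l < 0].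

Definition VCC P (x : 'cV[R]_4) : R := quad P x.

Definition lyapunov_matrix s P :=
  [/\ P^T = P, pos_def P &
      exists2 gamma, 0 < gamma &
        neg_def ((A_ s)^T *m P + P *m A_ s + gamma *: P)].

Definition comparison_defined s P V := forall x, VCC P x <= V -> f_dom s x.

Definition f_star s P V (theta omega : R) : R :=
  let values := [set f_ s theta omega x | x in [set x | VCC P x <= V]] in
  if 0 <= omega then minimum values else maximum values.

Definition comparison_field s P V (p : R * R) : R * R :=
  (- kp s * f_star s P V p.1 p.2 + p.2, - ki s * f_star s P V p.1 p.2).

(* C V is the chosen limit cycle of the V-comparison system, degenerating to
   the zero equilibrium for V = 0.  The last two clauses are properties of
   the plane curves C V recorded with the assumption. *)
Definition limit_cycle_family s P Vb (C : R -> set (R * R)) :=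
  [/\ forall V, 0 <= V <= Vb -> comparison_defined s P V,
      C 0 = [set (0, 0)] /\
      (forall V, 0 < V <= Vb ->
         stable_clockwise_limit_cycle (comparison_field s P V) (C V)),
      smooth_family C Vb,
      forall V, 0 <= V <= Vb -> frontier (closed_region (C V)) = C V &
      forall V1 V2, 0 <= V1 -> V1 < V2 -> V2 <= Vb ->
        C V1 `&` C V2 = set0 /\
        closed_region (C V1) `<=` interior (closed_region (C V2))].

(* vpll is the function with domain closed_region (C Vb) taking the value V
   exactly on the boundary of closed_region (C V); its values outside of this
   domain are irrelevant. *)
Definition is_VPLL (C : R -> set (R * R)) Vb (vpll : R * R -> R) :=
  forall p, closed_region (C Vb) p ->
    forall V, vpll p = V <->
              0 <= V <= Vb /\ frontier (closed_region (C V)) p.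

Definition solution s (tau : \bar R) (z : R -> R * R * 'cV[R]_4) :=
  [/\ {within upto tau, continuous z},
      forall t, upto tau t -> f_dom s (z t).2 &
      forall t, 0 < t -> (t%:E < tau)%E ->
        is_derive t 1 z (full_field s (z t))].

Definition crosses_line (c : R) (u : R -> R) :=
  exists t1 t2, [/\ 0 <= t1, 0 <= t2, u t1 < c & c < u t2].

Definition lock_in_domain s : set (R * R * 'cV[R]_4) :=
  [set q | (exists2 z, solution s +oo%E z & z 0 = q) /\
     forall z, solution s +oo%E z -> z 0 = q ->
       [/\ z t @[t --> +oo] --> ((0, 0, 0) : R * R * 'cV[R]_4),
           ~ crosses_line pi (fun t => (z t).1.1) &
           ~ crosses_line (- pi) (fun t => (z t).1.1)]].

Definition forward_invariant s (S : set (R * R * 'cV[R]_4)) :=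
  forall tau z, solution s tau z -> S (z 0) ->
    forall t, upto tau t -> S (z t).

Definition lock_in_estimation s (S : set (R * R * 'cV[R]_4)) :=
  forward_invariant s S /\ S `<=` lock_in_domain s.

End System.

(* Main.v *)
(** In the coordinates y = theta - (kp / ki) omega, w = omega the PLL reads
    y' = w, w' = - F with F = ki f, and the V-comparison system has for F the
    minimum fm (w >= 0) or the maximum fM (w < 0) of F over the ellipsoid
    VCC <= V.  Hence a limit cycle moves to the right above the line w = 0 and to
    the left below it.  It crosses this line transversally, and a cycle with more
    than two arcs would be a spiral that cannot close; so it consists of two
    graphs L <= U over an interval [a, b], and the region it bounds is the lens
    between them.

    While VCC (x) <= V one has fm <= F <= fM, so the field does not point outwards
    at a nearest point of the lens: the squared distance to the lens satisfies a
    Gronwall inequality and the lens is invariant.  Since VCC (x (t)) tends to 0,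
    the regions of all the levels V eventually become invariant.  If Vinf is the
    infimum of the levels whose region is eventually entered, all cluster points
    of (theta, omega) lie on the cycle of level Vinf; for Vinf > 0 this is
    impossible, because the gradient condition makes the limiting field (x = 0)
    cross this cycle strictly inwards.  So Vinf = 0 and the solution converges. *)
Require Import Defs.
From HB Require Import structures.
From mathcomp Require Import all_boot all_order all_algebra.
From mathcomp Require Import complex.
From mathcomp Require Import all_classical all_reals all_analysis.
From mathcomp Require Import ring lra.
Set Implicit Arguments.
Unset Strict Implicit.
Unset Printing Implicit Defensive.
Import Order.TTheory GRing.Theory Num.Theory.
Import numFieldNormedType.Exports.
Local Open Scope classical_set_scope.
Local Open Scope ring_scope.

(** The combination y = theta - (kp / ki) omega eliminates f, so F enters only the equation of w.
    The velocity being (w, - F), a smaller F points further up: the minimum above w = 0 and the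
    maximum below it are the most outward choices. Extrema over an ellipsoid are only Lipschitz in
    (theta, omega), and the comparison field jumps on w = 0. Hence the function whose level sets are
    the cycles is never differentiated: it only assigns a level to each point, and its decrease is
    replaced by the invariance of the regions together with a study of cluster points. The delicate
    points are the two tips on w = 0, where the field jumps and the boundary is vertical. The
    central symmetry [flip] exchanges fm and fM, so that mostly upper arcs and left ends need a
    direct treatment. The lock-in domain also asks for a global solution, although f is only locally
    Lipschitz in (theta, omega); the invariance is therefore proved for a field with truncated
    coordinates, and existence follows from it. *)

Section Calculus.
Context {R : realType}.
Implicit Types (f : R -> R) (a b t x e : R).

Lemma continuous_epsP f x :
  {for x, continuous f} <->
  forall e, 0 < e -> exists2 d : R, 0 < d &
    forall t, `|t - x| < d -> `|f t - f x| < e.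
Proof.
split.
  move=> /cvgrPdist_lt cf e e0; have /nbhs_ballP[d /= d0 H] := cf e e0.
  exists d => // t tx; rewrite distrC; apply: H.
  by rewrite /ball/= distrC.
move=> H; apply/cvgrPdist_lt => e e0; have [d d0 {}H] := H e e0.
apply/nbhs_ballP; exists d => // t; rewrite /ball/= distrC => tx.
by rewrite distrC; exact: H.
Qed.

Lemma is_derive_epsP f x l :
  is_derive x 1 f l <->
  forall e, 0 < e -> exists2 d : R, 0 < d &
    forall h, `|h| < d -> `|f (x + h) - f x - l * h| <= e * `|h|.
Proof.
split.
  move=> [+ <-]; rewrite /derivable /derive /= => /cvgrPdist_le H e e0.
  have /nbhs_ballP[d /= d0 {}H] := H e e0.
  exists d => // h hd; have [->|h0] := eqVneq h 0.
    by rewrite addr0 subrr mulr0 subr0 normr0 mulr0.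
  have := H h; rewrite /ball/= sub0r normrN => /(_ hd h0).
  rewrite -[X in _ * X + x]/1 mulr1 [h + x]addrC /GRing.scale /=.
  set l0 := lim _; move=> H1.
  have -> : f (x + h) - f x - l0 * h = - ((l0 - h^-1 * (f (x + h) - f x)) * h).
    by field.
  by rewrite normrN normrM ler_pM2r// normr_gt0.
move=> H.
have cv : (fun h => h^-1 *: ((f \o shift x) (h *: 1) - f x)) @ 0^' --> l.
  apply/cvgrPdist_le => e e0; have [d d0 {}H] := H e e0.
  apply/nbhs_ballP; exists d => // h /=; rewrite /ball/= sub0r normrN => hd h0.
  rewrite -[X in _ * X + x]/1 mulr1 [h + x]addrC /GRing.scale /=.
  have -> : l - h^-1 * (f (x + h) - f x) = - ((f (x + h) - f x - l * h) / h).
    by field.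
  rewrite normrN normrM normfV ler_pdivrMr ?normr_gt0//; exact: H.
apply: DeriveDef; first by apply/cvg_ex; exists l.
exact: (cvg_lim _ cv).
Qed.

Lemma is_derive_local f g x l e : 0 < e ->
  (forall t, `|t - x| < e -> f t = g t) -> is_derive x 1 f l ->
  is_derive x 1 g l.
Proof.
move=> e0 fg /is_derive_epsP H; apply/is_derive_epsP => e' e'0.
have [d d0 {}H] := H e' e'0; exists (Num.min d e); first by rewrite lt_min d0.
move=> h; rewrite lt_min => /andP[hd he]; rewrite -!fg ?subrr ?normr0 //.
  exact: H.
by rewrite addrC addKr.
Qed.

Lemma mean_value f (df : R -> R) a b : a < b -> continuous f ->
  (forall t, a < t < b -> is_derive t 1 f (df t)) ->
  exists2 c : R, a < c < b & f b - f a = df c * (b - a).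
Proof.
move=> ab cf dfE; have dfE' c : c \in `]a, b[ -> is_derive c 1 f (df c).
  by rewrite in_itv => /dfE.
have [c cab E] := MVT ab dfE' (continuous_subspaceT cf).
by exists c => //; move: cab; rewrite in_itv.
Qed.

Lemma derive_ge0_le f a b : a <= b -> continuous f ->
  (forall t, a < t < b -> exists2 l : R, is_derive t 1 f l & 0 <= l) -> f a <= f b.
Proof.
rewrite le_eqVlt => /orP[/eqP-> //|ab] cf H.
have [t|c cab E] := @mean_value f (fun t => 'D_1 f t) a b ab cf.
  by move=> /H[l fl _]; exact/derivableP/ex_derive.
have [l fl l0] := H c cab; rewrite -subr_ge0 E mulr_ge0 //; last by rewrite subr_ge0 ltW.
by rewrite (@derive_val _ _ _ _ _ _ _ fl).
Qed.

Lemma derive_gt0_lt f a b : a < b -> continuous f ->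
  (forall t, a < t < b -> exists2 l : R, is_derive t 1 f l & 0 < l) -> f a < f b.
Proof.
move=> ab cf H.
have [t|c cab E] := @mean_value f (fun t => 'D_1 f t) a b ab cf.
  by move=> /H[l fl _]; exact/derivableP/ex_derive.
have [l fl l0] := H c cab; rewrite -subr_gt0 E mulr_gt0 ?subr_gt0//.
by rewrite (@derive_val _ _ _ _ _ _ _ fl).
Qed.

Lemma derive_le0_ge f a b : a <= b -> continuous f ->
  (forall t, a < t < b -> exists2 l : R, is_derive t 1 f l & l <= 0) -> f b <= f a.
Proof.
move=> ab cf H; rewrite -lerN2; apply: (@derive_ge0_le (fun t => - f t)) => //.
  by move=> t; apply: continuousN; exact: cf.
by move=> t /H[l fl l0]; exists (- l); [exact: is_deriveN|rewrite oppr_ge0].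
Qed.

Lemma derive_lt0_gt f a b : a < b -> continuous f ->
  (forall t, a < t < b -> exists2 l : R, is_derive t 1 f l & l < 0) -> f b < f a.
Proof.
move=> ab cf H; rewrite -ltrN2; apply: (@derive_gt0_lt (fun t => - f t)) => //.
  by move=> t; apply: continuousN; exact: cf.
by move=> t /H[l fl l0]; exists (- l); [exact: is_deriveN|rewrite oppr_gt0].
Qed.

(** The mean value theorem on either side of x. This fills in the isolated instants at which a
    piecewise solution satisfies no equation, wherever the right-hand side is continuous along the
    curve. *)
Lemma derive_punctured f (df : R -> R) x e : 0 < e -> continuous f ->
  (forall t, 0 < `|t - x| < e -> is_derive t 1 f (df t)) ->
  {for x, continuous df} -> is_derive x 1 f (df x).
Proof.
move=> e0 cf dfE /continuous_epsP cdf; apply/is_derive_epsP => r r0.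
have [d d0 {}cdf] := cdf r r0; exists (Num.min d e); first by rewrite lt_min d0.
move=> h; rewrite lt_min => /andP[hd he].
suff [c cx E] : exists2 c, `|c - x| <= `|h| & f (x + h) - f x = df c * h.
  rewrite E -mulrBl normrM ler_wpM2r// ltW// cdf//; exact: le_lt_trans hd.
have [h0|h0|->] := ltrgt0P h; last first.
- by exists x; rewrite ?subrr ?normr0 // addr0 subrr mulr0.
- have [|t /andP[t1 t2]|c /andP[t1 t2] E] := @mean_value f df (x + h) x _ cf.
  + by lra.
  + by apply: dfE; move: he; rewrite (ltr0_norm h0) ltr0_norm; lra.
  + exists c; last by rewrite -opprB E; ring.
    by rewrite ltr0_norm; lra.
- have [|t /andP[t1 t2]|c /andP[t1 t2] E] := @mean_value f df x (x + h) _ cf.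
  + by lra.
  + by apply: dfE; move: he; rewrite (gtr0_norm h0) gtr0_norm; lra.
  + exists c; last by rewrite E; ring.
    by rewrite gtr0_norm; lra.
Qed.

Lemma gronwall f k a b : a <= b -> continuous f ->
  (forall t, a < t < b -> exists2 l : R, is_derive t 1 f l & l <= k * f t) ->
  f b <= f a * expR (k * (b - a)).
Proof.
move=> ab cf H.
have ce : continuous (fun t => expR (- k * (t - a))).
  move=> t; apply: (@continuous_comp _ _ _ (fun t => - k * (t - a)) expR).
    by apply: cvgM; [exact: cvg_cst|apply: cvgB; [exact: cvg_id|exact: cvg_cst]].
  exact: continuous_expR.
suff : f b * expR (- k * (b - a)) <= f a * expR (- k * (a - a)).
  rewrite subrr mulr0 expR0 mulr1 mulNr expRN ler_pdivrMr// expR_gt0//.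
apply: (@derive_le0_ge (fun t => f t * expR (- k * (t - a)))) => //.
  by move=> t; exact: (continuousM (cf t) (ce t)).
move=> t /H[l fl lk]; exists ((l - k * f t) * expR (- k * (t - a))).
  have de : is_derive t 1 (fun t => expR (- k * (t - a)))
                      (- k * expR (- k * (t - a))).
    have dl : is_derive t 1 (fun t => - k * (t - a)) (- k).
      apply/is_derive_epsP => e e0; exists 1 => // h _.
      rewrite (_ : _ - _ - _ = 0); last by ring.
      by rewrite normr0 mulr_ge0// ltW.
    have := @is_derive1_comp R expR (fun t => - k * (t - a)) t _ _
      (is_derive_expR _) dl.
    by rewrite mulrC.
  have dM := is_deriveM fl de.
  apply: is_derive_eq dM _ => /=; rewrite /GRing.scale /=; ring.
by rewrite mulr_le0_ge0 ?expR_ge0// subr_le0.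
Qed.

Lemma first_zero f a b : a < b -> continuous f -> 0 < f a -> f b <= 0 ->
  exists c, [/\ a < c <= b, f c = 0 & forall t, a <= t < c -> 0 < f t].
Proof.
move=> ab cf fa fb.
pose S := [set t | a <= t <= b /\ forall s, a <= s <= t -> 0 < f s].
have Sa : S a.
  split; first by rewrite lexx ltW.
  by move=> s; rewrite -eq_le => /eqP <-.
have hS : has_sup S by split; [exists a|exists b => t [/andP[]]].
set c := sup S.
have ac : a <= c by apply: ub_le_sup => //; case: hS.
have cb : c <= b by apply: ge_sup; [exists a|move=> t [/andP[]]].
have fpos t : a <= t < c -> 0 < f t.
  move=> /andP[at_ tc]; have ct0 : 0 < c - t by lra.
  have [s [sab Hs] ts] := sup_adherent ct0 hS; apply: Hs; rewrite at_ /=.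
  by rewrite ltW//; move: ts; rewrite -/c; lra.
have fc0 : f c = 0.
  apply/eqP; case: (ltrgtP (f c) 0) => // fc; exfalso.
    have /continuous_epsP/(_ (- f c)) := cf c.
    case=> [|d d0 H]; first by rewrite oppr_gt0.
    have ac' : a < c.
      rewrite lt_neqAle ac andbT; apply/eqP => E; move: fc fa; rewrite -E; lra.
    have := fpos (Num.max a (c - d / 2)); rewrite le_max lexx gt_max ac' /=.
    move=> /(_ ltac:(lra)); have := H (Num.max a (c - d / 2)).
    set m := Num.max _ _.
    have mc : m < c by rewrite gt_max ac'; lra.
    have mc' : c - d / 2 <= m by rewrite le_max lexx orbT.
    rewrite ltr0_norm; last lra.
    move=> /(_ ltac:(lra)); rewrite ltr_norml => /andP[]; lra.
  have /continuous_epsP/(_ (f c)) := cf c.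
  case=> // d d0 H.
  have cb' : c < b.
    rewrite lt_neqAle cb andbT; apply/eqP => E; move: fc fb; rewrite -E; lra.
  pose m := Num.min b (c + d / 2).
  have mc : c < m by rewrite lt_min cb'; lra.
  have mc' : m <= c + d / 2 by rewrite ge_min lexx orbT.
  suff : m <= c by lra.
  apply: ub_le_sup; first by case: hS.
  split; first by rewrite ge_min lexx /= andbT; lra.
  move=> s /andP[as_ sm]; have [sc|cs] := ltP s c; first by apply: fpos; rewrite as_.
  have := H s; rewrite ger0_norm; last lra.
  move=> /(_ ltac:(lra)); rewrite ltr_norml => /andP[]; lra.
exists c; split=> //; rewrite cb andbT lt_neqAle ac andbT.
by apply/eqP => E; move: fa; rewrite E fc0 ltxx.
Qed.

Lemma continuous_bounded f a b : continuous f ->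
  exists M : R, forall t, a <= t <= b -> `|f t| <= M.
Proof.
move=> cf; have [ab|ba] := leP a b; last by exists 0 => t; lra.
have cn : continuous (fun s => `|f s|).
  by move=> s; apply: continuous_comp; [exact: cf|exact: norm_continuous].
have [c _ Hc] := EVT_max ab (continuous_subspaceT cn).
by exists `|f c| => s sd; apply: Hc; rewrite in_itv.
Qed.

Lemma derive_right_ge f x l e : is_derive x 1 f l -> 0 < e ->
  (forall t, x < t < x + e -> f x <= f t) -> 0 <= l.
Proof.
move=> /is_derive_epsP fl e0 H; rewrite leNgt; apply/negP => l0.
have [d d0 {}fl] := fl (- l / 2) ltac:(lra).
pose h := Num.min d e / 2.
have h0 : 0 < Num.min d e by rewrite lt_min d0.
have hd : Num.min d e <= d by rewrite ge_min lexx.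
have he : Num.min d e <= e by rewrite ge_min lexx orbT.
have hh : `|h| = h by rewrite gtr0_norm// /h; lra.
have := fl h; rewrite hh => /(_ ltac:(rewrite /h; lra)).
have := H (x + h) ltac:(rewrite /h; lra).
rewrite ler_norml => fxh /andP[_].
have : l * h < 0 by rewrite nmulr_rlt0// /h; lra.
rewrite mulrAC -!mulNr; lra.
Qed.

Lemma is_derive_add f g t l m : is_derive t 1 f l -> is_derive t 1 g m ->
  is_derive t 1 (fun s => f s + g s) (l + m).
Proof. exact: is_deriveD. Qed.

Lemma is_derive_opp f t l : is_derive t 1 f l ->
  is_derive t 1 (fun s => - f s) (- l).
Proof. exact: is_deriveN. Qed.

Lemma is_derive_sub f g t l m : is_derive t 1 f l -> is_derive t 1 g m ->
  is_derive t 1 (fun s => f s - g s) (l - m).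
Proof. exact: is_deriveB. Qed.

Lemma is_derive_mul f g t l m : is_derive t 1 f l -> is_derive t 1 g m ->
  is_derive t 1 (fun s => f s * g s) (l * g t + f t * m).
Proof.
move=> fl gm; apply: (is_derive_eq (is_deriveM fl gm)).
by rewrite /GRing.scale /=; ring.
Qed.

Lemma is_derive_const (c t : R) : is_derive t 1 (fun=> c : R) 0.
Proof. exact: is_derive_cst. Qed.

Lemma is_derive_affine f (c d t l : R) : is_derive (c * t + d) 1 f l ->
  is_derive t 1 (fun s => f (c * s + d)) (c * l).
Proof.
move=> fl; have dl : is_derive t 1 (fun s => c * s + d) c.
  have := is_derive_add (is_derive_mul (is_derive_const c t) (is_derive_id t 1))
    (is_derive_const d t).
  by rewrite mul0r add0r mulr1 addr0.
rewrite mulrC.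
exact: (@is_derive1_comp _ f (fun s => c * s + d)).
Qed.

Lemma continuous_affine f (c d : R) :
  continuous f -> continuous (fun s => f (c * s + d)).
Proof.
move=> cf t; apply: (@continuous_comp _ _ _ (fun s => c * s + d) f); last exact: cf.
by apply: cvgD; [apply: cvgM; [exact: cvg_cst|exact: cvg_id]|exact: cvg_cst].
Qed.

(** Continuous induction: the supremum of the times with f >= 0 is again such a time, and the
    hypothesis pushes it further to the right. *)
Lemma stay_ge0 f a b : continuous f -> 0 <= f a ->
  (forall t, a <= t < b -> 0 <= f t ->
    exists2 e : R, 0 < e & forall s, t < s < t + e -> 0 <= f s) ->
  forall t, a <= t <= b -> 0 <= f t.
Proof.
move=> cf fa H t /andP[at_ tb]; rewrite leNgt; apply/negP => ft.
pose S := [set s | a <= s <= t /\ 0 <= f s].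
have Sa : S a by rewrite /S/= lexx.
have hS : has_sup S by split; [exists a|exists t => s [/andP[]]].
set c := sup S.
have ac : a <= c by apply: ub_le_sup => //; case: hS.
have ct : c <= t by apply: ge_sup; [exists a|move=> s [/andP[]]].
have fc : 0 <= f c.
  rewrite leNgt; apply/negP => fc.
  have [] := (continuous_epsP f c).1 (cf c) (- f c); first by rewrite oppr_gt0.
  move=> d d0 Hd; have [s [/andP[as_ st] fs] cs] := sup_adherent d0 hS.
  have sc : s <= c by apply: ub_le_sup; [case: hS|rewrite /S/= as_].
  have /Hd : `|s - c| < d by rewrite ler0_norm; move: cs; rewrite -/c; lra.
  by rewrite ltr_norml => /andP[]; lra.
have ct' : c < t.
  by rewrite lt_neqAle ct andbT; apply/eqP => E; move: fc; rewrite E; lra.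
have [|e e0 He] := H c _ fc; first by rewrite ac; lra.
pose m := Num.min e (t - c).
have m0 : 0 < m by rewrite lt_min e0; lra.
have me : m <= e by rewrite ge_min lexx.
have mt : m <= t - c by rewrite ge_min lexx orbT.
suff : c + m / 2 <= c by lra.
apply: ub_le_sup; first by case: hS.
by split; [|apply: He]; lra.
Qed.

Lemma periodic_int (X : Type) (f : R -> X) (T : R) : (forall t, f (t + T) = f t) ->
  forall (k : int) t, f (t + k%:~R * T) = f t.
Proof.
move=> pf; have natp (n : nat) r : f (r + n%:R * T) = f r.
  elim: n => [|n IH]; first by rewrite mul0r addr0.
  by rewrite -addn1 natrD mulrDl mul1r addrA pf.
case=> n r; first exact: natp.
rewrite NegzE mulrNz mulNr.
by have := natp n.+1 (r - n.+1%:R * T); rewrite subrK.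
Qed.

Lemma periodic_reduce (X : Type) (f : R -> X) (T c t : R) : 0 < T ->
  (forall t, f (t + T) = f t) ->
  exists k : int, c <= t + k%:~R * T < c + T /\ f (t + k%:~R * T) = f t.
Proof.
move=> T0 pf; pose k := Num.floor ((t - c) / T).
have kle : k%:~R * T <= t - c by rewrite -ler_pdivlMr// ge_floor.
have klt : t - c < (k + 1)%:~R * T by rewrite -ltr_pdivrMr// floorD1_gt.
rewrite intrD mulrDl mul1r in klt.
exists (- k); split; last exact: periodic_int.
by rewrite mulrNz mulNr; lra.
Qed.

(** Used in time, to extend a trajectory by constants beyond an interval, and in space, to truncate
    a field to a box. *)
Definition clamp a b t := Num.max a (Num.min b t).

Lemma clamp_id a b t : a <= t <= b -> clamp a b t = t.
Proof. by move=> /andP[at_ tb]; rewrite /clamp min_r// max_r. Qed.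

Lemma clamp_itv a b t : a <= b -> a <= clamp a b t <= b.
Proof.
by move=> ab; rewrite /clamp le_max lexx /= ge_max ab /= ge_min lexx.
Qed.

Lemma clamp_lip a b s t : `|clamp a b s - clamp a b t| <= `|s - t|.
Proof.
apply: (@le_trans _ _ `|Num.min b s - Num.min b t|); rewrite /clamp.
  move: (Num.min b s) (Num.min b t) => u v.
  by case: (lerP a u) => ?; case: (lerP a v) => ?;
    rewrite ler_norml; apply/andP; split; case: (ltrgt0P (u - v)); lra.
by case: (lerP b s) => ?; case: (lerP b t) => ?;
  rewrite ler_norml; apply/andP; split; case: (ltrgt0P (s - t)); lra.
Qed.

Lemma continuous_clamp a b : continuous (clamp a b).
Proof.
move=> x; apply/continuous_epsP => e e0; exists e => // t; apply: le_lt_trans.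
exact: clamp_lip.
Qed.

End Calculus.

(** * Limit cycles of y' = w, w' = - F as pairs of graphs *)

Section Cycle.
Context {R : realType}.
Implicit Types (F fm fM : R -> R -> R) (y w : R -> R) (s t e l c x : R).

(** The regularity that survives a minimum or maximum over x, which need not be differentiable. *)
Definition box_lipschitz F := forall M : R, exists2 L : R, 0 <= L &
  forall p q p' q', `|p| <= M -> `|q| <= M -> `|p'| <= M -> `|q'| <= M ->
    `|F p q - F p' q'| <= L * (`|p - p'| + `|q - q'|).

Lemma box_lipschitz_cont F (T : topologicalType) (u v : T -> R) (t : T) :
  box_lipschitz F -> {for t, continuous u} -> {for t, continuous v} ->
  {for t, continuous (fun s : T => F (u s) (v s))}.
Proof.
move=> lF cu cv; have [L L0 HL] := lF (Num.max `|u t| `|v t| + 1).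
apply/cvgrPdist_lt => e e0.
pose d := Num.min 1 (e / (2 * L + 1)).
have d0 : 0 < d by rewrite lt_min ltr01 divr_gt0//; lra.
have d1 : d <= 1 by rewrite ge_min lexx.
have dL : d * (2 * L + 1) <= e.
  by rewrite -ler_pdivlMr; [rewrite ge_min lexx orbT|lra].
move/cvgrPdist_lt: cu => /(_ _ d0) cu; move/cvgrPdist_lt: cv => /(_ _ d0) cv.
near=> s.
have us : `|u t - u s| < d by near: s.
have vs : `|v t - v s| < d by near: s.
have le1 (p q m : R) : `|p - q| < d -> `|p| <= m -> `|q| <= m + 1.
  move=> pq pm; have := ler_normD p (q - p); rewrite addrC subrK distrC; lra.
have m1 : `|u t| <= Num.max `|u t| `|v t| by rewrite le_max lexx.
have m2 : `|v t| <= Num.max `|u t| `|v t| by rewrite le_max lexx orbT.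
apply: le_lt_trans (HL _ _ _ _ _ _ (le1 _ _ _ us m1) (le1 _ _ _ vs m2)) _.
- lra.
- lra.
have [->|Lpos] := eqVneq L 0; first by rewrite mul0r.
have L1 : 0 < L by rewrite lt_neqAle eq_sym Lpos.
have : L * (`|u t - u s| + `|v t - v s|) < L * (2 * d) by rewrite ltr_pM2l//; lra.
nra.
Unshelve. all: by end_near. Qed.

(** Conjugation by (y, w) |-> (- y, - w), which preserves y' = w and exchanges minimum and
    maximum. *)
Definition flip F := fun p q => - F (- p) (- q).

Lemma flip_lipschitz F : box_lipschitz F -> box_lipschitz (flip F).
Proof.
move=> lF M; have [L L0 HL] := lF M; exists L => // p q p' q' h1 h2 h3 h4.
rewrite /flip -opprD normrN.
have := HL (- p) (- q) (- p') (- q'); rewrite !normrN => /(_ h1 h2 h3 h4).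
by rewrite -!opprD !normrN.
Qed.

(* In the coordinates y = theta - (kp / ki) * omega and w = omega the cycle of
   the comparison system solves y' = w, w' = - fm for w > 0 and w' = - fM for
   w < 0.  Allowing both slopes on the line w = 0 makes the notion invariant
   under the symmetry (y, w, fm, fM) |-> (- y, - w, flip fM, flip fm). *)
Record comparison_cycle fm fM (T : R) y w : Prop := ComparisonCycle {
  cc_lipm : box_lipschitz fm;
  cc_lipM : box_lipschitz fM;
  cc_lt : forall x v, fm x v < fM x v;
  cc_conty : continuous y;
  cc_contw : continuous w;
  cc_T : 0 < T;
  cc_pery : forall t, y (t + T) = y t;
  cc_perw : forall t, w (t + T) = w t;
  cc_inj : forall s t, 0 < `|s - t| < T -> y s = y t -> w s = w t -> False;
  cc_ode : forall t0 : R, exists2 e : R, 0 < e & forall t : R, 0 < `|t - t0| < e ->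
    is_derive t 1 y (w t) /\
    exists2 F : R, is_derive t 1 w (- F) &
      [/\ 0 < w t -> F = fm (y t) (w t), w t < 0 -> F = fM (y t) (w t) &
          w t = 0 -> F = fm (y t) (w t) \/ F = fM (y t) (w t)] }.

Lemma cycle_flip fm fM T y w : comparison_cycle fm fM T y w ->
  comparison_cycle (flip fM) (flip fm) T (fun t => - y t) (fun t => - w t).
Proof.
case=> lm lM lt cy cw T0 py pw inj ode; split => //.
- exact: flip_lipschitz.
- exact: flip_lipschitz.
- by move=> x v; rewrite /flip ltrN2.
- by move=> t; apply: continuousN; exact: cy.
- by move=> t; apply: continuousN; exact: cw.
- by move=> t; rewrite py.
- by move=> t; rewrite pw.
- by move=> s t st /oppr_inj ? /oppr_inj; exact: (inj s t).
- move=> t0; have [e e0 H] := ode t0; exists e => // t /H[dy [F dw [F1 F2 F3]]].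
  split; first exact: is_derive_opp.
  exists (- F); first exact: is_derive_opp.
  rewrite /flip !opprK oppr_gt0 oppr_lt0; split=> [/F2->|/F1->|/eqP] //.
  by rewrite oppr_eq0 => /eqP/F3[] ->; [right|left].
Qed.

Lemma cycle_shift fm fM T y w c : comparison_cycle fm fM T y w ->
  comparison_cycle fm fM T (fun t => y (t + c)) (fun t => w (t + c)).
Proof.
case=> lm lM lt cy cw T0 py pw inj ode; split => //.
- by move=> t; have := continuous_affine (c := 1) (d := c) cy (x := t);
     under eq_fun do rewrite mul1r.
- by move=> t; have := continuous_affine (c := 1) (d := c) cw (x := t);
     under eq_fun do rewrite mul1r.
- by move=> t; rewrite addrAC py.
- by move=> t; rewrite addrAC pw.
- move=> s t st; apply: inj; by rewrite (_ : _ - _ = s - t)//; ring.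
- have dsh (f : R -> R) t l : is_derive (t + c) 1 f l ->
      is_derive t 1 (fun t => f (t + c)) l.
    rewrite -{1}[t]mul1r => /is_derive_affine; rewrite mul1r.
    by under eq_fun do rewrite mul1r.
  move=> t0; have [e e0 H] := ode (t0 + c); exists e => // t tt0.
  have /H[dy [F dw Fw]] : 0 < `|t + c - (t0 + c)| < e.
    by rewrite (_ : _ - _ = t - t0)//; ring.
  by split; [exact: dsh|exists F => //; exact: dsh].
Qed.

Section OneCycle.
Variables (fm fM : R -> R -> R) (T : R) (y w : R -> R).
Hypothesis cyc : comparison_cycle fm fM T y w.

Lemma cycle_derive_y t : is_derive t 1 y (w t).
Proof.
have cy := cc_conty cyc; have cw := cc_contw cyc.
have [e e0 H] := cc_ode cyc t; apply: (derive_punctured e0 cy); last exact: cw.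
by move=> s /H[].
Qed.

Lemma cycle_derive_w_pos t : 0 < w t -> is_derive t 1 w (- fm (y t) (w t)).
Proof.
have cy := cc_conty cyc; have cw := cc_contw cyc.
move=> wt; have [e e0 H] := cc_ode cyc t.
have /continuous_epsP/(_ _ wt)[d d0 Hd] := cw t.
have m0 : 0 < Num.min e d by rewrite lt_min e0.
apply: (@derive_punctured _ _ (fun t => - fm (y t) (w t)) _ _ m0 cw).
  move=> s; rewrite lt_min => /and3P[s0 se /Hd].
  rewrite ltr_norml => /andP[ws _].
  have ws' : 0 < w s by lra.
  have /H[_ [F dF [+ _ _]]] : 0 < `|s - t| < e by rewrite s0.
  by move=> /(_ ws') <-.
by apply: continuousN; apply: box_lipschitz_cont (cc_lipm cyc) (cy t) (cw t).
Qed.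

(** Near t0 both fm and fM are negative, so w' > 0 whichever slope applies: the jump of the field is
    harmless. *)
Lemma cycle_up t0 : w t0 = 0 -> fM (y t0) 0 < 0 ->
  exists2 e : R, 0 < e & (forall t, t0 < t < t0 + e -> 0 < w t) /\
                     (forall t, t0 - e < t < t0 -> w t < 0).
Proof.
have cy := cc_conty cyc; have cw := cc_contw cyc.
move=> w0 fM0.
have cFM := box_lipschitz_cont (cc_lipM cyc) (cy t0) (cw t0).
have [] := (continuous_epsP _ t0).1 cFM (- fM (y t0) 0); first lra.
move=> d d0 Hd; have [e e0 H] := cc_ode cyc t0.
pose m := Num.min e d.
have m0 : 0 < m by rewrite lt_min e0.
have dw t : 0 < `|t - t0| < m -> exists2 l : R, is_derive t 1 w l & 0 < l.
  rewrite lt_min => /and3P[t1 te /Hd]; rewrite w0 ltr_norml => /andP[_ fMt].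
  have /H[_ [F dF Fw]] : 0 < `|t - t0| < e by rewrite t1.
  exists (- F) => //; have := cc_lt cyc (y t) (w t).
  case: Fw; case: (ltrgt0P (w t)) => wt F1 F2 F3.
  - by rewrite F1//; lra.
  - by rewrite F2//; lra.
  - by case: (F3 wt) => ->; lra.
exists m => //; split=> t /andP[ta tb].
  rewrite -w0; apply: (derive_gt0_lt ta cw) => s /andP[s1 s2].
  by apply: dw; rewrite gtr0_norm; lra.
rewrite -w0; apply: (derive_gt0_lt tb cw) => s /andP[s1 s2].
by apply: dw; rewrite ltr0_norm; lra.
Qed.

End OneCycle.

Lemma cycle_derive_w_neg fm fM T y w t : comparison_cycle fm fM T y w ->
  w t < 0 -> is_derive t 1 w (- fM (y t) (w t)).
Proof.
move=> /cycle_flip cyc wt.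
have := cycle_derive_w_pos cyc (t := t); rewrite oppr_gt0 => /(_ wt).
move=> /is_derive_opp; rewrite /flip !opprK.
by under eq_fun do rewrite opprK.
Qed.

Lemma cycle_down fm fM T y w t0 : comparison_cycle fm fM T y w ->
  w t0 = 0 -> 0 < fm (y t0) 0 ->
  exists2 e : R, 0 < e & (forall t, t0 < t < t0 + e -> w t < 0) /\
                     (forall t, t0 - e < t < t0 -> 0 < w t).
Proof.
move=> /cycle_flip cyc w0 fm0.
have [||e e0 [H1 H2]] := cycle_up cyc (t0 := t0).
- by rewrite w0 oppr0.
- by rewrite /flip opprK oppr0; lra.
exists e => //; split=> t /[dup] te; first by move=> /H1; rewrite oppr_gt0.
by move=> /H2; rewrite oppr_lt0.
Qed.

End Cycle.

(** * Transversality to the line w = 0, and arcs as graphs *)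

Section Transversality.
Context {R : realType}.
Implicit Types (F fm fM : R -> R -> R) (y w : R -> R) (s t e l c x : R).

(* Backward uniqueness: a point of the line w = 0 where fm = 0 would be an
   equilibrium of the Lipschitz field of the half-plane w >= 0, in which the
   cycle arrives. *)
Lemma cycle_no_rest fm fM (T : R) y w t0 : comparison_cycle fm fM T y w ->
  w t0 = 0 -> fm (y t0) 0 <= 0 -> 0 < fM (y t0) 0 -> False.
Proof.
move=> cyc w0 fm0 fM0.
have cy := cc_conty cyc; have cw := cc_contw cyc.
have cFM := box_lipschitz_cont (cc_lipM cyc) (cy t0) (cw t0).
have [] := (continuous_epsP _ t0).1 cFM (fM (y t0) 0); first lra.
rewrite w0 => d1 d10 Hd1; have [e e0 H] := cc_ode cyc t0.
(* The bound by T lets the final coincidence of the states at t1 and t0 contradict injectivity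
   within one period. *)
pose d := Num.min (Num.min e d1) T.
have d0 : 0 < d by rewrite !lt_min e0 d10 (cc_T cyc).
have dT : d <= T by rewrite ge_min lexx orbT.
have de : d <= e by rewrite /d !ge_min lexx.
have dd1 : d <= d1 by rewrite /d !ge_min lexx orbT.
have fMpos t : t0 - d < t <= t0 -> 0 < fM (y t) (w t).
  move=> td; have /Hd1 : `|t - t0| < d1.
    by rewrite ler0_norm; lra.
  by rewrite ltr_norml; lra.
(* A negative value would persist: there w' = - fM < 0, so w could not be back at 0 at time t0. *)
have wge t : t0 - d < t < t0 -> 0 <= w t.
  move=> td; rewrite leNgt; apply/negP => wt.
  have [||||c [tc wc H2]] := @first_zero _ (fun t => - w t) t t0.
  - by lra.
  - by move=> s; apply: continuousN; exact: cw.
  - by rewrite oppr_gt0.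
  - by rewrite w0 oppr0.
  suff : w c < w t by lra.
  apply: (derive_lt0_gt _ cw); first lra.
  move=> s sc; have ws : w s < 0 by have := H2 s ltac:(lra); lra.
  exists (- fM (y s) (w s)); first exact: cycle_derive_w_neg cyc ws.
  by rewrite oppr_lt0; apply: fMpos; lra.
have dw t : t0 - d < t < t0 -> is_derive t 1 w (- fm (y t) (w t)).
  move=> td; have /H[_ [F dF [F1 F2 F3]]] : 0 < `|t - t0| < e.
    by rewrite ltr0_norm; lra.
  have wt := wge t td; have [w0t|w0t] := ltP 0 (w t).
    by rewrite -F1.
  have {w0t}wt0 : w t = 0 by apply: le_anti; rewrite w0t.
  (* At a zero of w the slope - fM < 0 would make w negative just afterwards. *)
  case: (F3 wt0) => [<- //|FE]; have := fMpos t ltac:(lra).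
  have : 0 <= - F.
    apply: (derive_right_ge dF (e := t0 - t)); first lra.
    by move=> s ts; rewrite wt0; apply: wge; lra.
  by rewrite FE; lra.
have [fm1|fm1] := ltP (fm (y t0) 0) 0.
  have cFm := box_lipschitz_cont (cc_lipm cyc) (cy t0) (cw t0).
  have [] := (continuous_epsP _ t0).1 cFm (- fm (y t0) 0); first lra.
  rewrite w0 => d2 d20 Hd2; pose t1 := t0 - Num.min d d2 / 2.
  have m0 : 0 < Num.min d d2 by rewrite lt_min d0.
  have md : Num.min d d2 <= d by rewrite ge_min lexx.
  have md2 : Num.min d d2 <= d2 by rewrite ge_min lexx orbT.
  have : 0 <= w t1 by apply: wge; rewrite /t1; lra.
  suff : w t1 < w t0 by lra.
  apply: (derive_gt0_lt _ cw); first by rewrite /t1; lra.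
  move=> s sc; exists (- fm (y s) (w s)); first by apply: dw; rewrite /t1 in sc; lra.
  have /Hd2 : `|s - t0| < d2 by rewrite ler0_norm; rewrite /t1 in sc; lra.
  by rewrite ltr_norml; lra.
have {fm0 fm1} fm0 : fm (y t0) 0 = 0 by apply: le_anti; rewrite fm0.
(* Squared distance to the rest point in reversed time. The rate 1 + 3 L comes from 2 |a| |b| <= a^2
   + b^2. Vanishing at t0, it vanishes before t0 as well, so the cycle would stand still. *)
pose E s := (y (- s) - y t0) * (y (- s) - y t0) + w (- s) * w (- s).
have [M HM] : exists M : R, forall s, t0 - d <= s <= t0 -> `|y s| <= M /\ `|w s| <= M.
  have [M1 H1] := continuous_bounded (t0 - d) t0 cy.
  have [M2 H2] := continuous_bounded (t0 - d) t0 cw.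
  exists (Num.max M1 M2) => s sd.
  by split; rewrite le_max ?H1 ?H2 ?orbT.
have [L L0 HL] := cc_lipm cyc M.
have cE : continuous E.
  have c1 : continuous (fun s => y (- s) - y t0).
    move=> s; apply: cvgB; last exact: cvg_cst.
    have := continuous_affine (c := -1) (d := 0) cy (x := s).
    by under eq_fun do rewrite mulN1r addr0.
  have c2 : continuous (fun s => w (- s)).
    move=> s; have := continuous_affine (c := -1) (d := 0) cw (x := s).
    by under eq_fun do rewrite mulN1r addr0.
  by move=> s; exact: (continuousD (continuousM (c1 s) (c1 s))
                                   (continuousM (c2 s) (c2 s))).
have dneg (f : R -> R) s l : is_derive (- s) 1 f l ->
    is_derive s 1 (fun s => f (- s)) (- l).
  have := @is_derive_affine _ f (-1) 0 s l; rewrite addr0 !mulN1r => /[apply].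
  by under eq_fun do rewrite mulN1r addr0.
pose t1 := t0 - d / 2.
have : E (- t1) <= E (- t0) * expR ((1 + 3 * L) * (- t1 - - t0)).
  apply: gronwall => //; first by rewrite /t1; lra.
  move=> s st.
  have sd : t0 - d < - s < t0 by rewrite /t1 in st; lra.
  have dy := is_derive_sub (dneg _ _ _ (cycle_derive_y cyc (- s)))
    (is_derive_const (y t0) s).
  have dw' := dneg _ _ _ (dw _ sd).
  eexists.
    exact: is_derive_add (is_derive_mul dy dy) (is_derive_mul dw' dw').
  have [y1 w1] := HM (- s) ltac:(lra).
  have [y2 w2] := HM t0 ltac:(lra).
  have := HL _ _ _ _ y1 w1 y2 w2; rewrite w0 fm0 !subr0 opprK.
  rewrite /E; move: (y (- s) - y t0) (w (- s)) (fm _ _) => a b f.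
  move=> Hf; rewrite !mulrN !mulNr.
  have nab : - (a * b) <= `|a| * `|b| by rewrite -normrM lerNl lerNnormlW.
  have nfb : f * b <= L * (`|a| + `|b|) * `|b|.
    apply: le_trans (ler_norm _) _; rewrite normrM ler_wpM2r//.
  have ea : a * a = `|a| * `|a| by rewrite -normrM ger0_norm// -expr2 sqr_ge0.
  have eb : b * b = `|b| * `|b| by rewrite -normrM ger0_norm// -expr2 sqr_ge0.
  have s2 : 2 * (`|a| * `|b|) <= a * a + b * b.
    by have := sqr_ge0 (`|a| - `|b|); rewrite ea eb; nra.
  have Ls2 : 2 * L * (`|a| * `|b|) <= L * (a * a + b * b) by nra.
  have La : 0 <= L * (a * a) by rewrite mulr_ge0// -expr2 sqr_ge0.
  rewrite eb in nfb *; rewrite ea in s2 Ls2 La *.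
  nra.
have -> : E (- t0) = 0 by rewrite /E opprK w0 subrr !mul0r addr0.
rewrite mul0r /E opprK => Ele.
have y1 : y t1 = y t0.
  apply/eqP; rewrite -subr_eq0 -sqrf_eq0 expr2 -[_ == 0]andbT; apply/andP; split=> //.
  by apply/eqP/le_anti; rewrite -expr2 sqr_ge0 andbT expr2; have := sqr_ge0 (w t1); nra.
have w1 : w t1 = w t0.
  apply/eqP; rewrite w0 -sqrf_eq0; apply/eqP/le_anti; rewrite sqr_ge0 andbT expr2.
  by move: Ele; rewrite y1 subrr mul0r add0r.
apply: (cc_inj cyc _ y1 w1).
by rewrite distrC gtr0_norm /t1; lra.
Qed.

(** The remaining cases are fm <= 0 < fM, excluded by [cycle_no_rest], and fm < 0 = fM, excluded by
    its image under the central symmetry. *)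
Lemma cycle_zero fm fM (T : R) y w t : comparison_cycle fm fM T y w ->
  w t = 0 -> fM (y t) 0 < 0 \/ 0 < fm (y t) 0.
Proof.
move=> cyc wt; have lt := cc_lt cyc (y t) 0.
have [|fm0] := ltP 0 (fm (y t) 0); first by right.
have [|fM0] := ltP (fM (y t) 0) 0; first by left.
have [fM1|fM1] := ltP 0 (fM (y t) 0); first by case: (cycle_no_rest cyc wt).
case: (cycle_no_rest (cycle_flip cyc) (t0 := t)); rewrite /flip ?opprK ?oppr0.
- by rewrite wt oppr0.
- by rewrite oppr_le0.
- by rewrite oppr_gt0; lra.
Qed.

Lemma cycle_strict_y fm fM (T : R) y w t1 t2 : comparison_cycle fm fM T y w ->
  t1 < t2 -> (forall t, t1 < t < t2 -> 0 < w t) -> y t1 < y t2.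
Proof.
move=> cyc t12 wpos; apply: (derive_gt0_lt t12 (cc_conty cyc)) => t /wpos wt.
by exists (w t) => //; exact: cycle_derive_y cyc t.
Qed.

(** y increases while w > 0, so it can replace time as the parameter; the chain rule gives the slope
    w' / y'. *)
Lemma upper_arc fm fM (T : R) y w t1 t2 : comparison_cycle fm fM T y w ->
  t1 < t2 -> (forall t, t1 < t < t2 -> 0 < w t) ->
  (forall x, y t1 <= x <= y t2 -> exists2 t, t1 <= t <= t2 & y t = x) /\
  exists U : R -> R, [/\ continuous U,
    forall t, t1 <= t <= t2 -> U (y t) = w t &
    forall x, y t1 < x < y t2 -> is_derive x 1 U (- fm x (U x) / U x)].
Proof.
move=> cyc t12 wpos.
have cy := cc_conty cyc; have cw := cc_contw cyc.
have ylt s t : t1 <= s -> s < t -> t <= t2 -> y s < y t.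
  by move=> ? st ?; apply: (cycle_strict_y cyc st) => r ?; apply: wpos; lra.
have surj x : y t1 <= x <= y t2 -> exists2 t, t1 <= t <= t2 & y t = x.
  move=> xy; have yt : y t1 <= y t2 by lra.
  have [||t tt <-] := @IVT _ y t1 t2 x (ltW t12).
  - exact: continuous_subspaceT.
  - by rewrite min_l // max_r.
  - by exists t.
split=> //.
pose c := clamp t1 t2.
have cin t : t1 <= c t <= t2 by apply: clamp_itv; exact: ltW.
have cid t : t1 <= t <= t2 -> c t = t by exact: clamp_id.
have clo t : t <= t1 -> c t = t1.
  by move=> tt; rewrite /c /clamp min_r ?max_l //; lra.
have chi t : t2 <= t -> c t = t2.
  by move=> tt; rewrite /c /clamp min_l ?max_r //; lra.
(* Continuing y with slope 1 on both sides gives an increasing bijection of the line, whose inverse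
   is defined and continuous everywhere. *)
pose Y t := y (c t) + (t - c t).
have Yid t : t1 <= t <= t2 -> Y t = y t by move=> /cid; rewrite /Y => ->; ring.
have Ylt s t : s < t -> Y s < Y t.
  have yle a b : t1 <= a -> a <= b -> b <= t2 -> y a <= y b.
    move=> ta; rewrite le_eqVlt => /orP[/eqP-> //|ab] bt.
    by apply: ltW; exact: ylt.
  move=> st; have cs : `|c t - c s| <= `|t - s| by exact: clamp_lip.
  have := cin s; have := cin t => ct csi.
  have cle : c s <= c t.
    rewrite /c /clamp ge_max le_max lexx le_max; apply/orP; right.
    by rewrite le_min !ge_min lexx (ltW st) orbT.
  move: cs; rewrite !ger0_norm; [|lra|lra] => cs.
  have [E|N] := eqVneq (c s) (c t); first by rewrite /Y E; lra.
  have : y (c s) < y (c t) by apply: ylt; lra.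
  by rewrite /Y; lra.
have cY : continuous Y.
  have cc : continuous c := @continuous_clamp _ t1 t2.
  move=> t; apply: cvgD; first exact: (continuous_comp (cc t) (cy _)).
  by apply: cvgB; [exact: cvg_id|exact: cc].
have Yinj : injective Y.
  by move=> s t; case: (ltgtP s t) => // /Ylt; lra.
have /choice[g Yg] : forall x, exists t, Y t = x.
  move=> x.
  pose lo := Num.min t1 (t1 + (x - y t1)); pose hi := Num.max t2 (t2 + (x - y t2)).
  have lo1 : lo <= t1 by rewrite ge_min lexx.
  have lo2 : lo <= t1 + (x - y t1) by rewrite ge_min lexx orbT.
  have hi1 : t2 <= hi by rewrite le_max lexx.
  have hi2 : t2 + (x - y t2) <= hi by rewrite le_max lexx orbT.
  have Ylo : Y lo <= x by rewrite /Y clo//; lra.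
  have Yhi : x <= Y hi by rewrite /Y chi//; lra.
  have [|||t _ <-] := @IVT _ Y lo hi x _; last by exists t.
  - by lra.
  - exact: continuous_subspaceT.
  - by rewrite min_l ?max_r; lra.
have gY : cancel Y g by move=> t; apply: Yinj; rewrite Yg.
have cg : continuous g.
  move=> x; rewrite -[x]Yg; apply: (nbhs_singleton (near_can_continuous (f := Y) _ _)).
    by near=> z; exact: gY.
  by near=> z; exact: cY.
exists (fun x => w (c (g x))); split.
- move=> x; apply: (@continuous_comp _ _ _ (fun x => c (g x)) w); last exact: cw.
  by apply: continuous_comp; [exact: cg|exact: continuous_clamp].
- by move=> t tt; rewrite -(Yid _ tt) gY cid.
move=> x xy; have [t tt yt] := surj x ltac:(lra).
have tt1 : t1 < t.
  by rewrite lt_neqAle andbC; case/andP: tt => -> _ /=; apply/eqP => E; subst; lra.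
have tt2 : t < t2.
  by rewrite lt_neqAle andbC; case/andP: tt => _ -> /=; apply/eqP => E; subst; lra.
have wt : 0 < w t by apply: wpos; lra.
have gx : g x = t by rewrite -yt -(Yid _ tt) gY.
have ct : c (g x) = t by rewrite gx cid.
pose d := Num.min (t - t1) (t2 - t).
have d0 : 0 < d by rewrite lt_min; lra.
have dE s : `|s - t| < d -> t1 <= s <= t2.
  by rewrite lt_min !ltr_norml; lra.
have dY : is_derive t 1 Y (w t).
  apply: (is_derive_local d0 (f := y)); last exact: cycle_derive_y cyc t.
  by move=> s /dE/Yid.
have dg : is_derive x 1 g (w t)^-1.
  rewrite -yt -(Yid _ tt); apply: is_derive_inverse.
  - by near=> z; exact: gY.
  - by near=> z; exact: cY.
  - by rewrite gt_eqF.
have dwc : is_derive (g x) 1 (fun s => w (c s)) (- fm x (w t)).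
  rewrite gx -{1}yt; apply: (is_derive_local d0 (f := w)).
    by move=> s /dE/cid ->.
  exact: (cycle_derive_w_pos cyc).
by rewrite ct; apply: (is_derive_eq (is_derive1_comp dwc dg)); rewrite mulrC.
Unshelve. all: by end_near. Qed.

End Transversality.

(** * A cycle has exactly two arcs *)

Section Lens.
Context {R : realType}.
Implicit Types (F fm fM : R -> R -> R) (y w : R -> R) (s t e l c x : R).

(** Time is eliminated: dw / dy = w' / y' = - F / w on each arc. The equations hold only inside (a,
    b), since the slopes become infinite at the tips; the last two fields record the transversal
    crossing there. *)
Record lens fm fM (a b : R) (U L : R -> R) : Prop := Lens {
  lens_ab : a < b;
  lens_contU : continuous U;
  lens_contL : continuous L;
  lens_end : [/\ U a = 0, U b = 0, L a = 0 & L b = 0];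
  lens_U : forall x, a < x < b -> 0 < U x;
  lens_L : forall x, a < x < b -> L x < 0;
  lens_dU : forall x, a < x < b -> is_derive x 1 U (- fm x (U x) / U x);
  lens_dL : forall x, a < x < b -> is_derive x 1 L (- fM x (L x) / L x);
  lens_left : fM a 0 < 0;
  lens_right : 0 < fm b 0 }.

Lemma cycle_reduce fm fM (T : R) y w c t : comparison_cycle fm fM T y w ->
  exists2 s, c <= s < c + T & y s = y t /\ w s = w t.
Proof.
move=> cyc; have [|n [sI [ys ws]]] :=
  periodic_reduce (f := fun t => (y t, w t)) c t (cc_T cyc).
  by move=> r; rewrite (cc_pery cyc) (cc_perw cyc).
by exists (t + n%:~R * T).
Qed.

Lemma strict_itv (a b t : R) : a <= t <= b -> t != a -> t != b -> a < t < b.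
Proof. by move=> /andP[ta tb] na nb; rewrite !lt_neqAle ta tb nb eq_sym na. Qed.

Lemma continuous_pos_right (f : R -> R) t : continuous f -> 0 < f t ->
  exists2 e : R, 0 < e & forall s, t < s < t + e -> 0 < f s.
Proof.
move=> cf ft; have [d d0 Hd] := (continuous_epsP f t).1 (cf t) _ ft.
exists d => // s ts; have /Hd : `|s - t| < d by rewrite gtr0_norm; lra.
by rewrite ltr_norml; lra.
Qed.

(* A cycle whose second arc ended inside the span of the first one would be
   trapped between the graphs of U and L, on the right of [y tc], and could not
   return to its leftmost point. *)
Lemma spiral_trap fm fM (T : R) y w tb tc (U L : R -> R) :
  comparison_cycle fm fM T y w -> 0 < tb -> tb < tc -> tc < T ->
  w 0 = 0 -> w tb = 0 -> w tc = 0 -> fM (y tc) 0 < 0 ->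
  continuous U -> continuous L ->
  (forall t, 0 <= t <= tb -> U (y t) = w t) ->
  (forall t, tb <= t <= tc -> L (y t) = w t) ->
  (forall x, y 0 <= x <= y tb -> exists2 t, 0 <= t <= tb & y t = x) ->
  (forall x, y tc <= x <= y tb -> exists2 t, tb <= t <= tc & y t = x) ->
  (forall x, y 0 < x < y tb -> 0 < U x) ->
  (forall x, y tc < x < y tb -> L x < 0) ->
  y 0 < y tc -> y tc < y tb -> False.
Proof.
move=> cyc tb0 tbc tcT w0 wtb wtc fMc cU cL UE LE surjU surjL Upos Lneg y0c yc.
have cy := cc_conty cyc; have cw := cc_contw cyc.
have Ub : U (y tb) = 0 by rewrite UE ?wtb// lexx ltW.
have Lb : L (y tb) = 0 by rewrite LE ?wtb// lexx ltW.
have Lc : L (y tc) = 0 by rewrite LE ?wtc// lexx ltW.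
have Uc : 0 < U (y tc) by apply: Upos; rewrite y0c.
pose h t := Num.min (Num.min (y t - y tc) (y tb - y t))
                    (Num.min (w t - L (y t)) (U (y t) - w t)).
have cLy : continuous (fun t => L (y t)).
  by move=> t; exact: (continuous_comp (cy t) (cL _)).
have cUy : continuous (fun t => U (y t)).
  by move=> t; exact: (continuous_comp (cy t) (cU _)).
have c1 : continuous (fun t => y t - y tc).
  by move=> t; apply: cvgB; [exact: cy|exact: cvg_cst].
have c2 : continuous (fun t => y tb - y t).
  by move=> t; apply: cvgB; [exact: cvg_cst|exact: cy].
have c3 : continuous (fun t => w t - L (y t)).
  by move=> t; apply: cvgB; [exact: cw|exact: cLy].
have c4 : continuous (fun t => U (y t) - w t).
  by move=> t; apply: cvgB; [exact: cUy|exact: cw].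
have ch : continuous h.
  by move=> t; exact: (continuous_min (continuous_min (c1 t) (c2 t))
                                      (continuous_min (c3 t) (c4 t))).
have hE t : (0 <= h t) = [&& y tc <= y t, y t <= y tb, L (y t) <= w t
                           & w t <= U (y t)].
  by rewrite /h !le_min !subr_ge0 -!andbA.
have yr s t e : t < s < t + e -> (forall r, t < r < t + e -> 0 < w r) ->
    y t < y s.
  move=> /andP[ts se] Hw; apply: (cycle_strict_y cyc ts) => r /andP[tr rs].
  by apply: Hw; rewrite tr (lt_trans rs).
(* After one period the cycle is back at abscissa y 0, to the left of the trap. *)
suff : 0 <= h T.
  rewrite hE; have := cc_pery cyc 0; rewrite add0r => -> /and4P[].
  by rewrite leNgt y0c.
apply: (@stay_ge0 _ h tc T ch); last by rewrite lexx ltW.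
  by rewrite hE Lc wtc !lexx !ltW.
move=> t /andP[tct tT].
rewrite hE => /and4P[h1 h2 h3 h4].
(* At the corner itself the crossing is upward, hence w > 0 just afterwards and y increases. *)
have [E|ttc] := eqVneq t tc.
  subst t; have [ea ea0 [Ha _]] := cycle_up cyc wtc fMc.
  have [|eb eb0 Hb] := continuous_pos_right (t := tc) c2; first by rewrite subr_gt0.
  have [|ec ec0 Hc] := continuous_pos_right (t := tc) c4.
    by rewrite wtc subr0.
  exists (Num.min ea (Num.min eb ec)); first by rewrite !lt_min ea0 eb0.
  move=> s; rewrite -ltrBlDl !lt_min !ltrBlDl => /and4P[s1 sa sb sc].
  have wa : 0 < w s by apply: Ha; rewrite s1.
  have ya : y tc < y s by apply: (@yr s tc ea) => //; rewrite s1.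
  have yb : y s < y tb by rewrite -subr_gt0; apply: Hb; rewrite s1.
  have Us : w s < U (y s) by rewrite -subr_gt0; apply: Hc; rewrite s1.
  have Ls : L (y s) < 0 by apply: Lneg; rewrite ya.
  by rewrite hE !ltW// (lt_trans Ls).
have {tct}ttc : tc < t by rewrite lt_neqAle eq_sym ttc.
(* Contact with either graph would be a self-intersection within less than a period. *)
have noU : U (y t) != w t.
  apply/eqP => E; have [|s /andP[s0 sb] ys] := surjU (y t).
    by rewrite h2 (le_trans (ltW y0c) h1).
  apply: (cc_inj cyc (s := t) (t := s)) => //; last first.
    by rewrite -E -ys UE// s0.
  have st : s < t by apply: le_lt_trans sb _; exact: lt_trans ttc.
  by rewrite gtr0_norm ?subr_gt0// st; clear -s0 tT; lra.
have noL : w t != L (y t).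
  apply/eqP => E; have [|s /andP[sb sc] ys] := surjL (y t); first by rewrite h1.
  apply: (cc_inj cyc (s := t) (t := s)) => //; last first.
    by rewrite E -ys LE// sb.
  have st : s < t by exact: le_lt_trans ttc.
  by rewrite gtr0_norm ?subr_gt0// st; clear -sb tb0 tT; lra.
have p4 : w t < U (y t) by rewrite lt_neqAle eq_sym noU.
have p3 : L (y t) < w t by rewrite lt_neqAle eq_sym noL.
have p2 : y t < y tb.
  rewrite lt_neqAle h2 andbT; apply/eqP => E.
  by move: p3 p4; rewrite E Ub Lb => /lt_trans lt /lt; rewrite ltxx.
move: p2 p3 p4; rewrite -[y t < _]subr_gt0 -[_ < w t]subr_gt0 -[w t < _]subr_gt0 => p2 p3 p4.
have [eb eb0 Hb] := continuous_pos_right c2 p2.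
have [ec ec0 Hc] := continuous_pos_right c3 p3.
have [ed ed0 Hd] := continuous_pos_right c4 p4.
have [ea ea0 Ha] : exists2 e : R, 0 < e &
    forall s, t < s < t + e -> y tc <= y s.
  (* On the left wall w > L (y tc) = 0, so y increases. *)
  have [E|N] := eqVneq (y t) (y tc).
    have [|e e0 He] := continuous_pos_right (t := t) cw.
      by move: p3; rewrite E Lc subr0.
    by exists e => // s ts; rewrite -E ltW//; apply: (@yr s t e).
  have [|e e0 He] := continuous_pos_right (t := t) c1.
    by rewrite subr_gt0 lt_neqAle eq_sym N.
  by exists e => // s ts; rewrite -subr_ge0 ltW//; apply: He.
exists (Num.min (Num.min ea eb) (Num.min ec ed)).
  by rewrite !lt_min ea0 eb0 ec0.
move=> s; rewrite -ltrBlDl !lt_min !ltrBlDl => /and3P[s1 /andP[sa sb] /andP[sc sd]].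
have := Ha s; have := Hb s; have := Hc s; have := Hd s.
rewrite s1 sa sb sc sd !subr_gt0 => /(_ isT) ? /(_ isT) ? /(_ isT) ? /(_ isT) ?.
by rewrite hE; apply/and4P; split => //; exact: ltW.
Qed.

(** From its leftmost point, which lies on w = 0, the cycle runs to the right above the line until
    [tb], then to the left below it until [tc]. These two arcs are the whole cycle because [tc]
    turns out to be the period. *)
Lemma lens_of_min fm fM (T : R) y w : comparison_cycle fm fM T y w ->
  (forall t, y 0 <= y t) ->
  exists a b U L, lens fm fM a b U L /\
    forall x v, (exists t, y t = x /\ w t = v) <->
                (a <= x <= b /\ (v = U x \/ v = L x)).
Proof.
move=> cyc ymin; have T0 := cc_T cyc.
have cy := cc_conty cyc; have cw := cc_contw cyc.
have yT : y T = y 0 by have := cc_pery cyc 0; rewrite add0r.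
have wT : w T = w 0 by have := cc_perw cyc 0; rewrite add0r.
have dy := cycle_derive_y cyc.
have w0 : w 0 = 0.
  apply: le_anti; apply/andP; split.
    have dn : is_derive (0 : R) 1 (fun t => y (-1 * t + 0)) (-1 * w 0).
      by apply: is_derive_affine; rewrite mulr0 addr0; exact: dy.
    rewrite -oppr_ge0 -mulN1r; apply: (derive_right_ge dn ltr01) => t _.
    by rewrite mulr0 addr0.
  by apply: (derive_right_ge (dy 0) ltr01) => t _.
have fM0 : fM (y 0) 0 < 0.
  case: (cycle_zero cyc w0) => // fm0.
  have [e e0 [_ H]] := cycle_down cyc w0 fm0.
  suff : y (- (e / 2)) < y 0 by have := ymin (- (e / 2)); lra.
  by apply: (cycle_strict_y cyc); [lra|move=> t te; apply: H; lra].
have [e1' e1'0 [H1' _]] := cycle_up cyc w0 fM0.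
pose e1 := Num.min e1' T.
have e10 : 0 < e1 by rewrite lt_min e1'0.
have e1T : e1 <= T by rewrite ge_min lexx orbT.
have H1 t : 0 < t < e1 -> 0 < w t.
  by rewrite lt_min => te; apply: H1'; rewrite add0r; lra.
have [|||tb [tb1 wtb wpos']] := @first_zero _ w (e1 / 2) T _ cw.
- by lra.
- by apply: H1; lra.
- by rewrite wT w0.
have wpos t : 0 < t < tb -> 0 < w t.
  by move=> tt; have [te|te] := ltP t e1; [apply: H1|apply: wpos']; lra.
have tb0 : 0 < tb by lra.
have yb : y 0 < y tb by exact: (cycle_strict_y cyc tb0 wpos).
have tbT : tb < T.
  by rewrite lt_neqAle; apply/andP; split; [apply/eqP => E; subst; lra|lra].
have fmb : 0 < fm (y tb) 0.
  case: (cycle_zero cyc wtb) => // fMb.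
  have [e e0 [_ H]] := cycle_up cyc wtb fMb.
  pose t := tb - Num.min e tb / 2.
  have m0 : 0 < Num.min e tb by rewrite lt_min e0.
  have m1 : Num.min e tb <= e by rewrite ge_min lexx.
  have m2 : Num.min e tb <= tb by rewrite ge_min lexx orbT.
  have := H t; have := wpos t; rewrite /t; lra.
have [e2' e2'0 [H2' _]] := cycle_down cyc wtb fmb.
pose e2 := Num.min e2' (T - tb).
have e20 : 0 < e2 by rewrite lt_min e2'0; lra.
have e2T : e2 <= T - tb by rewrite ge_min lexx orbT.
have H2 t : tb < t < tb + e2 -> w t < 0.
  by rewrite -ltrBlDl lt_min => te; apply: H2'; lra.
have cwN : continuous (fun t => - w t).
  by move=> t; apply: continuousN; exact: cw.
have [|||tc [tc1 wtc wneg']] := @first_zero _ _ (tb + e2 / 2) T _ cwN.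
- by lra.
- by rewrite oppr_gt0; apply: H2; lra.
- by rewrite wT w0 oppr0.
have {}wtc : w tc = 0 by lra.
have wneg t : tb < t < tc -> 0 < - w t.
  move=> tt; have [te|te] := ltP t (tb + e2); last by apply: wneg'; lra.
  by rewrite oppr_gt0; apply: H2; lra.
have tbc : tb < tc by lra.
have cycN := cycle_flip cyc.
have yc : y tc < y tb by have := cycle_strict_y cycN tbc wneg; rewrite ltrN2.
have [surjU [U [cU UE dU]]] := upper_arc cyc tb0 wpos.
have [surjL' [L' [cL' LE' dL']]] := upper_arc cycN tbc wneg.
pose L x := - L' (- x).
have cL : continuous L.
  move=> x; apply: continuousN; have := continuous_affine (c := -1) (d := 0) cL' (x := x).
  by under eq_fun do rewrite mulN1r addr0.
have LE t : tb <= t <= tc -> L (y t) = w t by rewrite /L => /LE' ->; rewrite opprK.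
have surjL x : y tc <= x <= y tb -> exists2 t, tb <= t <= tc & y t = x.
  move=> xy; have [|t tt /oppr_inj yt] := surjL' (- x); first lra.
  by exists t.
have Ua : U (y 0) = 0 by rewrite UE ?w0//; lra.
have Ub : U (y tb) = 0 by rewrite UE ?wtb//; lra.
have Lb : L (y tb) = 0 by rewrite LE ?wtb//; lra.
have Lc : L (y tc) = 0 by rewrite LE ?wtc//; lra.
have Upos x : y 0 < x < y tb -> 0 < U x.
  move=> xy; have [|t tt yt] := surjU x; first lra.
  rewrite -yt UE//; apply: wpos; apply: strict_itv tt _ _; apply/eqP => E;
    by move: xy; rewrite -yt E ltxx ?andbF.
have Lneg x : y tc < x < y tb -> L x < 0.
  move=> xy; have [|t tt yt] := surjL x; first lra.
  rewrite -yt LE// -oppr_gt0; apply: wneg; apply: strict_itv tt _ _; apply/eqP => E;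
    by move: xy; rewrite -yt E ltxx ?andbF.
(* A return to w = 0 before the period would lie strictly to the right of the leftmost point, as the
   cycle does not meet itself, and would begin the trapped spiral. *)
have tcT : tc = T.
  apply/eqP; rewrite eq_le; apply/andP; split; first by case/andP: tc1.
  rewrite leNgt; apply/negP => tcT.
  have fMc : fM (y tc) 0 < 0.
    case: (cycle_zero cyc wtc) => // fmc.
    have [e e0 [_ H]] := cycle_down cyc wtc fmc.
    pose t := tc - Num.min e (tc - tb) / 2.
    have m0 : 0 < Num.min e (tc - tb) by rewrite lt_min e0 subr_gt0.
    have m1 : Num.min e (tc - tb) <= e by rewrite ge_min lexx.
    have m2 : Num.min e (tc - tb) <= tc - tb by rewrite ge_min lexx orbT.
    have := H t; have := wneg t; rewrite /t; clear -m0 m1 m2; lra.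
  apply: (@spiral_trap fm fM T y w tb tc U L) => //.
  rewrite lt_neqAle ymin andbT; apply/eqP => E.
  apply: (cc_inj cyc (s := 0) (t := tc)) => //; last by rewrite w0.
  by rewrite sub0r normrN gtr0_norm ?tcT ?(lt_trans tb0 tbc).
subst tc; rewrite yT in yc Lc Lneg surjL dL'.
exists (y 0), (y tb), U, L; split.
  split=> //.
  move=> x xy; have xy' : - y tb < - x < - y 0 by lra.
  have := is_derive_affine (f := L') (c := -1) (d := 0) (t := x).
  rewrite addr0 !mulN1r => /(_ _ (dL' _ xy')) /is_derive_opp.
  under eq_fun do rewrite mulN1r addr0.
  move=> dLx; apply: (is_derive_eq dLx).
  by rewrite /flip opprK /L invrN mulrN opprK; ring.
move=> x v; split=> [[t [<- <-]]|[xab [->|->]]].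
- have [s ss [<- <-]] := cycle_reduce 0 t cyc; rewrite add0r in ss.
  have [st|st] := leP s tb.
    split; last by left; rewrite UE//; lra.
    by rewrite ymin /=; move: st; rewrite le_eqVlt => /orP[/eqP->//|st];
      apply/ltW/(cycle_strict_y cyc st) => r ?; apply: wpos; lra.
  split; last by right; rewrite LE//; lra.
  rewrite ymin /= -lerN2 ltW//; apply: (cycle_strict_y cycN st) => r ?.
  by apply: wneg; lra.
- by have [t tt <-] := surjU _ xab; exists t; rewrite UE.
- by have [t tt <-] := surjL _ xab; exists t; rewrite LE.
Qed.

Lemma cycle_lens fm fM (T : R) y w : comparison_cycle fm fM T y w ->
  exists a b U L, lens fm fM a b U L /\
    forall x v, (exists t, y t = x /\ w t = v) <->
                (a <= x <= b /\ (v = U x \/ v = L x)).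
Proof.
move=> cyc; have T0 := cc_T cyc.
have [c _ Hc] := EVT_min (ltW T0) (continuous_subspaceT (cc_conty cyc)).
have [|a [b [U [L [lUL H]]]]] := lens_of_min (cycle_shift c cyc).
  move=> t; rewrite add0r; have [s ss [<- _]] := cycle_reduce 0 (t + c) cyc.
  by apply: Hc; rewrite in_itv /= -[T]add0r; lra.
exists a, b, U, L; split=> // x v; rewrite -H; split=> -[t [yt wt]].
  by exists (t - c); rewrite !subrK.
by exists (t + c).
Qed.

End Lens.

(** * The region bounded by the cycle is the lens *)

Section Region.
Context {R : realType}.
Variables (fm fM : R -> R -> R) (k a b : R) (U L : R -> R).
Hypothesis lUL : lens fm fM a b U L.

Definition shear (p : R * R) : R := p.1 - k * p.2.

(** A single continuous function that is positive inside the curve, zero on it and negative outside;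
    closedness and openness are read off its sign. *)
Definition lens_gap (p : R * R) : R :=
  Num.min (Num.min (shear p - a) (b - shear p))
          (Num.min (p.2 - L (shear p)) (U (shear p) - p.2)).

Definition lens_set : set (R * R) := [set p | 0 <= lens_gap p].

Definition lens_curve : set (R * R) :=
  [set p | a <= shear p <= b /\ (p.2 = U (shear p) \/ p.2 = L (shear p))].

Lemma lens_setE p : lens_set p <->
  a <= shear p <= b /\ L (shear p) <= p.2 <= U (shear p).
Proof.
rewrite /lens_set /lens_gap /= !le_min !subr_ge0.
by split=> [/andP[-> ->]|[-> ->]].
Qed.

Lemma continuous_shear : continuous shear.
Proof.
move=> p; apply: cvgB; first exact: cvg_fst.
by apply: cvgM; [exact: cvg_cst|exact: cvg_snd].
Qed.

Lemma continuous_lens_gap : continuous lens_gap.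
Proof.
have cs := continuous_shear.
have c2 : continuous (fun p : R * R => p.2) by move=> p; exact: cvg_snd.
have cU : continuous (fun p => U (shear p)).
  by move=> p; apply: (@continuous_comp _ _ _ shear U p (cs p)); exact: (lens_contU lUL).
have cL : continuous (fun p => L (shear p)).
  by move=> p; apply: (@continuous_comp _ _ _ shear L p (cs p)); exact: (lens_contL lUL).
have c1 (c : R) : continuous (fun p => shear p - c).
  by move=> p; apply: cvgB; [exact: cs|exact: cvg_cst].
have c3 (c : R) : continuous (fun p => c - shear p).
  by move=> p; apply: cvgB; [exact: cvg_cst|exact: cs].
have c4 : continuous (fun p : R * R => p.2 - L (shear p)).
  by move=> p; apply: cvgB; [exact: c2|exact: cL].
have c5 : continuous (fun p : R * R => U (shear p) - p.2).
  by move=> p; apply: cvgB; [exact: cU|exact: c2].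
by move=> p; exact: (continuous_min (continuous_min (c1 a p) (c3 b p))
                                    (continuous_min (c4 p) (c5 p))).
Qed.

Lemma lens_closed : closed lens_set.
Proof.
rewrite (_ : lens_set = lens_gap @^-1` [set x | 0 <= x]) //.
by apply: closed_comp; [move=> p _; exact: continuous_lens_gap|exact: closed_ge].
Qed.

Lemma lens_pos_open : open [set p | 0 < lens_gap p].
Proof.
rewrite (_ : [set p | 0 < lens_gap p] = lens_gap @^-1` [set x | 0 < x]) //.
by apply: open_comp; [move=> p _; exact: continuous_lens_gap|exact: open_gt].
Qed.

Lemma lens_compact : compact lens_set.
Proof.
have [M1 H1] := continuous_bounded a b (lens_contU lUL).
have [M2 H2] := continuous_bounded a b (lens_contL lUL).
pose M := M1 + M2; pose N := `|a| + `|b| + `|k| * M.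
apply: (@subclosed_compact _ _ (`[- N, N] `*` `[- M, M])).
- exact: lens_closed.
- by apply: compact_setX; exact: segment_compact.
move=> p /lens_setE[sp pUL]; have := H1 _ sp; have := H2 _ sp.
move=> L2 U1; have p2 : `|p.2| <= M.
  by move: L2 U1; rewrite !ler_norml /M => /andP[? ?] /andP[? ?]; lra.
have p1 : `|p.1| <= N.
  rewrite -[p.1](subrK (k * p.2)) (le_trans (ler_normD _ _))// normrM lerD//.
    by rewrite -/(shear p) ler_norml;
      have := ler_norm b; have := ler_norm (- a); rewrite normrN;
      have := normr_ge0 a; have := normr_ge0 b; lra.
  by rewrite ler_wpM2l.
by split; rewrite /= in_itv /= -ler_norml.
Qed.

Lemma lens_set_curve p : lens_set p -> lens_curve p \/ 0 < lens_gap p.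
Proof.
move=> pK; have [sp pUL] := (lens_setE p).1 pK.
have [pU|pU] := eqVneq p.2 (U (shear p)); first by left; split; [|left].
have [pL|pL] := eqVneq p.2 (L (shear p)); first by left; split; [|right].
have [Ua Ub La Lb] := lens_end lUL.
have pUL' : L (shear p) < p.2 < U (shear p) by exact: strict_itv pUL pL pU.
right; rewrite /lens_gap !lt_min !subr_gt0 pUL' andbT.
apply: strict_itv sp _ _; apply/eqP => E; move: pUL'; rewrite E ?Ua ?Ub ?La ?Lb;
  by move=> /andP[/lt_trans h /h]; rewrite ltxx.
Qed.

Lemma lens_curve_gap p : lens_curve p -> lens_gap p = 0.
Proof.
have [Ua Ub La Lb] := lens_end lUL.
move=> [sp pE]; have LU : L (shear p) <= 0 <= U (shear p).
  have [->|na] := eqVneq (shear p) a; first by rewrite Ua La lexx.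
  have [->|nb] := eqVneq (shear p) b; first by rewrite Ub Lb lexx.
  have sp' := strict_itv sp na nb.
  by apply/andP; split; apply: ltW; [exact: (lens_L lUL)|exact: (lens_U lUL)].
apply: le_anti; apply/andP; split; last first.
  apply/(lens_setE p).2; split=> //; case: pE => ->; rewrite lexx ?andbT /=;
  by case/andP: LU => l u; exact: le_trans l u.
by rewrite /lens_gap !ge_min; case: pE => ->; rewrite subrr lexx !orbT.
Qed.

(** A point outside the lens escapes along a ray that misses the curve, so its component is
    unbounded. A point inside but off the curve has positive gap; relative to the complement of the
    curve the lens is both open and closed, which confines the component of that point to it. *)
Lemma closed_region_lens : closed_region lens_curve = lens_set.
Proof.
apply/seteqP; split => p.
  move=> [pC|pb]; first by rewrite /lens_set/= (lens_curve_gap pC).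
  have [//|pK] := pselect (lens_set p); exfalso.
  have pC : ~ lens_curve p.
    by move=> /lens_curve_gap E; apply: pK; rewrite /lens_set/= E.
  (* The direction (k, 1) is vertical in sheared coordinates, so the ray keeps [shear p] and only
     moves up or down. *)
  pose ray (d s : R) : R * R := (p.1 + k * (d * s), p.2 + d * s).
  have sray d s : shear (ray d s) = shear p by rewrite /shear/=; ring.
  have [d d1 Hd] : exists2 d : R, `|d| = 1 &
      forall s, 0 <= s -> ~ lens_curve (ray d s).
    have [sp|sp] := boolP (a <= shear p <= b); last first.
      by exists 1; rewrite ?normr1// => s _ [+ _]; rewrite sray (negbTE sp).
    have [pU|pU] := leP p.2 (U (shear p)); last first.
      exists 1; rewrite ?normr1// => s s0 /lens_curve_gap E.
      have : lens_set (ray 1 s) by rewrite /lens_set/= E.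
      by move=> /lens_setE[_]; rewrite sray /ray/= mul1r => /andP[_]; lra.
    have [pL|pL] := leP (L (shear p)) p.2.
      by exfalso; apply: pK; apply/lens_setE; rewrite sp pL pU.
    exists (-1); rewrite ?normrN1// => s s0 /lens_curve_gap E.
    have : lens_set (ray (-1) s) by rewrite /lens_set/= E.
    by move=> /lens_setE[_]; rewrite sray /ray/= mulN1r => /andP[+ _]; lra.
  have cray : continuous (ray d).
    have cid : continuous (fun s : R => d * s).
      by move=> s; apply: cvgM; [exact: cvg_cst|exact: cvg_id].
    have ca (c : R) (f : R -> R) : continuous f -> continuous (fun s => c + f s).
      by move=> cf s; apply: cvgD; [exact: cvg_cst|exact: cf].
    have ck : continuous (fun s : R => k * (d * s)).
      by move=> s; apply: cvgM; [exact: cvg_cst|exact: cid].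
    by move=> s; exact: (cvg_pair (ca p.1 _ ck s) (ca p.2 _ cid s)).
  have conn : connected (ray d @` [set s : R | 0 <= s]).
    apply: connected_continuous_connected; last exact: continuous_subspaceT.
    by apply/connected_intervalP => x y /= x0 y0 z /andP[xz _]; exact: le_trans xz.
  have sub : ray d @` [set s : R | 0 <= s] `<=`
             connected_component (~` lens_curve) p.
    apply: connected_component_max => //.
      by exists 0; rewrite /= ?lexx // /ray !mulr0 !addr0; case: (p).
    by move=> _ [s s0 <-]; exact: Hd.
  have [M [Mr HM]] := pb.
  pose s := `|p.2| + `|M| + 2.
  have s0 : 0 <= s by rewrite /s; have := normr_ge0 p.2; have := normr_ge0 M; lra.
  have Ms : M < `|M| + 1 by have := ler_norm M; lra.
  have := HM _ Ms (ray d s) (sub _ (ex_intro2 _ _ s s0 erefl)).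
  rewrite /= prod_normE /= ge_max => /andP[_ h].
  have : `|d * s| <= `|p.2 + d * s| + `|p.2|.
    by have := ler_normB (p.2 + d * s) p.2; rewrite addrAC subrr add0r.
  by rewrite normrM d1 mul1r ger0_norm// /s; lra.
move=> pK; have [pC|pp] := lens_set_curve pK; first by left.
right; have : bounded_set lens_set by exact: compact_bounded lens_compact.
case=> M [Mr HM]; exists M; split=> // x Mx q qA; apply: (HM x Mx q).
set A := connected_component _ _ in qA.
have AC r : A r -> ~ lens_curve r by move/connected_component_sub.
suff AE : A `&` lens_set = A by move: qA; rewrite -AE => -[].
apply: component_connected.
- exists p; split=> //; apply: connected_component_refl => /lens_curve_gap E.
  by move: pp; rewrite E ltxx.
- exists [set p | 0 < lens_gap p]; first exact: lens_pos_open.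
  apply/seteqP; split=> r [Ar Kr]; split=> //; last exact: ltW.
  by case: (lens_set_curve Kr) => // /(AC _ Ar).
- by exists lens_set => //; exact: lens_closed.
Qed.

End Region.

(** * Forward invariance of the region bounded by the cycle *)

Section Barrier.
Context {R : realType}.
Implicit Types (fm fM : R -> R -> R) (a b x v n e t : R) (U L : R -> R).

Lemma lens_flip fm fM a b U L : lens fm fM a b U L ->
  lens (flip fM) (flip fm) (- b) (- a) (fun x => - L (- x)) (fun x => - U (- x)).
Proof.
have contN (f : R -> R) : continuous f -> continuous (fun x => - f (- x)).
  move=> cf x; apply: continuousN.
  have := continuous_affine (c := -1) (d := 0) cf (x := x).
  by under eq_fun do rewrite mulN1r addr0.
have derN (f : R -> R) x (l : R) : is_derive (- x) 1 f l ->
    is_derive x 1 (fun x => - f (- x)) l.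
  have := @is_derive_affine _ f (-1) 0 x l; rewrite addr0 !mulN1r => /[apply].
  under eq_fun do rewrite mulN1r addr0.
  by move=> /is_derive_opp; rewrite opprK.
case=> ab cU cL [Ua Ub La Lb] Up Lp dU dL fa fb; split.
- by rewrite ltrN2.
- exact: contN.
- exact: contN.
- by rewrite !opprK Ua Ub La Lb oppr0.
- by move=> x xab; rewrite oppr_gt0; apply: Lp; lra.
- by move=> x xab; rewrite oppr_lt0; apply: Up; lra.
- move=> x xab; have xab' : a < - x < b by lra.
  apply: is_derive_eq (derN _ _ _ (dL _ xab')) _.
  by rewrite /flip !opprK invrN mulrN !mulNr.
- move=> x xab; have xab' : a < - x < b by lra.
  apply: is_derive_eq (derN _ _ _ (dU _ xab')) _.
  by rewrite /flip !opprK invrN mulrN !mulNr.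
- by rewrite /flip opprK oppr0 oppr_lt0.
- by rewrite /flip opprK oppr0 oppr_gt0.
Qed.

Definition in_lens a b U L x v := a <= x <= b /\ L x <= v <= U x.

(* The closed ball around (x, v) + (n1, n2) through (x, v) has no interior
   point in common with the lens. *)
Definition lens_normal_at a b U L x v n1 n2 := forall x' v',
  in_lens a b U L x' v' ->
  2 * (n1 * (x' - x) + n2 * (v' - v)) <= (x' - x) ^+ 2 + (v' - v) ^+ 2.

Lemma le0_of_small (c e : R) : 0 < e -> (forall h, 0 < h < e -> c <= h) -> c <= 0.
Proof.
move=> e0 H; rewrite leNgt; apply/negP => c0.
pose h := Num.min e c / 2; have m0 : 0 < Num.min e c by rewrite lt_min e0.
have me : Num.min e c <= e by rewrite ge_min lexx.
have mc : Num.min e c <= c by rewrite ge_min lexx orbT.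
by have := H h; rewrite /h; lra.
Qed.

(** Descending from the graph gives the sign of n2; following the graph in both directions gives
    orthogonality to the tangent (1, U'), where U' = - fm / U. *)
Lemma normal_upper fm fM a b U L x n1 n2 : lens fm fM a b U L ->
  a < x < b -> lens_normal_at a b U L x (U x) n1 n2 ->
  0 <= n2 /\ n1 = n2 * fm x (U x) / U x.
Proof.
move=> lUL xab H; have Ux := lens_U lUL xab; have Lx := lens_L lUL xab.
have dU := lens_dU lUL xab.
split.
  rewrite -oppr_le0; apply: (@le0_of_small _ (2 * (U x - L x))); first lra.
  move=> h hh; have := H x (U x - h / 2).
  have xab' : a <= x <= b by lra.
  move=> /(_ ltac:(by split; lra)); rewrite subrr mulr0 add0r expr0n /= add0r.
  rewrite addrAC subrr add0r expr2; nra.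
pose G (t : R) := t ^+ 2 + (U (x + t) - U x) ^+ 2
                  - 2 * (n1 * t + n2 * (U (x + t) - U x)).
pose d := - fm x (U x) / U x.
pose e := Num.min (x - a) (b - x).
have e0 : 0 < e by rewrite lt_min; lra.
have G0 t : `|t| < e -> 0 <= G t.
  rewrite /e lt_min !ltr_norml => te.
  have xt : a < x + t < b by lra.
  have := H (x + t) (U (x + t)); rewrite [x + t - x]addrAC subrr add0r.
  move=> /(_ ltac:(split; [lra|rewrite lexx andbT ltW//])).
  have := lens_U lUL xt; have := lens_L lUL xt.
  by move=> l u; rewrite /G subr_ge0; apply; exact: lt_trans u.
have dG : is_derive (0 : R) 1 G (- 2 * (n1 + n2 * d)).
  have dt : is_derive (0 : R) 1 (fun t : R => t) (1 : R) by exact: is_derive_id.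
  have dUt : is_derive (0 : R) 1 (fun t => U (x + t) - U x) d.
    have := @is_derive_affine _ U 1 x 0 d; rewrite mulr0 add0r mul1r => /(_ dU).
    under eq_fun do rewrite mul1r addrC.
    by move=> /is_derive_sub/(_ (is_derive_const (U x) 0)); rewrite subr0.
  have := is_derive_sub (is_derive_add (is_derive_mul dt dt) (is_derive_mul dUt dUt))
    (is_derive_mul (is_derive_const 2 0) (is_derive_add
       (is_derive_mul (is_derive_const n1 0) dt)
       (is_derive_mul (is_derive_const n2 0) dUt))).
  by move=> dG; apply: (is_derive_eq dG); rewrite addr0 subrr; ring.
have GE : G 0 = 0 by rewrite /G addr0 subrr; ring.
have h1 : 0 <= - 2 * (n1 + n2 * d).
  apply: (derive_right_ge dG e0) => t; rewrite add0r GE => te.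
  by apply: G0; rewrite gtr0_norm; lra.
have h2 : 0 <= -1 * (- 2 * (n1 + n2 * d)).
  have dG' : is_derive (0 : R) 1 (fun t => G (-1 * t + 0)) (-1 * (- 2 * (n1 + n2 * d))).
    by apply: is_derive_affine; rewrite mulr0 addr0.
  apply: (derive_right_ge dG' e0) => t; rewrite add0r mulr0 !addr0 GE mulN1r => te.
  by apply: G0; rewrite normrN gtr0_norm; lra.
have : n1 + n2 * d = 0 by lra.
by rewrite /d mulrA mulrN mulNr => /eqP; rewrite addr_eq0 opprK => /eqP.
Qed.

Lemma normal_interior fm fM a b U L x v n1 n2 : lens fm fM a b U L ->
  a < x < b -> L x < v < U x -> lens_normal_at a b U L x v n1 n2 ->
  n1 = 0 /\ n2 = 0.
Proof.
move=> lUL xab vLU H.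
have cU := lens_contU lUL; have cL := lens_contL lUL.
have [d1 d10 H1] := (continuous_epsP U x).1 (cU x) (U x - v) ltac:(lra).
have [d2 d20 H2] := (continuous_epsP L x).1 (cL x) (v - L x) ltac:(lra).
pose e := Num.min (Num.min (x - a) (b - x)) (Num.min d1 d2).
have e0 : 0 < e by rewrite !lt_min d10 d20 !andbT; lra.
have Kx h : `|h| < e -> in_lens a b U L (x + h) v.
  rewrite !lt_min => /and3P[]; rewrite !ltr_norml => /andP[h1 h2] h3 h4.
  have := H1 (x + h); have := H2 (x + h); rewrite addrAC subrr add0r.
  by rewrite !ltr_norml => /(_ h4) ? /(_ h3) ?; split; lra.
have n1h h : `|h| < e -> 2 * n1 * h <= h ^+ 2.
  move=> /Kx/H; rewrite addrAC subrr add0r subrr mulr0 addr0 expr0n addr0.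
  by rewrite mulrA.
have n2h h : `|h| < Num.min (v - L x) (U x - v) -> 2 * n2 * h <= h ^+ 2.
  rewrite lt_min !ltr_norml => hh.
  have := H x (v + h) ltac:(by split; lra).
  by rewrite subrr mulr0 expr0n add0r addrAC subrr !add0r mulrA.
have zero (n r : R) : 0 < r -> (forall h, `|h| < r -> 2 * n * h <= h ^+ 2) -> n = 0.
  move=> r0 hn; apply: le_anti; apply/andP; split.
    apply: (le0_of_small r0) => h hh; have := hn h; rewrite gtr0_norm; last lra.
    by move=> /(_ ltac:(lra)); rewrite expr2; nra.
  rewrite -oppr_le0; apply: (le0_of_small r0) => h hh.
  have := hn (- h); rewrite normrN gtr0_norm; last lra.
  by move=> /(_ ltac:(lra)); rewrite expr2; nra.
split; [exact: zero e0 n1h|apply: zero n2h].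
by rewrite lt_min; lra.
Qed.

(** By the orbit equation, (U^2)' = - 2 fm stays above a positive constant near a, so U grows at
    least like a square root. The boundary is therefore vertical at the tip, and with n2 > 0 the
    ball would contain points of the graph. *)
Lemma normal_left fm fM a b U L n1 n2 : box_lipschitz fm ->
  (forall x v, fm x v < fM x v) ->
  lens fm fM a b U L -> lens_normal_at a b U L a 0 n1 n2 -> n2 <= 0.
Proof.
move=> lm lt lUL H; have [Ua Ub La Lb] := lens_end lUL.
have cU := lens_contU lUL; have ab := lens_ab lUL.
have fa : fm a 0 < 0 by have := lens_left lUL; have := lt a 0; lra.
pose c := - fm a 0 / 2; have c0 : 0 < c by rewrite /c; lra.
have cid : continuous (fun x : R => x) by move=> x; exact: cvg_id.
have cfm := box_lipschitz_cont lm (cid a) (cU a).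
have [] := (continuous_epsP _ a).1 cfm c; first by [].
rewrite Ua => d d0 Hd.
pose e := Num.min d (b - a).
have e0 : 0 < e by rewrite lt_min d0; lra.
have U2 x : a < x < a + e -> 2 * c * (x - a) <= U x * U x.
  rewrite -ltrBlDl lt_min => xe.
  pose g x := U x * U x - 2 * c * (x - a).
  suff : g a <= g x by rewrite /g Ua subrr mulr0 mulr0 subr0 subr_ge0.
  apply: derive_ge0_le; first lra.
    have ca : continuous (fun x : R => 2 * c * (x - a)).
      move=> z; apply: cvgM; first exact: cvg_cst.
      by apply: cvgB; [exact: cvg_id|exact: cvg_cst].
    move=> z; apply: cvgB; last exact: ca.
    exact: (continuousM (cU z) (cU z)).
  move=> z zx; have zab : a < z < b by lra.
  have dU := lens_dU lUL zab; have Uz := lens_U lUL zab.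
  have did : is_derive z 1 (fun t : R => t) (1 : R) by exact: is_derive_id.
  have dg := is_derive_sub (is_derive_mul dU dU) (is_derive_mul
    (is_derive_const (2 * c) z) (is_derive_sub did (is_derive_const a z))).
  eexists; first exact: dg.
  have /Hd : `|z - a| < d by rewrite gtr0_norm; lra.
  rewrite ltr_norml => fz.
  rewrite mul0r add0r subr0 mulr1 [U z * _]mulrC !divfK ?gt_eqF//.
  by rewrite /c in fz *; lra.
rewrite leNgt; apply/negP => n20.
(* Chosen so that n2 U > k U^2 outweighs both |n1| (x - a), which is at most of the order of U^2,
   and the quadratic terms of the ball. *)
pose k := (`|n1| + 1) / c + 1.
have k0 : 0 < k by rewrite /k addr_gt0// divr_gt0// ltr_wpDl.
have [] := (continuous_epsP U a).1 (cU a) (Num.min c (n2 / k)).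
  by rewrite lt_min c0 divr_gt0.
rewrite Ua => d' d'0 Hd'.
pose x := a + Num.min (Num.min e d') 1 / 2.
pose m := Num.min (Num.min e d') 1.
have m0 : 0 < m by rewrite /m lt_min ltr01 andbT lt_min d'0 andbT.
have [me md m1] : [/\ m <= e, m <= d' & m <= 1].
  by split; rewrite /m ge_min ?lexx ?orbT // ge_min lexx ?orbT.
have xE : x = a + m / 2 by [].
have eb : e <= b - a by rewrite ge_min lexx orbT.
have xab : a < x < b by lra.
have Ux := lens_U lUL xab; have Lx := lens_L lUL xab.
have := Hd' x; rewrite gtr0_norm; last lra.
move=> /(_ ltac:(lra)); rewrite subr0 lt_min gtr0_norm// => /andP[Uc Un].
rewrite ltr_pdivlMr // in Un.
have := H x (U x); rewrite subr0 => /(_ ltac:(by split; lra)).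
have := U2 x ltac:(lra).
have xa : x - a = m / 2 by lra.
have na : - (n1 * (x - a)) <= `|n1| * (x - a).
  by have := ler_norm (- n1); rewrite normrN; nra.
have kE : k * c = `|n1| + 1 + c by rewrite /k mulrDl mul1r divfK// gt_eqF.
move: na; have := normr_ge0 n1; move: `|n1| kE => N kE N0; rewrite !xa !expr2.
move: (U x) Ux Uc Un => u u0 uc un na h1 h2.
have g1 : c * m * N <= u * u * N by rewrite ler_wpM2r//; lra.
have g2 : c * m <= u * u by lra.
have g3 : k * c * u * u < c * n2 * u.
  by have := mulr_gt0 c0 u0; nra.
rewrite kE in g3.
have g4 : c * (2 * (n1 * (m / 2) + n2 * u)) <= c * (m / 2 * (m / 2) + u * u).
  by rewrite ler_pM2l.
have g5 : m / 2 * (m / 2) <= m / 4 by nra.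
nra.
Qed.

(** Nagumo's condition for every slope between the two extrema. On U one has n1 v = n2 fm with n2 >=
    0, so the product is n2 (fm - p) <= 0. At the left end v = 0, n2 <= 0 and p <= fM < 0. The lower
    graph and the right end follow by symmetry. *)
Lemma lens_normal fm fM a b U L x v n1 n2 p : box_lipschitz fm ->
  box_lipschitz fM -> (forall x v, fm x v < fM x v) ->
  lens fm fM a b U L -> in_lens a b U L x v ->
  lens_normal_at a b U L x v n1 n2 -> fm x v <= p <= fM x v ->
  n1 * v - n2 * p <= 0.
Proof.
move=> lm lM lt lUL [xab vLU] H fp.
have [Ua Ub La Lb] := lens_end lUL.
have Hflip : lens_normal_at (- b) (- a) (fun x => - L (- x)) (fun x => - U (- x))
    (- x) (- v) (- n1) (- n2).
  move=> x' v' [xab' vLU']; have := H (- x') (- v').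
  move=> /(_ ltac:(by split; lra)); rewrite !expr2; lra.
have ltf x' v' : flip fM x' v' < flip fm x' v' by rewrite /flip ltrN2.
have lf := lens_flip lUL.
have [xa|xa] := eqVneq x a.
  subst x; have v0 : v = 0 by lra.
  subst v; have := normal_left lm lt lUL H; have := lens_left lUL; nra.
have [xb|xb] := eqVneq x b.
  subst x; have v0 : v = 0 by lra.
  subst v; rewrite oppr0 in Hflip.
  by have := normal_left (flip_lipschitz lM) ltf lf Hflip; have := lens_right lUL; nra.
have {}xab := strict_itv xab xa xb.
have [vU|vU] := eqVneq v (U x).
  subst v; have [n20 n1E] := normal_upper lUL xab H.
  have Ux := lens_U lUL xab; rewrite n1E divfK ?gt_eqF//; nra.
have [vL|vL] := eqVneq v (L x).
  subst v; have xab' : - b < - x < - a by lra.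
  have := normal_upper lf xab'; rewrite opprK => /(_ _ _ Hflip).
  rewrite /flip !opprK => -[n20 n1E].
  have Lx := lens_L lUL xab.
  have -> : n1 = n2 * fM x (L x) / L x.
    by apply: oppr_inj; rewrite n1E invrN !mulrN !mulNr !opprK.
  by rewrite divfK ?lt_eqF//; nra.
have [-> ->] := normal_interior lUL xab (strict_itv vLU vL vU) H.
by rewrite !mul0r subrr.
Qed.

End Barrier.

Section Invariance.
Context {R : realType}.

(* Bony-Brezis argument: the squared distance to the lens grows at most
   exponentially, since at a nearest point the field does not point outwards. *)
Lemma lens_invariant (fm fM : R -> R -> R) (k a b : R) (U L : R -> R)
    (Y W phi : R -> R) (t1 Lam : R) :
  box_lipschitz fm -> box_lipschitz fM -> (forall x v, fm x v < fM x v) ->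
  lens fm fM a b U L -> continuous Y -> continuous W -> 0 < t1 -> 0 <= Lam ->
  (forall t, 0 < t < t1 -> is_derive t 1 Y (W t)) ->
  (forall t, 0 < t < t1 -> is_derive t 1 W (- phi t)) ->
  (forall t x v, 0 < t < t1 -> in_lens a b U L x v -> exists2 psi : R,
     fm x v <= psi <= fM x v &
     `|phi t - psi| <= Lam * (`|Y t - x| + `|W t - v|)) ->
  in_lens a b U L (Y 0) (W 0) -> in_lens a b U L (Y t1) (W t1).
Proof.
move=> lm lM lt lUL cY cW t10 Lam0 dY dW Hphi K0.
pose Q (t : R) (p : R * R) := (Y t - shear k p) ^+ 2 + (W t - p.2) ^+ 2.
pose lift (x v : R) : R * R := (x + k * v, v).
have slift x v : shear k (lift x v) = x by rewrite /shear /=; ring.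
have inK x v : in_lens a b U L x v -> lens_set k a b U L (lift x v).
  by move=> xv; apply/lens_setE; rewrite slift.
have KE p : lens_set k a b U L p -> in_lens a b U L (shear k p) p.2.
  by move/lens_setE.
have K_ne : lens_set k a b U L !=set0 by exists (lift (Y 0) (W 0)); exact: inK.
have cK := lens_compact (k := k) lUL.
have cs := @continuous_shear R k.
have cQ t : continuous (Q t).
  have sub2 (f : R * R -> R) (c : R) : continuous f ->
      continuous (fun p => (c - f p) ^+ 2).
    move=> cf p; have cf1 : {for p, continuous (fun p => c - f p)}.
      by apply: cvgB; [exact: cvg_cst|exact: cf].
    by under eq_fun do rewrite expr2; exact: (continuousM cf1 cf1).
  have c2 : continuous (fun p : R * R => p.2) by move=> p; exact: cvg_snd.
  by move=> p; apply: cvgD; [exact: sub2 cs p|exact: sub2 c2 p].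
have Q0 t p : 0 <= Q t p by rewrite addr_ge0 ?sqr_ge0.
have [//|nK1] := pselect (in_lens a b U L (Y t1) (W t1)); exfalso.
have [p1 /set_mem Kp1 Hp1] := compact_EVT_min K_ne cK (continuous_subspaceT (cQ t1)).
have Q1 : 0 < Q t1 p1.
  rewrite lt_neqAle Q0 andbT; apply/eqP => /esym/eqP.
  rewrite paddr_eq0 ?sqr_ge0// !sqrf_eq0 !subr_eq0 => /andP[/eqP E1 /eqP E2].
  by apply: nK1; rewrite E1 E2; exact: KE.
(* At a nearest point Q grows at a rate of at most c Q: the product 2 n1 n2 contributes Q and the
   Lipschitz error 3 Lam Q. *)
pose c := 1 + 3 * Lam.
pose m := Q t1 p1 * expR (- c * t1).
have m0 : 0 < m by rewrite mulr_gt0 ?expR_gt0.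
(* The slack e (1 + t) makes the final inequality strict, yet at t1 it is still below the weighted
   squared distance m. *)
pose e := m / (2 * (1 + t1)).
have e0 : 0 < e by rewrite divr_gt0//; lra.
have em : e * (1 + t1) < m by rewrite /e invfM mulrA divfK; lra.
pose F (p : R * R) t := Q t p * expR (- c * t) - e * (1 + t).
have cexp : continuous (fun t : R => expR (- c * t)).
  move=> t; apply: (@continuous_comp _ _ _ (fun t => - c * t) expR).
    by apply: cvgM; [exact: cvg_cst|exact: cvg_id].
  exact: continuous_expR.
pose FF (q : R * (R * R)) := F q.2 q.1.
have cFF : continuous FF.
  have c1 : continuous (fun q : R * (R * R) => q.1) by move=> q; exact: cvg_fst.
  have c2 : continuous (fun q : R * (R * R) => q.2) by move=> q; exact: cvg_snd.
  have cYq : continuous (fun q : R * (R * R) => Y q.1 - shear k q.2).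
    move=> q; apply: cvgB; first by apply: continuous_comp; [exact: c1|exact: cY].
    by apply: continuous_comp; [exact: c2|exact: cs].
  have cWq : continuous (fun q : R * (R * R) => W q.1 - q.2.2).
    move=> q; apply: cvgB; first by apply: continuous_comp; [exact: c1|exact: cW].
    by apply: continuous_comp; [exact: c2|exact: cvg_snd].
  have cEq : continuous (fun q : R * (R * R) => expR (- c * q.1)).
    move=> q; apply: (@continuous_comp _ _ _ (fun q : R * (R * R) => q.1)
      (fun t => expR (- c * t)) q (c1 q)); exact: cexp.
  move=> q; apply: cvgB; last first.
    apply: cvgM; first exact: cvg_cst.
    by apply: cvgD; [exact: cvg_cst|exact: c1].
  apply: cvgM; last exact: cEq.
  rewrite /Q; under eq_fun do rewrite !expr2.
  exact: (continuousD (continuousM (cYq q) (cYq q)) (continuousM (cWq q) (cWq q))).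
(* By compactness there is a last time [ts] at which some point of the lens satisfies F <= 0; the
   distance to the lens is never differentiated. *)
pose G := (`[0, t1] `*` lens_set k a b U L) `&` [set q | FF q <= 0].
have cG : compact G.
  apply: compact_closedI; last first.
    rewrite (_ : [set q | _] = FF @^-1` [set x | x <= 0]) //.
    by apply: closed_comp; [move=> q _; exact: cFF|exact: closed_le].
  by apply: compact_setX => //; exact: segment_compact.
have [p0 Kp0 p0E] : exists2 p, lens_set k a b U L p & Q 0 p = 0.
  exists (lift (Y 0) (W 0)); first exact: inK.
  by rewrite /Q slift !subrr expr0n addr0.
have F0 : F p0 0 = - e by rewrite /F p0E mul0r sub0r addr0 mulr1.
have G_ne : G !=set0.
  exists (0, p0); split; first by split; rewrite //= in_itv /= lexx ltW.
  by rewrite /FF /= F0 oppr_le0 ltW.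
have cfst : {within G, continuous (fun q : R * (R * R) => q.1)}.
  by apply: continuous_subspaceT => q; exact: cvg_fst.
have [[ts q0] /set_mem [[/= tsI Kq0] FFq0] Hts] := compact_EVT_max G_ne cG cfst.
rewrite in_itv /= in tsI; rewrite /FF /= in FFq0.
have maxG t p : 0 <= t <= t1 -> lens_set k a b U L p -> F p t <= 0 -> t <= ts.
  move=> tI Kp Fp; apply: (Hts (t, p)); apply/mem_set; split; last exact: Fp.
  by split; rewrite //= in_itv.
have cF p : continuous (F p).
  move=> t; have cc : {for t, continuous (fun t : R => (t, p))}.
    have ci : (fun t : R => t) @ t --> t by exact: cvg_id.
    have cp : (fun _ : R => p) @ t --> p by exact: cvg_cst.
    exact: cvg_pair ci cp.
  exact: (@continuous_comp _ _ _ _ FF t cc (cFF _)).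
have ts1 : ts < t1.
  rewrite lt_neqAle; apply/andP; split; last by case/andP: tsI.
  apply/eqP => E; move: FFq0; rewrite E leNgt => /negP; apply.
  rewrite /F subr_gt0; apply: lt_le_trans em _; rewrite /m ler_wpM2r ?expR_ge0//.
  by apply: Hp1; exact: mem_set.
have ts0 : 0 < ts.
  have [d d0 Hd] := (continuous_epsP (F p0) 0).1 (cF p0 0) e e0.
  pose t := Num.min d t1 / 2.
  have m1 : 0 < Num.min d t1 by rewrite lt_min d0.
  have m2 : Num.min d t1 <= d by rewrite ge_min lexx.
  have m3 : Num.min d t1 <= t1 by rewrite ge_min lexx orbT.
  have t0 : 0 < t by rewrite /t; clear -m1; lra.
  apply: lt_le_trans t0 _; apply: (maxG _ p0) => //.
    by rewrite /t; clear -m1 m3; lra.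
  have := Hd t; rewrite subr0 gtr0_norm; last by rewrite /t; clear -m1; lra.
  move=> /(_ ltac:(rewrite /t; clear -m1 m2; lra)); rewrite F0.
  by rewrite ltr_norml; clear; lra.
(* With the nearest point p at time ts kept fixed, [F p] is differentiable. Maximality of ts makes
   its derivative there nonnegative, which the normal inequality contradicts. *)
have [p /set_mem Kp Hp] := compact_EVT_min K_ne cK (continuous_subspaceT (cQ ts)).
have Fp : F p ts <= 0.
  apply: le_trans FFq0; rewrite lerD2r ler_wpM2r ?expR_ge0//.
  by apply: Hp; exact: mem_set.
have Fpos t : ts < t < ts + (t1 - ts) -> F p ts <= F p t.
  move=> /andP[tst tt1]; apply: le_trans Fp _; rewrite leNgt; apply/negP => Ft.
  suff : t <= ts by rewrite leNgt tst.
  apply: (maxG _ p) => //; last exact: ltW.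
  by clear -tst tt1 ts0; lra.
have tsI' : 0 < ts < t1 by rewrite ts0.
have dYs := dY _ tsI'; have dWs := dW _ tsI'.
pose n1 := Y ts - shear k p; pose n2 := W ts - p.2.
have [psi fpsi psiL] := Hphi _ _ _ tsI' (KE _ Kp).
have nrm : n1 * p.2 - n2 * psi <= 0.
  apply: (lens_normal lm lM lt lUL (KE _ Kp)) => // x v xv.
  have := Hp (lift x v); move=> /(_ (mem_set (inK _ _ xv))).
  rewrite /Q slift /= /n1 /n2 !expr2; move: (Y ts) (W ts) (shear k p) p.2.
  by clear => *; lra.
have dF : is_derive ts 1 (F p)
    ((2 * (n1 * W ts - n2 * phi ts) - c * Q ts p) * expR (- c * ts) - e).
  have did : is_derive ts 1 (fun t : R => t) (1 : R) by exact: is_derive_id.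
  have dexp : is_derive ts 1 (fun t => expR (- c * t)) (- c * expR (- c * ts)).
    have := @is_derive_affine _ expR (- c) 0 ts (expR (- c * ts)).
    by rewrite addr0 => /(_ (is_derive_expR _)); under eq_fun do rewrite addr0.
  have dn1 := is_derive_sub dYs (is_derive_const (shear k p) ts).
  have dn2 := is_derive_sub dWs (is_derive_const p.2 ts).
  have dQ := is_derive_add (is_derive_mul dn1 dn1) (is_derive_mul dn2 dn2).
  have := is_derive_sub (is_derive_mul dQ dexp) (is_derive_mul
    (is_derive_const e ts) (is_derive_add (is_derive_const 1 ts) did)).
  rewrite /F /Q; under [X in _ -> is_derive _ _ X _]eq_fun do rewrite !expr2.
  move=> dF; apply: (is_derive_eq dF); rewrite -/n1 -/n2 !expr2; ring.
have t1s : 0 < t1 - ts by rewrite subr_gt0.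
have := derive_right_ge dF t1s Fpos; apply/negP; rewrite -ltNge subr_lt0.
apply: le_lt_trans e0; apply: mulr_le0_ge0; last exact: expR_ge0.
rewrite /Q -/n1 -/n2 /c; have WE : W ts = p.2 + n2 by rewrite /n2 addrC subrK.
have pE : phi ts = psi + (phi ts - psi) by rewrite addrC subrK.
rewrite WE pE; move: psiL; rewrite -/n1 -/n2.
move: (phi ts - psi) nrm Lam0; clear => r nrm Lam0 psiL.
have h1 : - (n2 * r) <= `|n2| * (Lam * (`|n1| + `|n2|)).
  apply: le_trans (ler_norm _) _; rewrite normrN normrM ler_wpM2l//.
have s1 : n1 ^+ 2 = `|n1| ^+ 2 by rewrite real_normK ?num_real.
have s2 : n2 ^+ 2 = `|n2| ^+ 2 by rewrite real_normK ?num_real.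
have h2 : 2 * (n1 * n2) <= n1 ^+ 2 + n2 ^+ 2 by have := sqr_ge0 (n1 - n2); nra.
have h3 : 2 * (`|n1| * `|n2|) <= n1 ^+ 2 + n2 ^+ 2.
  by rewrite s1 s2; have := sqr_ge0 (`|n1| - `|n2|); nra.
have h4 : Lam * (2 * (`|n1| * `|n2|)) <= Lam * (n1 ^+ 2 + n2 ^+ 2).
  by rewrite ler_wpM2l.
have h5 : 0 <= Lam * n1 ^+ 2 by rewrite mulr_ge0 ?sqr_ge0.
have h6 : `|n2| * (Lam * (`|n1| + `|n2|)) = Lam * (`|n1| * `|n2|) + Lam * n2 ^+ 2.
  by rewrite s2; ring.
rewrite h6 in h1; nra.
Qed.

End Invariance.

(** * Trajectories do not accumulate on a cycle *)

Section Drift.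
Context {R : realType}.
Implicit Types (fm fM f : R -> R -> R) (a b x v n e t c r : R) (U L Y W phi : R -> R).

Definition cluster_point Y W x v := forall r t, 0 < r ->
  exists2 s : R, t <= s & `|Y s - x| < r /\ `|W s - v| < r.

(** The filter consists of the tails of the trajectory restricted to its visits to K; returns at
    arbitrarily late times suffice, without eventual confinement. *)
Lemma compact_cluster_point Y W (K : set (R * R)) : compact K ->
  (forall t, exists2 s : R, t <= s & K (Y s, W s)) ->
  exists2 p, K p & cluster_point Y W p.1 p.2.
Proof.
move=> cK freq.
pose F : set_system (R * R) :=
  [set A | exists t, forall s, t <= s -> K (Y s, W s) -> A (Y s, W s)].
have FF : ProperFilter F.
  split.
    by move=> [t Ht]; have [s ts Ks] := freq t; exact: Ht ts Ks.
  split.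
  - by exists 0.
  - move=> A B [t Ht] [t' Ht']; exists (Num.max t t') => s.
    by rewrite ge_max => /andP[ts t's] Ks; split; [exact: Ht|exact: Ht'].
  - by move=> A B AB [t Ht]; exists t => s ts Ks; apply: AB; exact: Ht.
have [|p [Kp clp]] := cK F FF; first by exists 0.
exists p => // r t r0.
pose A : set (R * R) := [set q | exists2 s : R, t <= s & q = (Y s, W s)].
have FA : F A by exists t => s ts _; exists s.
have nB : nbhs p (ball p r) by apply/nbhs_ballP; exists r.
have [_ [[s ts ->] [/= B1 B2]]] := clp A _ FA nB.
by exists s => //; split; rewrite distrC.
Qed.

(** The speed is bounded, so each late approach to (x, v) is followed by a stay of fixed length s in
    the box of radius r, during which G falls by c s. The states so reached lie in a compact set
    where G <= - c s / 2, and they accumulate there. *)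
Lemma drift_cluster Y W phi (G : R * R -> R) (B T x v r c : R) :
  continuous Y -> continuous W -> continuous G -> 0 < r -> 0 < c -> 0 <= T ->
  (forall t, 0 < t -> is_derive t 1 Y (W t)) ->
  (forall t, 0 < t -> is_derive t 1 W (- phi t)) ->
  (forall t, 0 < t -> `|W t| <= B /\ `|phi t| <= B) ->
  (forall t, T < t -> `|Y t - x| <= r -> `|W t - v| <= r ->
     exists2 l : R, is_derive t 1 (fun t => G (Y t, W t)) l & l <= - c) ->
  cluster_point Y W x v -> G (x, v) = 0 ->
  exists x' v', [/\ `|x' - x| <= r, `|v' - v| <= r, G (x', v') < 0 &
                    cluster_point Y W x' v'].
Proof.
move=> cY cW cG r0 c0 T0 dY dW bB dG clp Gp.
have B0 : 0 <= B by have [/(le_trans (normr_ge0 _))] := bB 1 ltr01.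
(* During time s the displacement is at most r / 2, and the approach starts within r / 2 of the
   point; B + 1 avoids a division by 0. *)
pose s := r / (2 * (B + 1)).
have s0 : 0 < s by rewrite divr_gt0//; lra.
have sB : (B + 1) * s = r / 2.
  have B1 : B + 1 != 0 by rewrite gt_eqF//; lra.
  by rewrite /s; field.
have cYW : continuous (fun t => (Y t, W t)).
  by move=> t; exact: cvg_pair (cY t) (cW t).
have cGt : continuous (fun t => G (Y t, W t)).
  by move=> t; exact: (@continuous_comp _ _ _ _ G t (cYW t) (cG _)).
pose K : set (R * R) := (`[x - r, x + r] `*` `[v - r, v + r]) `&`
                        [set p | G p <= - (c * s / 2)].
have cK : compact K.
  apply: compact_closedI; first by apply: compact_setX; exact: segment_compact.
  rewrite (_ : [set p | _] = G @^-1` [set z | z <= - (c * s / 2)]) //.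
  by apply: closed_comp; [move=> p _; exact: cG|exact: closed_le].
have [t|[x' v'] [[/= x'I v'I] Gle] cl'] := compact_cluster_point (Y := Y) (W := W) cK; last first.
  exists x', v'; split=> //.
  - by move: x'I; rewrite in_itv /= ler_distl.
  - by move: v'I; rewrite in_itv /= ler_distl.
  - by have := mulr_gt0 c0 s0; move: Gle => /=; clear; lra.
have cs0 : 0 < c * s / 2 by have := mulr_gt0 c0 s0; clear; lra.
have [d d0 Hd] : exists2 d : R, 0 < d & forall z u, `|z - x| < d -> `|u - v| < d ->
    G (z, u) < c * s / 2.
  have /cvgrPdist_lt/(_ _ cs0)/nbhs_ballP[d /= d0 Hd] := cG (x, v).
  exists d => // z u zx uv; have := Hd (z, u).
  move=> /(_ ltac:(by split; rewrite /ball /= distrC)); rewrite Gp sub0r normrN.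
  exact: le_lt_trans (ler_norm _).
pose d' := Num.min d (r / 2).
have d'0 : 0 < d' by rewrite lt_min d0; lra.
have dd' : d' <= d by rewrite ge_min lexx.
have dr' : d' <= r / 2 by rewrite ge_min lexx orbT.
have [t1 t1t [Y1 W1]] := clp d' (Num.max t (T + 1)) d'0.
move: t1t; rewrite ge_max => /andP[tt1 Tt1].
have t10 : 0 < t1 by clear -Tt1 T0; lra.
have move_le (f df : R -> R) : continuous f ->
    (forall u : R, 0 < u -> is_derive u 1 f (df u)) ->
    (forall u : R, 0 < u -> `|df u| <= B) ->
    forall u : R, t1 <= u <= t1 + s -> `|f u - f t1| <= r / 2.
  move=> cf dfE bf u /andP[]; rewrite le_eqVlt => /orP[/eqP <- _|tu us].
    by rewrite subrr normr0; clear -r0; lra.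
  have [z /andP[z1 z2]|z /andP[z1 z2] ->] := mean_value (df := df) tu cf.
    by apply: dfE; exact: lt_trans z1.
  have z0 : 0 < z by exact: lt_trans z1.
  rewrite normrM -sB (gtr0_norm (x := u - t1)) ?subr_gt0//.
  by apply: (@ler_pM R) => //; [by rewrite subr_ge0 ltW|
    by apply: le_trans (bf z z0) _; rewrite lerDl|by rewrite lerBlDl].
have NY (u : R) : t1 <= u <= t1 + s -> `|Y u - x| <= r.
  move=> us; have h := move_le Y W cY dY (fun u u0 => (bB u u0).1) u us.
  have := ler_distD (Y t1) (Y u) x; clear -h Y1 dr'; lra.
have NW (u : R) : t1 <= u <= t1 + s -> `|W u - v| <= r.
  have bn (u' : R) : 0 < u' -> `|- phi u'| <= B by move=> /bB[_]; rewrite normrN.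
  move=> us; have h := move_le W (fun u => - phi u) cW dW bn u us.
  have := ler_distD (W t1) (W u) v; clear -h W1 dr'; lra.
exists (t1 + s); first by clear -tt1 s0; lra.
have us : t1 <= t1 + s <= t1 + s by clear -s0; lra.
split; first by split => /=; rewrite in_itv /= -ler_distl; [exact: NY|exact: NW].
have h1 : t1 <= t1 + s by clear -s0; lra.
have h2 : continuous (fun t => G (Y t, W t) + c * t).
  by move=> u; apply: cvgD; [exact: cGt|apply: cvgM; [exact: cvg_cst|exact: cvg_id]].
have : G (Y (t1 + s), W (t1 + s)) + c * (t1 + s) <= G (Y t1, W t1) + c * t1.
  apply: (derive_le0_ge h1 h2) => u /andP[u1 u2].
  have [||| l dl lc] := dG u.
  - by clear -u1 Tt1; lra.
  - by apply: NY; clear -u1 u2; lra.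
  - by apply: NW; clear -u1 u2; lra.
  exists (l + c); last by clear -lc; lra.
  have did : is_derive u 1 (fun t : R => t) (1 : R) by exact: is_derive_id.
  have := is_derive_add dl (is_derive_mul (is_derive_const c u) did).
  by rewrite mul0r add0r mulr1.
have := Hd (Y t1) (W t1) (lt_le_trans Y1 dd') (lt_le_trans W1 dd').
by rewrite mulrDr /=; move: (G _) (G _); clear -s0 c0 => g1 g2; lra.
Qed.

(* As f0 lies strictly between fm and fM, the limiting field y' = w, w' = - f0
   crosses the cycle strictly inwards off the line w = 0 and leaves that line at
   once, so that the trajectory cannot have all its cluster points on the
   cycle. *)
Record stalled fm fM f0 a b U L Y W phi (B : R) : Prop := Stalled {
  st_lipm : box_lipschitz fm;
  st_lipM : box_lipschitz fM;
  st_lt : forall x v, fm x v < f0 x v < fM x v;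
  st_lens : lens fm fM a b U L;
  st_contY : continuous Y;
  st_contW : continuous W;
  st_dY : forall t, 0 < t -> is_derive t 1 Y (W t);
  st_dW : forall t, 0 < t -> is_derive t 1 W (- phi t);
  st_bound : forall t, 0 < t -> `|W t| <= B /\ `|phi t| <= B;
  st_phi : forall x v e, 0 < e -> exists r T : R, [/\ 0 < r, 0 <= T &
    forall t, T < t -> `|Y t - x| <= r -> `|W t - v| <= r ->
      `|phi t - f0 x v| < e];
  st_cluster : forall x v, cluster_point Y W x v ->
    a <= x <= b /\ (v = U x \/ v = L x) }.

Lemma stalled_flip fm fM f0 a b U L Y W phi B :
  stalled fm fM f0 a b U L Y W phi B ->
  stalled (flip fM) (flip fm) (flip f0) (- b) (- a)
    (fun x => - L (- x)) (fun x => - U (- x)) (fun t => - Y t) (fun t => - W t)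
    (fun t => - phi t) B.
Proof.
case=> lm lM lt lUL cY cW dY dW bB hphi cl; split.
- exact: flip_lipschitz.
- exact: flip_lipschitz.
- by move=> x v; have := lt (- x) (- v); rewrite /flip; lra.
- exact: lens_flip.
- by move=> t; apply: continuousN; exact: cY.
- by move=> t; apply: continuousN; exact: cW.
- by move=> t t0; exact: is_derive_opp (dY t t0).
- by move=> t t0; exact: is_derive_opp (dW t t0).
- by move=> t t0; rewrite !normrN; exact: bB.
- move=> x v e e0; have [r [T [r0 T0 H]]] := hphi (- x) (- v) e e0.
  exists r, T; split=> // t Tt Yx Wv.
  rewrite /flip -opprD normrN; apply: H => //.
    by rewrite -normrN opprB addrC.
  by rewrite -normrN opprB addrC.
- move=> x v clp; have [|xI vE] := cl (- x) (- v).
    move=> r t r0; have [s ts [Ys Ws]] := clp r t r0; exists s => //.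
    by split; rewrite -normrN opprD opprK.
  split; first lra.
  by case: vE => E; [right|left]; rewrite -E opprK.
Qed.

(** Near the point the derivative of w - U(y) along the trajectory is close to fm - f0 < 0. So
    another cluster point lies strictly below U, still with w > 0, where the curve consists of U
    alone. *)
Lemma stalled_pos fm fM f0 a b U L Y W phi B x v :
  stalled fm fM f0 a b U L Y W phi B -> cluster_point Y W x v -> 0 < v -> False.
Proof.
case=> lm lM lt lUL cY cW dY dW bB hphi cl clp v0.
have [Ua Ub La Lb] := lens_end lUL.
have cU := lens_contU lUL.
have curveU x' v' : cluster_point Y W x' v' -> 0 < v' ->
    a < x' < b /\ v' = U x'.
  move=> /cl[x'I v'E] v'0.
  have [x'a|na] := eqVneq x' a; first by subst x'; case: v'E; lra.
  have [x'b|nb] := eqVneq x' b; first by subst x'; case: v'E; lra.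
  have x'ab := strict_itv x'I na nb; split=> //.
  by case: v'E => // E; have := lens_L lUL x'ab; lra.
have [xab vU] := curveU _ _ clp v0; have Ux := lens_U lUL xab.
pose c := (f0 x v - fm x v) / 2.
have c0 : 0 < c by have := lt x v; rewrite /c; clear; lra.
have c20 : 0 < c / 2 by clear -c0; lra.
have [r1 [T [r10 T0 Hphi]]] := hphi x v _ c20.
(* Since U' = - fm / U, this is the term - U'(y) y' of the derivative; at (x, v), where v = U x, it
   equals fm x v. *)
pose Hs (p : R * R) := fm p.1 (U p.1) / U p.1 * p.2.
have cHs : {for (x, v), continuous Hs}.
  have cf : {for (x, v), continuous (fun p : R * R => p.1)} by exact: cvg_fst.
  have cUf : {for (x, v), continuous (fun p : R * R => U p.1)}.
    exact: (@continuous_comp _ _ _ (fun p : R * R => p.1) U (x, v) cf (cU _)).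
  apply: cvgM; last exact: cvg_snd.
  apply: cvgM; first exact: (box_lipschitz_cont lm cf cUf).
  by apply: cvgV => //=; rewrite gt_eqF.
have /cvgrPdist_lt/(_ _ c20)/nbhs_ballP[r2 /= r20 Hr2] := cHs.
pose r := Num.min (Num.min r1 (r2 / 2)) (Num.min v (Num.min (x - a) (b - x)) / 2).
have r0 : 0 < r.
  rewrite /r !lt_min r10 divr_gt0//= divr_gt0// !lt_min v0 /=.
  by clear -xab; lra.
have rr1 : r <= r1 by rewrite /r ge_min ge_min lexx.
have rr2 : r <= r2 / 2 by rewrite /r ge_min ge_min lexx orbT.
pose m := Num.min v (Num.min (x - a) (b - x)).
have m0 : 0 < m by rewrite !lt_min v0 /=; clear -xab; lra.
have rm : r <= m / 2 by rewrite /r ge_min lexx orbT.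
have mv : m <= v by rewrite /m ge_min lexx.
have ma : m <= x - a by rewrite /m ge_min ge_min lexx orbT.
have mb : m <= b - x by rewrite /m ge_min ge_min lexx !orbT.
pose G (p : R * R) := p.2 - U p.1.
have cG : continuous G.
  move=> p; apply: cvgB; first exact: cvg_snd.
  by apply: (@continuous_comp _ _ _ (fun p : R * R => p.1) U p); [exact: cvg_fst|exact: cU].
have dG t : T < t -> `|Y t - x| <= r -> `|W t - v| <= r ->
    exists2 l : R, is_derive t 1 (fun t => G (Y t, W t)) l & l <= - c.
  move=> Tt Yx Wv; have t0 : 0 < t by exact: le_lt_trans Tt.
  have YI : a < Y t < b.
    by move: Yx; rewrite ler_norml; clear -rm ma mb m0; lra.
  have dUY := is_derive1_comp (lens_dU lUL YI) (dY _ t0).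
  have dGt := is_derive_sub (dW _ t0) dUY.
  eexists; first exact: dGt.
  have := Hphi t Tt (le_trans Yx rr1) (le_trans Wv rr1).
  have /Hr2 : ball (x, v) r2 (Y t, W t).
    have r2' : r < r2 by clear -rr2 r20; lra.
    by split; rewrite /ball /= distrC; exact: le_lt_trans r2'.
  rewrite /Hs /= -vU divfK ?gt_eqF// /c.
  set z := _ * W t; rewrite (_ : - fm _ _ / _ * _ = - z); last by rewrite /z; ring.
  rewrite !ltr_norml; clear; lra.
have Gxv : G (x, v) = 0 by rewrite /G /= vU subrr.
have [x' [v' [x'x v'v Gneg cl']]] :=
  drift_cluster cY cW cG r0 c0 T0 dY dW bB dG clp Gxv.
have v'0 : 0 < v' by move: v'v; rewrite ler_norml; clear -rm mv m0; lra.
have [_ E] := curveU _ _ cl' v'0.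
by move: Gneg; rewrite /G /= E subrr ltxx.
Qed.

(** At the left end f0 < fM < 0, so w increases there; the drift of - w yields a cluster point with
    w > 0, which [stalled_pos] forbids. *)
Lemma stalled_left fm fM f0 a b U L Y W phi B :
  stalled fm fM f0 a b U L Y W phi B -> cluster_point Y W a 0 -> False.
Proof.
move=> st clp; case: (st) => lm lM lt lUL cY cW dY dW bB hphi cl.
pose c := - f0 a 0 / 2.
have c0 : 0 < c by have := lt a 0; have := lens_left lUL; rewrite /c; clear; lra.
have [r [T [r0 T0 Hphi]]] := hphi a 0 _ c0.
have cG : continuous (fun p : R * R => - p.2).
  by move=> p; apply: cvgN; exact: cvg_snd.
have [||x' [v' [x'x v'v Gneg cl']]] :=
  drift_cluster (c := c) cY cW cG r0 c0 T0 dY dW bB _ clp _; last first.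
- by apply: (stalled_pos st cl'); rewrite -oppr_lt0.
- by rewrite /= oppr0.
- move=> t Tt Yx Wv; have t0 : 0 < t by exact: le_lt_trans Tt.
  exists (- - phi t); first exact: is_derive_opp (dW _ t0).
  have := Hphi t Tt Yx Wv; rewrite ltr_norml /c opprK; clear; lra.
Qed.

Lemma not_stalled fm fM f0 a b U L Y W phi B x v :
  stalled fm fM f0 a b U L Y W phi B -> cluster_point Y W x v -> False.
Proof.
move=> st clp; have stf := stalled_flip st.
have clf : cluster_point (fun t => - Y t) (fun t => - W t) (- x) (- v).
  move=> r t r0; have [s ts [Ys Ws]] := clp r t r0; exists s => //.
  by rewrite -!opprD !normrN.
have [v0|v0|v0] := ltrgt0P v.
- exact: stalled_pos st clp v0.
- by apply: (stalled_pos stf clf); rewrite oppr_gt0.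
subst v; have [xI vE] := st_cluster st clp; have lUL := st_lens st.
have [xa|na] := eqVneq x a; first by subst x; exact: stalled_left st clp.
have [xb|nb] := eqVneq x b.
  by subst x; rewrite oppr0 in clf; exact: stalled_left stf clf.
have xab := strict_itv xI na nb.
have := lens_U lUL xab; have := lens_L lUL xab.
by case: vE => <-; rewrite ltxx.
Qed.

End Drift.

(** * Global solutions of Lipschitz systems *)

Section Picard.
Context {R : realType}.
Implicit Types (f g : R -> R) (t s e c l : R).

(** Integration starts at -1 so that 0 is an interior point, and the value is frozen for t <= 0: P
    is continuous on the whole line although a derivative is claimed only for t > 0. *)
Lemma primitive_pos g : continuous g ->
  exists P : R -> R, [/\ continuous P, forall t, t <= 0 -> P t = 0 &
    forall t, 0 < t -> is_derive t 1 P (g t)].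
Proof.
move=> cg; pose F (x : R) := (\int[lebesgue_measure]_(t in [set` `[-1, x]]) g t)%R.
have dF (x : R) : -1 < x -> is_derive x 1 F (g x).
  move=> x1; have xx : x < x + 1 by rewrite ltrDl.
  have int : lebesgue_measure.-integrable `[-1, x + 1] (EFin \o g).
    apply: continuous_compact_integrable; first exact: segment_compact.
    exact: continuous_subspaceT.
  have [dx E] := continuous_FTC1_closed xx int x1 (cg x).
  by apply: DeriveDef dx _; rewrite -derive1E; exact: E.
have cF (x : R) : -1 < x -> {for x, continuous F}.
  move=> x1; apply/differentiable_continuous/derivable1_diffP.
  by have [] := dF x x1.
pose P t := F (Num.max 0 t) - F 0.
exists P; split.
- move=> t; apply: cvgB; last exact: cvg_cst.
  have cm : {for t, continuous (fun t : R => Num.max 0 t)}.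
    by apply: continuous_max; [exact: cvg_cst|exact: cvg_id].
  apply: (@continuous_comp _ _ _ (fun t : R => Num.max 0 t) F t cm).
  by apply: cF; rewrite lt_max; apply/orP; left; rewrite ltrN10.
- by move=> t t0; rewrite /P max_l// subrr.
- move=> t t0; apply: (is_derive_local t0 (f := fun t => F t - F 0)).
    by move=> s; rewrite /P ltr_norml => st; rewrite max_r//; lra.
  rewrite -[g t]subr0; have t1 : -1 < t by lra.
  exact: is_derive_sub (dF t t1) (is_derive_const (F 0) t).
Qed.

(** Integrating the exponential gains the factor 1 / k, the source of the contraction in the
    weighted norm. *)
Lemma exp_bound_diff (f g df dg : R -> R) (k C : R) : 0 < k -> 0 <= C ->
  continuous f -> continuous g -> f 0 = g 0 ->
  (forall t, 0 < t -> is_derive t 1 f (df t)) ->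
  (forall t, 0 < t -> is_derive t 1 g (dg t)) ->
  (forall t, 0 < t -> `|df t - dg t| <= C * expR (k * t)) ->
  forall t, 0 <= t -> `|f t - g t| <= C / k * expR (k * t).
Proof.
move=> k0 C0 cf cg fg dF dG H t t0.
pose h (s : R) := C / k * expR (k * s).
have ch : continuous h.
  move=> s; apply: cvgM; first exact: cvg_cst.
  apply: (@continuous_comp _ _ _ (fun s => k * s) expR); last exact: continuous_expR.
  by apply: cvgM; [exact: cvg_cst|exact: cvg_id].
have dh s : is_derive s 1 h (C * expR (k * s)).
  have := @is_derive_affine _ expR k 0 s (expR (k * s)).
  rewrite addr0 => /(_ (is_derive_expR _)); under eq_fun do rewrite addr0.
  move=> /(is_derive_mul (is_derive_const (C / k) s)).
  by rewrite mul0r add0r mulrA divfK// gt_eqF.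
have h0 : 0 <= h 0 by rewrite mulr_ge0 ?expR_ge0// divr_ge0// ltW.
suff side (p q dp dq : R -> R) : continuous p -> continuous q -> p 0 = q 0 ->
    (forall t, 0 < t -> is_derive t 1 p (dp t)) ->
    (forall t, 0 < t -> is_derive t 1 q (dq t)) ->
    (forall t, 0 < t -> `|dp t - dq t| <= C * expR (k * t)) ->
    p t - q t <= h t.
  rewrite ler_norml.
  have H' s : 0 < s -> `|dg s - df s| <= C * expR (k * s).
    by move=> s0; rewrite distrC; exact: H.
  have := side f g df dg cf cg fg dF dG H.
  have := side g f dg df cg cf (esym fg) dG dF H'.
  by rewrite /h => h1 h2; apply/andP; split; lra.
move=> cp cq pq dP dQ Hpq; rewrite -subr_ge0.
have : 0 <= h 0 - (p 0 - q 0) by rewrite pq subrr subr0.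
move=> /le_trans; apply.
apply: (@derive_ge0_le _ (fun s => h s - (p s - q s)) _ _ t0).
  move=> s; apply: cvgB; first exact: ch.
  by apply: cvgB; [exact: cp|exact: cq].
move=> s /andP[s0 _]; exists (C * expR (k * s) - (dp s - dq s)).
  exact: is_derive_sub (dh s) (is_derive_sub (dP s s0) (dQ s s0)).
by rewrite subr_ge0 (le_trans (ler_norm _))// Hpq.
Qed.

(** 2 C / 2^n is the tail of the geometric series, so the intervals [b n, d n] are nested and the
    limit is a common point. *)
Lemma geometric_limit (a : nat -> R) (C : R) : 0 <= C ->
  (forall n, `|a n.+1 - a n| <= C / 2 ^+ n) ->
  exists l, forall n, `|a n - l| <= 2 * C / 2 ^+ n.
Proof.
move=> C0 H.
have p0 n : 0 < (2 : R) ^+ n by rewrite exprn_gt0.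
have half n : 2 * C / 2 ^+ n.+1 = C / 2 ^+ n.
  by have := p0 n; rewrite exprS => pn; field; rewrite gt_eqF.
have dbl n : 2 * C / 2 ^+ n = C / 2 ^+ n + C / 2 ^+ n by rewrite -mulrA; ring.
pose b n := a n - 2 * C / 2 ^+ n; pose d n := a n + 2 * C / 2 ^+ n.
have bS n : b n <= b n.+1.
  by have := H n; rewrite /b half dbl ler_norml; lra.
have dS n : d n.+1 <= d n.
  by have := H n; rewrite /d half dbl ler_norml; lra.
have bm m n : (m <= n)%N -> b m <= b n.
  move=> /subnK <-; elim: (n - m)%N => [//|k IH]; exact: le_trans (bS _).
have dm m n : (m <= n)%N -> d n <= d m.
  move=> /subnK <-; elim: (n - m)%N => [//|k IH]; exact: le_trans (dS _) _.
have bd n : b n <= d n.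
  have : 0 <= 2 * C / 2 ^+ n by rewrite divr_ge0 ?mulr_ge0// ltW.
  by rewrite /b /d; lra.
have bdnm n m : b n <= d m.
  have [nm|mn] := leqP n m; first exact: le_trans (bm _ _ nm) (bd m).
  exact: le_trans (bd n) (dm _ _ (ltnW mn)).
exists (sup (range b)) => n.
have hs : has_sup (range b).
  by split; [exists (b 0), 0|exists (d 0) => _ [m _ <-]; exact: bdnm].
have lb : b n <= sup (range b) by apply: ub_le_sup; [case: hs|exists n].
have ub : sup (range b) <= d n.
  by apply: ge_sup; [case: hs|move=> _ [m _ <-]; exact: bdnm].
by rewrite ler_norml; move: lb ub; rewrite /b /d; lra.
Qed.

(* Picard iterates contract by 1/2 in the norm weighted by expR (- 2 L t), which
   gives a solution on the whole half-line at once. *)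
Theorem picard (I : finType) (F : R -> (I -> R) -> I -> R) (L M : R)
    (u0 : I -> R) : 0 < L -> 0 <= M ->
  (forall t u v d, (forall i, `|u i - v i| <= d) ->
     forall i, `|F t u i - F t v i| <= L * d) ->
  (forall u : I -> R -> R, (forall i, continuous (u i)) ->
     forall i, continuous (fun t => F t (u ^~ t) i)) ->
  (forall t i, `|F t u0 i| <= M) ->
  exists u : I -> R -> R, [/\ forall i, continuous (u i),
    forall i, u i 0 = u0 i &
    forall t i, 0 < t -> is_derive t 1 (u i) (F t (u ^~ t) i)].
Proof.
move=> L0 M0 lipF cF bF.
(* A primitive is chosen for every function; it is arbitrary when g is discontinuous, but all the
   iterates are continuous. *)
have /choice[prim primP] : forall g : R -> R, exists P : R -> R, continuous g ->
    [/\ continuous P, forall t, t <= 0 -> P t = 0 &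
        forall t, 0 < t -> is_derive t 1 P (g t)].
  move=> g; have [cg|ncg] := pselect (continuous g).
    by have [P HP] := primitive_pos cg; exists P.
  by exists g.
pose step (u : I -> R -> R) i t := u0 i + prim (fun s => F s (u ^~ s) i) t.
pose U n := iter n step (fun i _ => u0 i).
have stepP u : (forall i, continuous (u i)) -> forall i,
    [/\ continuous (step u i), forall t, t <= 0 -> step u i t = u0 i &
        forall t, 0 < t -> is_derive t 1 (step u i) (F t (u ^~ t) i)].
  move=> cu i; have [c1 z1 d1] := primP _ (cF u cu i); split.
  - by move=> t; apply: cvgD; [exact: cvg_cst|exact: c1].
  - by move=> t /z1; rewrite /step => ->; rewrite addr0.
  - move=> t t0; have := is_derive_add (is_derive_const (u0 i) t) (d1 t t0).
    by rewrite add0r.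
have cU n i : continuous (U n i).
  elim: n i => [|n IH] i; first by move=> t; exact: cvg_cst.
  by have [] := stepP _ IH i.
have U0 n i t : t <= 0 -> U n i t = u0 i.
  by case: n => [//|n] t0; have [_ H _] := stepP _ (cU n) i; exact: H.
pose E t := expR (2 * L * Num.max t 0).
have k0 : 0 < 2 * L by rewrite mulr_gt0.
pose c := M / (2 * L).
have c0 : 0 <= c by rewrite divr_ge0// ltW.
have EE t : 0 <= t -> E t = expR (2 * L * t) by move=> t0; rewrite /E max_l.
have diff n i t : `|U n.+1 i t - U n i t| <= (c * E t) / 2 ^+ n.
  have [t0|t0] := leP t 0.
    by rewrite !U0// subrr normr0 divr_ge0 ?exprn_ge0// mulr_ge0// expR_ge0.
  elim: n i t t0 => [|n IH] i t t0.
    rewrite expr0 divr1 (EE _ (ltW t0)).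
    have [cs _ ds] := stepP _ (cU 0%N) i.
    apply: (@exp_bound_diff (U 1%N i) (U 0%N i) (fun t => F t u0 i) (fun=> 0)
      (2 * L) M k0 M0 cs (cU 0%N i)).
    - by rewrite !U0.
    - move=> s s0; rewrite subr0; apply: le_trans (bF s i) _.
      by rewrite ler_peMr// ltW// pexpR_gt1// mulr_gt0.
    - exact: ltW.
  have [cs _ ds] := stepP _ (cU n.+1) i; have [cs' _ ds'] := stepP _ (cU n) i.
  have pn : 0 < (2 : R) ^+ n by rewrite exprn_gt0.
  (* The Lipschitz constant L divided by the exponent 2 L is the contraction factor 1 / 2. *)
  have -> : c * E t / 2 ^+ n.+1 = L * (c / 2 ^+ n) / (2 * L) * expR (2 * L * t).
    by rewrite (EE _ (ltW t0)) exprS; field; rewrite !gt_eqF.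
  apply: (exp_bound_diff k0 _ cs cs' _ ds ds').
  - by apply: mulr_ge0; [exact: ltW|apply: divr_ge0 => //; exact: ltW].
  - by rewrite -[LHS]/(U n.+2 i 0) -[RHS]/(U n.+1 i 0) !U0.
  - move=> s s0; rewrite -mulrA; apply: lipF => j.
    by rewrite mulrAC -(EE _ (ltW s0)); exact: IH.
  - exact: ltW.
have /choice[u1 Hu1] : forall p : I * R, exists l, forall n,
    `|U n p.1 p.2 - l| <= 2 * (c * E p.2) / 2 ^+ n.
  by move=> [i t]; apply: geometric_limit => [|n] /=;
    [rewrite mulr_ge0 ?expR_ge0|exact: diff].
pose u i t := u1 (i, t).
have Hu n i t : `|U n i t - u i t| <= 2 * (c * E t) / 2 ^+ n by exact: (Hu1 (i, t)).
have small (C e : R) : 0 <= C -> 0 < e -> exists n, C / 2 ^+ n < e.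
  move=> C0 e0; have [n Hn] : exists n : nat, C / e < n%:R.
    by exists (Num.bound (C / e)); rewrite archi_boundP// divr_ge0// ltW.
  exists n; rewrite ltr_pdivrMr ?exprn_gt0// mulrC -ltr_pdivrMr//.
  apply: lt_le_trans Hn _; by rewrite -natrX ler_nat ltnW// ltn_expl.
have Emono s t : s <= t -> E s <= E t.
  move=> st; rewrite ler_expR ler_pM2l// ge_max !le_max st lexx.
  by rewrite !orbT.
have cu i : continuous (u i).
  move=> t; apply/continuous_epsP => e e0.
  have C0 : 0 <= 2 * (c * E (t + 1)) by rewrite mulr_ge0// mulr_ge0// expR_ge0.
  have e30 : 0 < e / 3 by lra.
  have [n Hn] := small _ _ C0 e30.
  have [d d0 Hd] := (continuous_epsP _ t).1 (cU n i t) _ e30.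
  exists (Num.min d 1); first by rewrite lt_min d0 ltr01.
  move=> s; rewrite lt_min => /andP[/Hd sd]; rewrite ltr_norml => s1.
  have near r : r <= t + 1 -> `|U n i r - u i r| < e / 3.
    move=> rt; apply: le_lt_trans (Hu n i r) _; apply: le_lt_trans Hn.
    rewrite ler_wpM2r ?invr_ge0 ?exprn_ge0// ler_wpM2l// ler_wpM2l//.
    exact: Emono.
  have := near s ltac:(lra); have := near t ltac:(lra); move: sd.
  rewrite !ltr_norml; clear; lra.
(* For every n, both sides lie within c E(t) / 2^n of the iterate [U n.+1 i t]. *)
have uv i t : 0 <= t -> u i t = step u i t.
  move=> t0; apply/eqP; rewrite -subr_eq0 -normr_eq0; apply/eqP/le_anti.
  rewrite normr_ge0 andbT; apply/ler_addgt0Pr => e e0; rewrite add0r.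
  have C0 : 0 <= 2 * (c * E t) by rewrite mulr_ge0// mulr_ge0// expR_ge0.
  have [n Hn] := small _ _ C0 e0; apply: ltW; apply: le_lt_trans Hn.
  have [cs _ ds] := stepP _ (cU n) i; have [cs' z' ds'] := stepP _ cu i.
  have pn : 0 < (2 : R) ^+ n by rewrite exprn_gt0.
  have h : `|U n.+1 i t - step u i t| <= c * E t / 2 ^+ n.
    have -> : c * E t / 2 ^+ n = L * (2 * c / 2 ^+ n) / (2 * L) * expR (2 * L * t).
      by rewrite EE//; field; rewrite !gt_eqF.
    apply: (exp_bound_diff k0 _ cs cs' _ ds ds') => //.
    - by rewrite !mulr_ge0 ?invr_ge0// ltW.
    - by rewrite z'// -[LHS]/(U n.+1 i 0) U0.
    - move=> s s0; rewrite -mulrA; apply: lipF => j.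
      rewrite mulrAC -(EE _ (ltW s0)) -(mulrA 2); exact: Hu.
  have h' := Hu n.+1 i t.
  have hE : 2 * (c * E t) / 2 ^+ n.+1 = c * E t / 2 ^+ n.
    by rewrite exprS; field; rewrite gt_eqF.
  rewrite hE distrC in h'.
  have := ler_distD (U n.+1 i t) (u i t) (step u i t).
  have -> : 2 * (c * E t) / 2 ^+ n = c * E t / 2 ^+ n + c * E t / 2 ^+ n.
    by field; rewrite gt_eqF.
  by move=> h3; apply: le_trans h3 _; exact: lerD.
exists u; split=> //.
- by move=> i; rewrite uv//; have [_ H _] := stepP _ cu i; exact: H.
- move=> t i t0; apply: (is_derive_local t0 (f := step u i)).
    by move=> s; rewrite ltr_norml => st; rewrite uv//; lra.
  by have [_ _] := stepP _ cu i; apply.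
Qed.

End Picard.

(** * Derivatives and continuity by components *)

Section Components.
Context {R : realType}.

Lemma is_derive_cvgP (V W : normedModType R) (f : V -> W) (x v : V) (d : W) :
  is_derive x v f d <-> h^-1 *: (f (h *: v + x) - f x) @[h --> 0^'] --> d.
Proof.
split=> [[+ <-]|cv]; first by rewrite /derivable /derive.
apply: DeriveDef; first by apply/cvg_ex; exists d.
exact: (cvg_lim _ cv).
Qed.

Lemma is_derive_pairP (U W : normedModType R) (f : R -> U * W) (t : R) d :
  is_derive t 1 f d <->
  is_derive t 1 (fun t => (f t).1) d.1 /\ is_derive t 1 (fun t => (f t).2) d.2.
Proof.
rewrite !is_derive_cvgP; split=> [cv|[cv1 cv2]].
  split.
    have := cvg_comp _ _ cv (cvg_fst (F := nbhs d.1) (G := nbhs d.2)).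
    exact.
  have := cvg_comp _ _ cv (cvg_snd (F := nbhs d.1) (G := nbhs d.2)).
  exact.
have := cvg_pair cv1 cv2; exact.
Qed.

Lemma is_derive_colP n (f : R -> 'cV[R]_n) (t : R) (d : 'cV[R]_n) :
  is_derive t 1 f d <-> forall i, is_derive t 1 (fun t => f t i 0) (d i 0).
Proof.
split=> [[df <-] i|H].
  apply: DeriveDef; first exact: (derivable_mxP f t 1).1.
  by rewrite derive_mx// mxE.
have df : derivable f t 1.
  by apply/derivable_mxP => i j; rewrite ord1; exact: (@ex_derive _ _ _ _ _ _ _ (H i)).
apply: DeriveDef => //; rewrite derive_mx//; apply/colP => i; rewrite mxE.
by rewrite (@derive_val _ _ _ _ _ _ _ (H i)).
Qed.

Lemma continuous_colP n (T : topologicalType) (f : T -> 'cV[R]_n) (t : T) :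
  {for t, continuous f} <-> forall i, {for t, continuous (fun t => f t i 0)}.
Proof.
split=> [cf i|H].
  exact: (@continuous_comp _ _ _ f (fun M : 'cV[R]_n => M i 0) t cf
            (@coord_continuous R n 1 i 0 (f t))).
apply/cvgrPdist_le => e e0; near=> s.
rewrite /Num.Def.normr/= mx_normrE (bigmax_le _ (ltW e0))//= => i _.
rewrite !mxE/=; move: i; near: s; apply: filter_forall => -[i j] /=.
by rewrite ord1; exact: ((cvgrPdist_le _ _).1 (H i)).
Unshelve. all: by end_near. Qed.

End Components.

(** * The frequency term and its extrema on ellipsoids *)

Section Quadratic.
Context {R : realType}.

Lemma cdotE n (u v : 'cV[R]_n) : cdot u v = \sum_i u i 0 * v i 0.
Proof. by rewrite /cdot mxE; apply: eq_bigr => i _; rewrite mxE. Qed.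

Lemma quadE n (M : 'M[R]_n) (x : 'cV[R]_n) :
  quad M x = \sum_j \sum_i x i 0 * M i j * x j 0.
Proof.
rewrite /quad mxE; apply: eq_bigr => j _; rewrite mxE mulr_suml.
by apply: eq_bigr => i _; rewrite mxE.
Qed.

Lemma continuous_for_ext (T U : topologicalType) (f g : T -> U) (t : T) :
  g =1 f -> {for t, continuous f} -> {for t, continuous g}.
Proof. by move=> /funext ->. Qed.

Lemma continuous_bigsum (T : topologicalType) (I : finType) (f : I -> T -> R) t :
  (forall i, {for t, continuous (f i)}) ->
  {for t, continuous (fun x => \sum_i f i x)}.
Proof.
move=> cf; elim: (index_enum I) => [|i r IH].
  apply: (@continuous_for_ext _ _ (fun=> 0)) => [x|]; first by rewrite big_nil.
  exact: cvg_cst.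
apply: continuous_for_ext (continuousD (cf i) IH) => x; by rewrite big_cons.
Qed.

Lemma is_derive_bigsum (I : finType) (f : I -> R -> R) (df : I -> R) (t : R) :
  (forall i, is_derive t 1 (f i) (df i)) ->
  is_derive t 1 (fun x => \sum_i f i x) (\sum_i df i).
Proof.
move=> H; elim: (index_enum I) => [|i r IH].
  by under eq_fun do rewrite big_nil; rewrite big_nil; exact: is_derive_const.
by under eq_fun do rewrite big_cons; rewrite big_cons; exact: is_derive_add.
Qed.

Lemma continuous_cdot n (T : topologicalType) (u v : T -> 'cV[R]_n) (t : T) :
  {for t, continuous u} -> {for t, continuous v} ->
  {for t, continuous (fun t => cdot (u t) (v t))}.
Proof.
move=> /continuous_colP cu /continuous_colP cv.
apply: (continuous_for_ext (fun=> cdotE _ _)).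
by apply: continuous_bigsum => i; exact: continuousM (cu i) (cv i).
Qed.

Lemma continuous_quad n (T : topologicalType) (M : 'M[R]_n) (x : T -> 'cV[R]_n)
    (t : T) :
  {for t, continuous x} -> {for t, continuous (fun t => quad M (x t))}.
Proof.
move=> /continuous_colP cx; apply: (continuous_for_ext (fun=> quadE _ _)).
apply: continuous_bigsum => j; apply: continuous_bigsum => i.
by apply: continuousM (cx j); apply: continuousM (cx i) _; exact: cvg_cst.
Qed.

Lemma is_derive_quad n (A M : 'M[R]_n) (x : R -> 'cV[R]_n) (t : R) :
  is_derive t 1 x (A *m x t) ->
  is_derive t 1 (fun t => quad M (x t)) (quad (A^T *m M + M *m A) (x t)).
Proof.
move=> /is_derive_colP dx; under eq_fun do rewrite quadE.
have -> : quad (A^T *m M + M *m A) (x t) = \sum_j \sum_i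
    ((A *m x t) i 0 * M i j * x t j 0 + x t i 0 * M i j * (A *m x t) j 0).
  have bil (u v : 'cV[R]_n) : (u^T *m M *m v) 0 0 = \sum_j \sum_i u i 0 * M i j * v j 0.
    rewrite mxE; apply: eq_bigr => j _; rewrite mxE mulr_suml.
    by apply: eq_bigr => i _; rewrite mxE.
  have -> : quad (A^T *m M + M *m A) (x t) =
      ((A *m x t)^T *m M *m x t) 0 0 + ((x t)^T *m M *m (A *m x t)) 0 0.
    by rewrite /quad mulmxDr mulmxDl mxE trmx_mul !mulmxA.
  rewrite !bil -big_split; apply: eq_bigr => j _; rewrite -big_split.
  by apply: eq_bigr.
apply: is_derive_bigsum => j; apply: is_derive_bigsum => i.
have := is_derive_mul (is_derive_mul (dx i) (is_derive_const (M i j) t)) (dx j).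
by rewrite mulr0 addr0.
Qed.

Lemma quadZ n (M : 'M[R]_n) (c : R) (x : 'cV[R]_n) :
  quad M (c *: x) = c ^+ 2 * quad M x.
Proof.
rewrite !quadE mulr_sumr; apply: eq_bigr => j _; rewrite mulr_sumr.
by apply: eq_bigr => i _; rewrite !mxE; ring.
Qed.

(** c is the minimum of the form on the unit sphere of the sup norm; homogeneity extends the bound
    to all x. *)
Lemma pos_def_bound n (M : 'M[R]_n) : pos_def M ->
  exists2 c : R, 0 < c & forall (x : 'cV[R]_n) i, c * x i 0 ^+ 2 <= quad M x.
Proof.
move=> Mpos; have [S0|S0] := pselect ([set v : 'rV[R]_n | `|v| = 1] !=set0); last first.
  (* The sphere is empty only in dimension 0, where there is no index i. *)
  exists 1 => // x i; exfalso; apply: S0.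
  exists (const_mx 1); rewrite /= /Num.Def.normr/= mx_normrE.
  apply: le_anti; apply/andP; split.
    by apply: bigmax_le => // -[? ?] _; rewrite mxE normr1.
  by apply: (le_trans _ (le_bigmax _ _ (0, i))); rewrite mxE normr1.
have cS : compact [set v : 'rV[R]_n | `|v| = 1].
  apply: bounded_closed_compact.
    exists 1; split => // z z1 v /= ->; exact: ltW.
  rewrite (_ : [set v | _] = (fun v : 'rV[R]_n => `|v|) @^-1` [set 1])//.
  by apply: closed_comp; [move=> v _; exact: norm_continuous|exact: closed_eq].
have ctr : continuous (fun v : 'rV[R]_n => v^T).
  move=> v; apply/continuous_colP => i; apply: (@continuous_for_ext _ _ (fun v : 'rV[R]_n => v 0 i)) => [w|].
    by rewrite mxE.
  exact: coord_continuous.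
have cq : continuous (fun v : 'rV[R]_n => quad M v^T).
  by move=> v; apply: continuous_quad; exact: ctr.
have [v0 /set_mem /= v01 Hv0] := compact_EVT_min S0 cS (continuous_subspaceT cq).
exists (quad M v0^T).
  by apply: Mpos; rewrite trmx_eq0 -normr_eq0 v01 oner_eq0.
move=> x i; have [->|x0] := eqVneq x 0.
  by rewrite mxE expr0n mulr0 /quad trmx0 !mul0mx mxE.
have nx : 0 < `|x^T| by rewrite normr_gt0 trmx_eq0.
have := Hv0 (`|x^T|^-1 *: x^T); rewrite linearZ /= trmxK quadZ.
have -> : `|x^T|^-1 *: x^T \in [set v : 'rV[R]_n | `|v| = 1].
  by apply/mem_set; rewrite /= normrZ normfV normr_id mulVf// gt_eqF.
move=> /(_ isT) H.
apply: (@le_trans _ _ (quad M v0^T * `|x^T| ^+ 2)); last first.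
  by rewrite -ler_pdivlMr ?exprn_gt0// mulrC -exprVn.
rewrite ler_wpM2l//.
  by apply/ltW/Mpos; rewrite trmx_eq0 -normr_eq0 v01 oner_eq0.
rewrite -[x i 0 ^+ 2]real_normK ?num_real// lerXn2r ?nnegrE//.
rewrite [leRHS]/Num.Def.normr/= mx_normrE.
by apply: (le_trans _ (le_bigmax _ _ (0, i))); rewrite mxE.
Qed.

End Quadratic.

Section FrequencyTerm.
Context {R : realType}.
Implicit Types (s : params R) (P : 'M[R]_4) (V Vb : R).

Lemma derive_bound_lipschitz (u : R -> R) (M B : R) : continuous u ->
  (forall t : R, `|t| <= M -> exists2 l : R, is_derive t 1 u l & `|l| <= B) ->
  forall a b : R, `|a| <= M -> `|b| <= M -> `|u a - u b| <= B * `|a - b|.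
Proof.
move=> cu H a b; wlog ab : a b / a < b.
  move=> W aM bM; have [/W|/W|->] := ltgtP a b; first exact.
    by rewrite distrC [`|a - b|]distrC; apply.
  by rewrite !subrr normr0 mulr0.
move=> aM bM; rewrite distrC [`|a - b|]distrC.
have cM c : a < c < b -> `|c| <= M.
  by move: aM bM; rewrite !ler_norml; lra.
have [t /cM/H[l dl _]|c cab ->] := mean_value (df := fun t => 'D_1 u t) ab cu.
  exact/derivableP/ex_derive.
have [l dl lB] := H c (cM c cab).
by rewrite normrM ler_wpM2r// (@derive_val _ _ _ _ _ _ _ dl).
Qed.

Lemma C1_lipschitz (u : R -> R) : Ck 1 u -> forall M : R, exists2 L : R, 0 <= L &
  forall a b : R, `|a| <= M -> `|b| <= M -> `|u a - u b| <= L * `|a - b|.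
Proof.
move=> [du cD] M.
have cu : continuous u by move=> t; exact/differentiable_continuous.
have [B HB] := continuous_bounded (- M) M (cD 1).
exists `|B| => //; apply: derive_bound_lipschitz => // t tM.
exists ('D_1 u t); first exact/derivableP/diff_derivable.
by apply: le_trans (ler_norm B); apply: HB; rewrite -ler_norml.
Qed.

(** The partial derivatives are bounded on the compact box, and the arguments are moved one at a
    time. *)
Lemma C1_lipschitz2 (g : R -> R -> R) : Ck 1 (fun p : R * R => g p.1 p.2) ->
  box_lipschitz g.
Proof.
set G := fun p : R * R => g p.1 p.2.
move=> [dG cD] M.
have cG : continuous G by move=> t; exact/differentiable_continuous.
have bnd (v : R * R) : exists2 B : R, 0 <= B & forall a b : R, `|a| <= M -> `|b| <= M ->
    `|'D_v G (a, b)| <= B.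
  have cK : compact (`[- M, M] `*` `[- M, M] : set (R * R)).
    by apply: compact_setX; exact: segment_compact.
  have cn : continuous (fun p => `|'D_v G p|).
    move=> p; exact: (@continuous_comp _ _ _ (fun p => 'D_v G p) (fun x : R => `|x|)
      p (cD v p) (@norm_continuous _ _ _)).
  have [M0|M0] := leP 0 M; last first.
    by exists 0 => // a b aM; have := normr_ge0 a; lra.
  have K0 : (`[- M, M] `*` `[- M, M] : set (R * R)) !=set0.
    by exists (0, 0); split => /=; rewrite in_itv /=; lra.
  have [p _ Hp] := compact_EVT_max K0 cK (continuous_subspaceT cn).
  exists `|'D_v G p| => // a b aM bM; apply: (Hp (a, b)); apply/mem_set.
  by split; rewrite /= in_itv /= -ler_norml.
have [B1 B10 HB1] := bnd (1, 0); have [B2 B20 HB2] := bnd (0, 1).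
have d1 (a b : R) : is_derive a 1 (fun t => g t b) ('D_(1, 0) G (a, b)).
  have /is_derive_cvgP : is_derive (a, b) (1, 0) G ('D_(1, 0) G (a, b)).
    exact/derivableP/diff_derivable.
  rewrite is_derive_cvgP; apply: cvg_trans; apply: near_eq_cvg; near=> h.
  by rewrite /G /= /GRing.scale /= mulr0 add0r.
have d2 (a b : R) : is_derive b 1 (fun t => g a t) ('D_(0, 1) G (a, b)).
  have /is_derive_cvgP : is_derive (a, b) (0, 1) G ('D_(0, 1) G (a, b)).
    exact/derivableP/diff_derivable.
  rewrite is_derive_cvgP; apply: cvg_trans; apply: near_eq_cvg; near=> h.
  by rewrite /G /= /GRing.scale /= mulr0 add0r.
have c1 (b : R) : continuous (fun t => g t b).
  by move=> t; apply/differentiable_continuous/derivable1_diffP; have [] := d1 t b.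
have c2 (a : R) : continuous (fun t => g a t).
  by move=> t; apply/differentiable_continuous/derivable1_diffP; have [] := d2 a t.
exists (B1 + B2); first exact: addr_ge0.
move=> p q p' q' pM qM p'M q'M.
have h1 : `|g p q - g p' q| <= B1 * `|p - p'|.
  apply: (derive_bound_lipschitz (c1 q) _ pM p'M) => t tM.
  by exists ('D_(1, 0) G (t, q)); [exact: d1|exact: HB1].
have h2 : `|g p' q - g p' q'| <= B2 * `|q - q'|.
  apply: (derive_bound_lipschitz (c2 p') _ qM q'M) => t tM.
  by exists ('D_(0, 1) G (p', t)); [exact: d2|exact: HB2].
have := ler_distD (g p' q) (g p q) (g p' q').
have := mulr_ge0 B10 (normr_ge0 (q - q')); have := mulr_ge0 B20 (normr_ge0 (p - p')).
by rewrite mulrDl !mulrDr; move: h1 h2; clear; lra.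
Unshelve. all: by end_near. Qed.

Lemma C1_col n (h : R -> 'cV[R]_n) : Ck 1 h -> forall i, Ck 1 (fun t => h t i 0).
Proof.
move=> [dh cD] i.
have dhi (t v : R) : is_derive t v (fun t => h t i 0) ('D_v h t i 0).
  have dv : derivable h t v by exact: diff_derivable.
  apply: DeriveDef; first exact: (derivable_mxP h t v).1.
  by rewrite derive_mx// mxE.
split=> [t|v t].
  by apply/derivable1_diffP; have [] := dhi t 1.
have -> : (fun x => 'D_v (fun t => h t i 0) x) = fun x => 'D_v h x i 0.
  by apply/funext => x; rewrite (@derive_val _ _ _ _ _ _ _ (dhi x v)).
exact: (continuous_colP _ _).1 (cD v t) i.
Qed.

End FrequencyTerm.

Section Extremal.
Context {R : realType}.

Lemma continuous_trmx n : continuous (fun v : 'rV[R]_n => v^T).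
Proof.
move=> v; apply/continuous_colP => i.
apply: (@continuous_for_ext _ _ (fun v : 'rV[R]_n => v 0 i)) => [w|].
  by rewrite mxE.
exact: coord_continuous.
Qed.

Variables (s : params R) (P : 'M[R]_4) (Vb : R).
Hypothesis Vb0 : 0 < Vb.
Hypothesis Ppos : pos_def P.
Hypothesis dom : comparison_defined s P Vb.
Hypothesis smg : Ck 1 (fun p : R * R => g_ s p.1 p.2).
Hypothesis smh : Ck 1 (h_ s).

Lemma VCC0 : VCC P 0 = 0.
Proof. by rewrite /VCC /quad trmx0 !mul0mx mxE. Qed.

Lemma ellipsoid_bound V : 0 <= V ->
  exists2 M : R, 0 <= M & forall x i, VCC P x <= V -> `|x i 0| <= M.
Proof.
move=> V0; have [c c0 Hc] := pos_def_bound Ppos.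
(* Avoids a square root: z^2 <= K implies z <= K + 1. *)
exists (V / c + 1) => [|x i xV]; first by rewrite addr_ge0// divr_ge0// ltW.
have : `|x i 0| ^+ 2 <= V / c.
  by rewrite ler_pdivlMr// mulrC real_normK ?num_real// (le_trans (Hc _ _)).
rewrite expr2; have := sqr_ge0 (`|x i 0| - 1); rewrite expr2; nra.
Qed.

Lemma ellipsoid_compact V : 0 <= V -> compact [set v : 'rV[R]_4 | VCC P v^T <= V].
Proof.
move=> V0; apply: bounded_closed_compact.
  have [M M0 HM] := ellipsoid_bound V0; exists M; split; first exact: num_real.
  move=> z Mz v /= vV.
  rewrite /Num.Def.normr/= mx_normrE (bigmax_le _ (le_trans M0 (ltW Mz)))//=.
  move=> -[i j] _ /=; rewrite ord1; apply: le_trans (ltW Mz).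
  by have := HM _ j vV; rewrite mxE.
rewrite (_ : [set v | _] = (fun v => VCC P v^T) @^-1` [set z | z <= V])//.
apply: closed_comp; last exact: closed_le.
by move=> v _; apply: continuous_quad; exact: continuous_trmx.
Qed.

Lemma f_dom0 : f_dom s 0.
Proof. by apply: dom; rewrite VCC0 ltW. Qed.

Lemma cdot0 n (u : 'cV[R]_n) : cdot u 0 = 0.
Proof. by rewrite /cdot mulmx0 mxE. Qed.

Lemma denominator_bound : exists2 d : R, 0 < d &
  forall x, VCC P x <= Vb -> d <= `|mu s - cdot (nu s) x|.
Proof.
have E0 : [set v : 'rV[R]_4 | VCC P v^T <= Vb] !=set0.
  by exists 0; rewrite /= trmx0 VCC0 ltW.
pose D (v : 'rV[R]_4) := `|mu s - cdot (nu s) v^T|.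
have cD : continuous D.
  move=> v; apply: (@continuous_comp _ _ _ (fun v : 'rV[R]_4 =>
    mu s - cdot (nu s) v^T) (fun x : R => `|x|)); last exact: norm_continuous.
  apply: continuousB; first exact: cst_continuous.
  exact: (@continuous_cdot _ _ _ (fun=> nu s) trmx v (@cst_continuous _ _ _ _)
    (@continuous_trmx _ v)).
have [v /set_mem vV Hv] := compact_EVT_min E0 (ellipsoid_compact (ltW Vb0))
  (continuous_subspaceT cD).
exists (D v).
  by rewrite normr_gt0 subr_eq0 eq_sym; exact: dom.
by move=> x xV; have := Hv x^T; rewrite /D trmxK; apply; apply/mem_set; rewrite /= trmxK.
Qed.

(** The denominator depends on x alone and is bounded away from 0 on the ellipsoid, so only
    numerators are compared. Uniformity in x is what passes to the extrema over x. *)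
Lemma f_lipschitz (M : R) : exists2 L : R, 0 <= L &
  forall x, VCC P x <= Vb -> forall p q p' q', `|p| <= M -> `|q| <= M ->
    `|p'| <= M -> `|q'| <= M ->
    `|f_ s p q x - f_ s p' q' x| <= L * (`|p - p'| + `|q - q'|).
Proof.
have [d d0 Hd] := denominator_bound.
have [X X0 HX] := ellipsoid_bound (ltW Vb0).
have [Lg Lg0 HLg] := C1_lipschitz2 smg M.
have /choice[Lh HLh] : forall i : 'I_4, exists L : R, 0 <= L /\
    forall a b : R, `|a| <= M -> `|b| <= M ->
      `|h_ s a i 0 - h_ s b i 0| <= L * `|a - b|.
  by move=> i; have [L L0 HL] := C1_lipschitz (C1_col smh i) M; exists L.
pose H := \sum_i Lh i * X.
have H0 : 0 <= H by apply: sumr_ge0 => i _; rewrite mulr_ge0//; case: (HLh i).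
exists ((Lg + H) / d); first by rewrite divr_ge0 ?addr_ge0// ltW.
move=> x xV p q p' q' pM qM p'M q'M.
rewrite /f_ -mulrBl normrM normfV ler_pdivrMr; last exact: lt_le_trans (Hd x xV).
have num : `|g_ s p q - cdot (h_ s q) x - (g_ s p' q' - cdot (h_ s q') x)|
    <= (Lg + H) * (`|p - p'| + `|q - q'|).
  have -> : g_ s p q - cdot (h_ s q) x - (g_ s p' q' - cdot (h_ s q') x) =
      (g_ s p q - g_ s p' q') - (cdot (h_ s q) x - cdot (h_ s q') x) by ring.
  apply: le_trans (ler_normB _ _) _; rewrite mulrDl lerD//; first exact: HLg.
  rewrite !cdotE -sumrB /H mulr_suml; apply: le_trans (ler_norm_sum _ _ _) _.
  apply: ler_sum => i _; rewrite -mulrBl normrM.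
  have [L0 HL] := HLh i.
  apply: (@le_trans _ _ (Lh i * `|q - q'| * X)).
    by apply: ler_pM => //; [exact: HL|exact: HX].
  by rewrite mulrAC ler_wpM2l ?mulr_ge0// lerDr.
apply: le_trans num _.
have -> : forall S D : R, (Lg + H) / d * S * D = (Lg + H) * S * (D / d).
  by move=> S D; ring.
rewrite ler_peMr//; first by rewrite mulr_ge0 ?addr_ge0.
by rewrite ler_pdivlMr// mul1r; exact: Hd.
Qed.

Lemma continuous_f (T : topologicalType) (u v : T -> R) (x : T -> 'cV[R]_4) (t : T) :
  {for t, continuous u} -> {for t, continuous v} -> {for t, continuous x} ->
  f_dom s (x t) -> {for t, continuous (fun t => f_ s (u t) (v t) (x t))}.
Proof.
move=> cu cv cx xd; rewrite /f_.
have ch : continuous (h_ s) by move=> z; apply/differentiable_continuous/smh.1.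
have cG : continuous (fun p : R * R => g_ s p.1 p.2).
  by move=> z; apply/differentiable_continuous/smg.1.
apply: continuousM.
  apply: continuousB.
    exact: (@continuous_comp _ _ _ (fun t => (u t, v t)) _ t (cvg_pair cu cv) (cG _)).
  apply: continuous_cdot cx.
  exact: (@continuous_comp _ _ _ v (h_ s) t cv (ch _)).
apply: continuousV; first by rewrite subr_eq0 eq_sym.
apply: continuousB; first exact: cst_continuous.
exact: (@continuous_cdot _ _ _ (fun=> nu s) x t (@cst_continuous _ _ _ _) cx).
Qed.

Definition fvalues V p q : set R := [set f_ s p q x | x in [set x | VCC P x <= V]].

Lemma minimumE (S : set R) m : S m -> lbound S m -> minimum S = m.
Proof.
move=> Sm lm; have /(@xgetPex _ 0)[Sx lx] : (S `&` lbound S) !=set0 by exists m.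
by apply: le_anti; rewrite lx//= lm.
Qed.

Lemma maximumE (S : set R) m : S m -> ubound S m -> maximum S = m.
Proof.
move=> Sm um; have /(@xgetPex _ 0)[Sx ux] : (S `&` ubound S) !=set0 by exists m.
by apply: le_anti; rewrite um//= ux.
Qed.

(** The ellipsoid is compact and f is continuous on it, so [minimum] and [maximum] are attained and
    are not the default value 0. *)
Lemma f_extremal V p q : 0 <= V <= Vb ->
  (exists2 x, VCC P x <= V & f_ s p q x = minimum (fvalues V p q) /\
     forall x', VCC P x' <= V -> minimum (fvalues V p q) <= f_ s p q x') /\
  (exists2 x, VCC P x <= V & f_ s p q x = maximum (fvalues V p q) /\
     forall x', VCC P x' <= V -> f_ s p q x' <= maximum (fvalues V p q)).
Proof.
move=> /andP[V0 VVb].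
have E0 : [set v : 'rV[R]_4 | VCC P v^T <= V] !=set0.
  by exists 0; rewrite /= trmx0 VCC0.
have cf : {within [set v : 'rV[R]_4 | VCC P v^T <= V],
    continuous (fun v : 'rV[R]_4 => f_ s p q v^T)}.
  apply: continuous_in_subspaceT => v /set_mem vV.
  apply: (@continuous_f _ (fun=> p) (fun=> q) trmx); [exact: cst_continuous|exact: cst_continuous| |].
    exact: continuous_trmx.
  exact: dom (le_trans vV VVb).
have memV x : VCC P x <= V -> x^T \in [set v : 'rV[R]_4 | VCC P v^T <= V].
  by move=> xV; apply/mem_set; rewrite /= trmxK.
split.
  have [v /set_mem vV Hv] := compact_EVT_min E0 (ellipsoid_compact V0) cf.
  have Hx x : VCC P x <= V -> f_ s p q v^T <= f_ s p q x.
    by move=> /memV/Hv; rewrite trmxK.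
  rewrite (@minimumE _ (f_ s p q v^T)); first by exists v^T.
    by exists v^T.
  by move=> _ [x xV <-]; exact: Hx.
have [v /set_mem vV Hv] := compact_EVT_max E0 (ellipsoid_compact V0) cf.
have Hx x : VCC P x <= V -> f_ s p q x <= f_ s p q v^T.
  by move=> /memV/Hv; rewrite trmxK.
rewrite (@maximumE _ (f_ s p q v^T)); first by exists v^T.
  by exists v^T.
by move=> _ [x xV <-]; exact: Hx.
Qed.

(** At a minimiser x for the second point, the difference of the minima is at most a difference of
    two values of f at the same x. *)
Lemma fmin_lipschitz V : 0 <= V <= Vb ->
  box_lipschitz (fun p q => minimum (fvalues V p q)).
Proof.
move=> VI M; have [L L0 HL] := f_lipschitz M; exists L => //.
have half p q p' q' : `|p| <= M -> `|q| <= M -> `|p'| <= M -> `|q'| <= M ->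
    minimum (fvalues V p q) - minimum (fvalues V p' q')
    <= L * (`|p - p'| + `|q - q'|).
  move=> pM qM p'M q'M; have [[x xV [<- _]] _] := f_extremal p' q' VI.
  have [[_ _ [_ /(_ _ xV) hx]] _] := f_extremal p q VI.
  have xVb : VCC P x <= Vb by apply: le_trans xV _; case/andP: VI.
  have := le_trans (ler_norm _) (HL x xVb _ _ _ _ pM qM p'M q'M); lra.
move=> p q p' q' pM qM p'M q'M; rewrite ler_norml half// andbT.
by have := half _ _ _ _ p'M q'M pM qM; rewrite [`|p' - p|]distrC [`|q' - q|]distrC; lra.
Qed.

Lemma fmax_lipschitz V : 0 <= V <= Vb ->
  box_lipschitz (fun p q => maximum (fvalues V p q)).
Proof.
move=> VI M; have [L L0 HL] := f_lipschitz M; exists L => //.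
have half p q p' q' : `|p| <= M -> `|q| <= M -> `|p'| <= M -> `|q'| <= M ->
    maximum (fvalues V p q) - maximum (fvalues V p' q')
    <= L * (`|p - p'| + `|q - q'|).
  move=> pM qM p'M q'M; have [_ [x xV [<- _]]] := f_extremal p q VI.
  have [_ [_ _ [_ /(_ _ xV) hx]]] := f_extremal p' q' VI.
  have xVb : VCC P x <= Vb by apply: le_trans xV _; case/andP: VI.
  have := le_trans (ler_norm _) (HL x xVb _ _ _ _ pM qM p'M q'M); lra.
move=> p q p' q' pM qM p'M q'M; rewrite ler_norml half// andbT.
by have := half _ _ _ _ p'M q'M pM qM; rewrite [`|p' - p|]distrC [`|q' - q|]distrC; lra.
Qed.

(** The gradient is formed with ['D_v], which is informative only where the limit exists. Along a
    line through 0, f is a quotient of affine functions of t, and this settles existence. *)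
Lemma is_derive_f_line p q (v : 'cV[R]_4) :
  is_derive (0 : R) 1 (fun t : R => f_ s p q (t *: v)) ('D_v (f_ s p q) 0).
Proof.
have cdotZ (u : 'cV[R]_4) (t : R) : cdot u (t *: v) = t * cdot u v.
  rewrite !cdotE mulr_sumr; apply: eq_bigr => i _; rewrite !mxE; ring.
have dt : is_derive (0 : R) 1 (fun t : R => t) (1 : R) by exact: is_derive_id.
have daff (c d : R) : is_derive (0 : R) 1 (fun t : R => c - t * d) (- d).
  have := is_derive_sub (is_derive_const c 0)
    (is_derive_mul dt (is_derive_const d 0)).
  by rewrite mul1r mulr0 addr0 sub0r.
have dn := daff (g_ s p q) (cdot (h_ s q) v).
have dd := daff (mu s) (cdot (nu s) v).
have dd0 : mu s - 0 * cdot (nu s) v != 0.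
  by rewrite mul0r subr0 eq_sym; have := f_dom0; rewrite /f_dom cdot0.
have dl := is_derive_mul dn 
    (@is_deriveV _ (fun t : R => mu s - t * cdot (nu s) v) 0 _ 1 dd0 dd).
have fE : (fun t : R => f_ s p q (t *: v)) = (fun t : R =>
    (g_ s p q - t * cdot (h_ s q) v) * (mu s - t * cdot (nu s) v)^-1).
  by apply/funext => t; rewrite /f_ !cdotZ.
rewrite -fE in dl.
suff : is_derive 0 v (f_ s p q) ('D_1 (fun t : R => f_ s p q (t *: v)) 0).
  move=> H; rewrite (@derive_val _ _ _ _ _ _ _ H).
  exact/derivableP/ex_derive.
rewrite (@derive_val _ _ _ _ _ _ _ dl).
move: dl; rewrite !is_derive_cvgP; apply: cvg_trans; apply: near_eq_cvg; near=> h.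
by rewrite /= !addr0 scale0r /GRing.scale /= mulr1.
Unshelve. all: by end_near. Qed.

Lemma f_strict V p q : 0 < V <= Vb -> gradient (f_ s p q) 0 != 0 ->
  minimum (fvalues V p q) < f_ s p q 0 < maximum (fvalues V p q).
Proof.
move=> /andP[V0 VVb] gr; have VI : 0 <= V <= Vb by rewrite ltW.
have [[_ _ [_ Hm]] [_ _ [_ HM]]] := f_extremal p q VI.
have zV : VCC P 0 <= V by rewrite VCC0 ltW.
(* An extremum at the interior point 0 would annihilate the gradient. *)
have flat (c : R) : c != 0 ->
    (forall x, VCC P x <= V -> c * f_ s p q 0 <= c * f_ s p q x) -> False.
  move=> c0 H; move/eqP: gr; apply; apply/colP => i; rewrite !mxE.
  set v : 'cV[R]_4 := delta_mx i 0.
  pose phi (t : R) := c * f_ s p q (t *: v).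
  have dphi : is_derive (0 : R) 1 phi (c * 'D_v (f_ s p q) 0).
    have := is_derive_mul (is_derive_const c 0) (is_derive_f_line p q v).
    by rewrite mul0r add0r.
  have dphiN : is_derive (0 : R) 1 (fun t => phi (-1 * t + 0))
      (-1 * (c * 'D_v (f_ s p q) 0)).
    by apply: is_derive_affine; rewrite mulr0 addr0.
  (* For |t| < 1 one has t^2 <= |t|, so t v stays in the ellipsoid as soon as |t| (|VCC P v| + 1) <
     V. *)
  pose r := Num.min 1 (V / (`|VCC P v| + 1)).
  have r0 : 0 < r by rewrite lt_min ltr01 divr_gt0// ltr_wpDl.
  have phi_ge t : `|t| < r -> phi 0 <= phi t.
    rewrite lt_min => /andP[t1 tV]; rewrite /phi scale0r; apply: H.
    rewrite /VCC quadZ -/(VCC P v) -real_normK ?num_real//.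
    rewrite ltr_pdivlMr in tV; last by rewrite ltr_wpDl.
    have := ler_norm (VCC P v); have := normr_ge0 (VCC P v); have := normr_ge0 t.
    by rewrite expr2; move: (VCC P v) `|t| t1 tV => z u; nra.
  have h1 : 0 <= c * 'D_v (f_ s p q) 0.
    apply: (derive_right_ge dphi r0) => t; rewrite add0r => tr.
    by apply: phi_ge; rewrite gtr0_norm; case/andP: tr.
  have h2 : 0 <= -1 * (c * 'D_v (f_ s p q) 0).
    apply: (derive_right_ge dphiN r0) => t; rewrite add0r mulr0 !addr0 mulN1r => tr.
    by apply: phi_ge; rewrite normrN gtr0_norm; case/andP: tr.
  by apply/eqP; rewrite -(mulrI_eq0 _ (mulfI c0)); apply/eqP; lra.
rewrite !lt_neqAle Hm// HM// !andbT; apply/andP; split; apply/eqP => E.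
  apply: (@flat 1) => [|x xV]; first exact: oner_neq0.
  by rewrite !mul1r -E; exact: Hm.
apply: (@flat (-1)) => [|x xV]; first by rewrite oppr_eq0 oner_neq0.
by rewrite !mulN1r lerN2 E; exact: HM.
Qed.

End Extremal.

(** * The comparison cycles of the PLL *)

Section ComparisonCycle.
Context {R : realType}.

Lemma shear_inj (k : R) (p q : R * R) : shear k p = shear k q -> p.2 = q.2 -> p = q.
Proof.
case: p q => [p1 p2] [q1 q2]; rewrite /shear /= => + E.
by rewrite E => /addIr ->.
Qed.

Lemma shear_lipschitz (F : R -> R -> R) (c k : R) : box_lipschitz F ->
  box_lipschitz (fun y w => c * F (y + k * w) w).
Proof.
move=> lF M; have [L L0 HL] := lF (M * (1 + `|k|)).
exists (`|c| * (L * (1 + `|k|))); first by rewrite !mulr_ge0// addr_ge0.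
move=> p q p' q' pM qM p'M q'M.
have k0 := normr_ge0 k; have M0 : 0 <= M by apply: le_trans pM.
have bnd (a b : R) : `|a| <= M -> `|b| <= M -> `|a + k * b| <= M * (1 + `|k|).
  move=> aM bM; apply: le_trans (ler_normD _ _) _; rewrite normrM mulrDr mulr1.
  by rewrite lerD// mulrC ler_wpM2r.
have bnd' (b : R) : `|b| <= M -> `|b| <= M * (1 + `|k|).
  by move=> bM; apply: le_trans bM _; rewrite ler_peMr// lerDl.
have := HL _ _ _ _ (bnd _ _ pM qM) (bnd' _ qM) (bnd _ _ p'M q'M) (bnd' _ q'M).
rewrite -mulrBr normrM -!mulrA => h; apply: ler_wpM2l => //.
apply: le_trans h _; apply: ler_wpM2l => //.
have -> : p + k * q - (p' + k * q') = (p - p') + k * (q - q') by ring.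
have := ler_normD (p - p') (k * (q - q')); rewrite normrM.
have := normr_ge0 (p - p'); have := normr_ge0 (q - q').
move: `|k| `|p - p'| `|q - q'| k0; clear => u d e u0 d0 e0 h; nra.
Qed.

Lemma finite_avoid (E : set R) (t0 : R) : finite_set E ->
  exists2 e : R, 0 < e & forall t, 0 < `|t - t0| < e -> ~ E t.
Proof.
move=> finE; have cE : closed (E `\ t0).
  apply: accessible_finite_set_closed.1; last exact: finite_setD.
  exact: hausdorff_accessible (@Rhausdorff R).
have nE : nbhs t0 (~` (E `\ t0)).
  by apply: open_nbhs_nbhs; split; [exact: closed_openC|move=> [_ /(_ erefl)]].
have /nbhs_ballP[e /= e0 He] := nE.
exists e => // t /andP[t0' te] Et; apply: (He t); first by rewrite /ball /= distrC.
by split=> // tE; move: t0'; rewrite tE subrr normr0 ltxx.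
Qed.

(** Translating s into [0, T) by a multiple of T puts t into (- T, 2 T); at most one further period
    brings it back. *)
Lemma periodic_inj (X : Type) (f : R -> X) (T : R) : 0 < T ->
  (forall t, f (t + T) = f t) -> {in `[0, T[ &, injective f} ->
  forall s t, 0 < `|s - t| < T -> f s <> f t.
Proof.
move=> T0 pf inj s t st E.
have [k [sk fs]] := periodic_reduce 0 s T0 pf; rewrite add0r in sk.
have ft := periodic_int pf k t.
have inI r : 0 <= r < T -> r \in `[0, T[ by rewrite in_itv.
case/andP: st => st0; rewrite ltr_norml => /andP[st1 st2].
have nst : s <> t by move=> H; move: st0; rewrite H subrr normr0 ltxx.
move: sk fs ft; move: (k%:~R * T) => m sk fs ft.
have [tm0|tm0] := ltP (t + m) 0.
  have := inj (s + m) (t + m + T) (inI _ sk) (inI (t + m + T) ltac:(lra)).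
  by rewrite fs pf ft => /(_ E); lra.
have [tmT|tmT] := ltP (t + m) T.
  have := inj (s + m) (t + m) (inI _ sk) (inI (t + m) ltac:(lra)).
  by rewrite fs ft => /(_ E); lra.
have := inj (s + m) (t + m - T) (inI _ sk) (inI (t + m - T) ltac:(lra)).
by rewrite fs -(pf (t + m - T)) subrK ft => /(_ E); lra.
Qed.

Section Cycle.
Variables (s : params R) (P : 'M[R]_4) (Vb : R).
Hypothesis Vb0 : 0 < Vb.
Hypothesis Ppos : pos_def P.
Hypothesis dom : comparison_defined s P Vb.
Hypothesis s_ok : admissible s.

Definition kappa := kp s / ki s.

Definition fm V y w := ki s * minimum (fvalues s P V (y + kappa * w) w).
Definition fM V y w := ki s * maximum (fvalues s P V (y + kappa * w) w).

Lemma ki_gt0 : 0 < ki s. Proof. by case: s_ok => -[]. Qed.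

Lemma smooth_g : Ck 1 (fun p : R * R => g_ s p.1 p.2).
Proof. by case: s_ok => _ [[/(_ 1%N)]]. Qed.

Lemma smooth_h : Ck 1 (h_ s).
Proof. by case: s_ok => _ [[_ /(_ 1%N)]]. Qed.

Lemma fm_f_fM V y w : 0 < V <= Vb ->
  fm V y w < ki s * f_ s (y + kappa * w) w 0 < fM V y w.
Proof.
move=> VI; rewrite !ltr_pM2l ?ki_gt0//.
apply: (f_strict Vb0 Ppos dom smooth_g smooth_h VI).
by case: s_ok => _ [_ [_ gr _]]; apply: gr; exact: f_dom0 Vb0 dom.
Qed.

Lemma fm_lipschitz V : 0 <= V <= Vb -> box_lipschitz (fm V).
Proof.
move=> VI; apply: (shear_lipschitz (F := fun p q => minimum (fvalues s P V p q))).
exact: (fmin_lipschitz Vb0 Ppos dom smooth_g smooth_h).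
Qed.

Lemma fM_lipschitz V : 0 <= V <= Vb -> box_lipschitz (fM V).
Proof.
move=> VI; apply: (shear_lipschitz (F := fun p q => maximum (fvalues s P V p q))).
exact: (fmax_lipschitz Vb0 Ppos dom smooth_g smooth_h).
Qed.

(** The shear turns the theta-equation into y' = w, and exceptional instants that are finite in
    number on bounded intervals are isolated, as [comparison_cycle] demands. *)
Lemma limit_cycle_lens V (Cv : set (R * R)) : 0 < V <= Vb ->
  clockwise_periodic_orbit (comparison_field s P V) Cv ->
  exists a b U L, lens (fm V) (fM V) a b U L /\ Cv = lens_curve kappa a b U L.
Proof.
move=> VI [z [T [T0 [cz ode] per inj [rg _]]]].
have V0 : 0 <= V <= Vb by case/andP: VI => /ltW -> ->.
have {}cz : continuous z.
  exact: (continuous_subspace_setT z).2 cz.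
pose y t := shear kappa (z t); pose w t := (z t).2.
have cy : continuous y.
  by move=> t; exact: (continuous_comp (cz t) (@continuous_shear R kappa (z t))).
have cw : continuous w.
  by move=> t; apply: (@continuous_comp _ _ _ z snd); [exact: cz|exact: cvg_snd].
have zE s' t : y s' = y t -> w s' = w t -> z s' = z t.
  exact: shear_inj.
have cyc : comparison_cycle (fm V) (fM V) T y w.
  split=> //.
  - exact: fm_lipschitz.
  - exact: fM_lipschitz.
  - by move=> x v; have := fm_f_fM x v VI; move=> /andP[]; exact: lt_trans.
  - by move=> t; rewrite /y per.
  - by move=> t; rewrite /w per.
  - by move=> s' t st ys ws; exact: (periodic_inj T0 per inj st (zE _ _ ys ws)).
  - move=> t0; have [//|E finE HE] := ode (t0 - 1) (t0 + 1).
    have [e e0 He] := finite_avoid t0 finE.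
    exists (Num.min e 1); first by rewrite lt_min e0 ltr01.
    move=> t; rewrite lt_min => /and3P[tp te t1].
    have nE : ~ E t by apply: He; rewrite tp.
    have tI : t0 - 1 < t < t0 + 1 by move: t1; rewrite ltr_norml; lra.
    have [d1 d2] := (is_derive_pairP _ _ _).1 (HE t tI nE).
    rewrite /comparison_field /= in d1 d2; move: d1 d2; set F := f_star _ _ _ _ _.
    move=> d1 d2; split.
      have := is_derive_sub d1 (is_derive_mul (is_derive_const kappa t) d2).
      move=> dy; apply: (is_derive_eq dy); rewrite mul0r add0r /kappa /w.
      by field; rewrite gt_eqF// ki_gt0.
    exists (ki s * F); first by rewrite -mulNr.
    have yw : y t + kappa * w t = (z t).1 by rewrite /y /w /shear subrK.
    rewrite /fm /fM yw /F /f_star; split=> [w0|w0|w0].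
    + by rewrite (ltW w0).
    + by rewrite leNgt w0.
    (* [f_star] takes the minimum on the line omega = 0. *)
    + by left; rewrite -/(w t) w0 lexx.
have [a [b [U [L [lUL cE]]]]] := cycle_lens cyc.
exists a, b, U, L; split=> //; rewrite -rg; apply/seteqP; split=> [_ [t _ <-]|p].
  by rewrite /lens_curve /=; apply/cE; exists t.
move=> /= /cE[t [yt wt]]; exists t => //; exact: shear_inj yt wt.
Qed.

End Cycle.
End ComparisonCycle.

(** * Lock-in of the coupled system *)

Section Invariance.
Context {R : realType}.

Lemma lyapunov_decay n (A P : 'M[R]_n) (x : R -> 'cV[R]_n) (c t : R) :
  neg_def (A^T *m P + P *m A + c *: P) -> continuous x -> 0 <= t ->
  (forall r, 0 < r < t -> is_derive r 1 x (A *m x r)) ->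
  quad P (x t) <= quad P (x 0) * expR (- c * t).
Proof.
move=> nd cx t0 dx; rewrite -[X in expR (_ * X)](subr0 t).
apply: (@gronwall _ (fun t => quad P (x t))) => //.
  by move=> r; apply: continuous_quad; exact: cx.
move=> r /dx dr; exists (quad (A^T *m P + P *m A) (x r)); first exact: is_derive_quad.
have [->|x0] := eqVneq (x r) 0.
  by rewrite /quad trmx0 !mul0mx !mxE mulr0.
have := nd _ x0; rewrite /quad mulmxDr mulmxDl -scalemxAr -scalemxAl mxE.
by rewrite [X in _ + X]mxE; clear; lra.
Qed.

Lemma ellipsoid_invariant (s : params R) (P : 'M[R]_4) (x : R -> 'cV[R]_4)
    (V t : R) :
  lyapunov_matrix s P -> 0 <= V -> continuous x -> 0 <= t ->
  (forall r, 0 < r < t -> is_derive r 1 x (A_ s *m x r)) ->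
  VCC P (x 0) <= V -> VCC P (x t) <= V.
Proof.
move=> [_ _ [c c0 nd]] V0 cx t0 dx xV.
apply: le_trans (lyapunov_decay nd cx t0 dx) _.
apply: le_trans (ler_wpM2r (expR_ge0 _) xV) _; rewrite ler_piMr//.
by rewrite -[X in _ <= X]expR0 ler_expR mulNr oppr_le0 mulr_ge0 ?(ltW c0).
Qed.

Section Region.
Implicit Types (V t : R).
Variables (s : params R) (P : 'M[R]_4) (Vb : R) (C : R -> set (R * R)).
Hypothesis Vb0 : 0 < Vb.
Hypothesis s_ok : admissible s.
Hypothesis P_lyapunov : lyapunov_matrix s P.
Hypothesis C_cycles : limit_cycle_family s P Vb C.

Let Ppos : pos_def P. Proof. by case: P_lyapunov. Qed.

Let dom : comparison_defined s P Vb.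
Proof. by case: C_cycles => + _ _ _ _; apply; rewrite lexx ltW. Qed.

Let k := kappa s.

Lemma region_lens V : 0 < V <= Vb ->
  exists a b U L, [/\ lens (fm s P V) (fM s P V) a b U L,
    C V = lens_curve k a b U L & closed_region (C V) = lens_set k a b U L].
Proof.
move=> VI; case: C_cycles => _ [_ /(_ V VI)[orb _]] _ _ _.
have [a [b [U [L [lUL CE]]]]] := limit_cycle_lens Vb0 Ppos dom s_ok VI orb.
by exists a, b, U, L; split=> //; rewrite CE; exact: closed_region_lens lUL.
Qed.

Lemma region_compact V : 0 < V <= Vb -> compact (closed_region (C V)).
Proof.
by move=> /region_lens[a [b [U [L [lUL _ ->]]]]]; exact: lens_compact lUL.
Qed.

Lemma derive_shear (th om : R -> R) (F t : R) :
  is_derive t 1 th (- kp s * F + om t) -> is_derive t 1 om (- ki s * F) ->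
  is_derive t 1 (fun t => th t - k * om t) (om t).
Proof.
move=> dth dom'.
have dy := is_derive_sub dth (is_derive_mul (is_derive_const k t) dom').
apply: (is_derive_eq dy); rewrite mul0r add0r /k /kappa.
by field; rewrite gt_eqF// (ki_gt0 s_ok).
Qed.

(** The maps c1 and c2 are the identity for actual solutions and clamps for the truncated system
    from which a solution is built. Being nonexpansive and trivial on the region, they do not affect
    the Lipschitz comparison with a point of the lens. *)
Lemma region_invariant V (th om c1 c2 : R -> R) (x : R -> 'cV[R]_4) (t1 : R) :
  0 < V <= Vb -> continuous th -> continuous om -> continuous c1 ->
  continuous c2 -> (forall a b, `|c1 a - c1 b| <= `|a - b|) ->
  (forall a b, `|c2 a - c2 b| <= `|a - b|) ->
  (forall p, closed_region (C V) p -> c1 p.1 = p.1 /\ c2 p.2 = p.2) ->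
  0 <= t1 ->
  (forall t, 0 < t < t1 -> VCC P (x t) <= V) ->
  (forall t, 0 < t < t1 ->
     is_derive t 1 th (- kp s * f_ s (c1 (th t)) (c2 (om t)) (x t) + om t)) ->
  (forall t, 0 < t < t1 ->
     is_derive t 1 om (- ki s * f_ s (c1 (th t)) (c2 (om t)) (x t))) ->
  closed_region (C V) (th 0, om 0) -> closed_region (C V) (th t1, om t1).
Proof.
move=> VI cth com cc1 cc2 lc1 lc2 idc; rewrite le_eqVlt.
move=> /orP[/eqP <- //|t10] xV dth dom' q0.
have [a [b [U [L [lUL _ KE]]]]] := region_lens VI.
have [M [_ /(_ (M + 1))HM]] := compact_bounded (region_compact VI).
have {}HM p : closed_region (C V) p -> `|p.1| <= M + 1 /\ `|p.2| <= M + 1.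
  move=> pK; have := HM ltac:(by rewrite ltrDl) p pK.
  by rewrite /= prod_normE /= ge_max => /andP[].
have [M1 HM1] := continuous_bounded 0 t1 (fun t => continuous_comp (cth t) (cc1 (th t))).
have [M2 HM2] := continuous_bounded 0 t1 (fun t => continuous_comp (com t) (cc2 (om t))).
pose N := Num.max (M + 1) (Num.max M1 M2).
have [Lf Lf0 HL] := f_lipschitz Vb0 Ppos dom (smooth_g s_ok) (smooth_h s_ok) N.
have VI' : 0 <= V <= Vb by case/andP: VI => /ltW -> ->.
have ki0 := ki_gt0 s_ok.
pose Lam := ki s * (Lf * (1 + `|k|)).
have inK x' v : in_lens a b U L x' v -> closed_region (C V) (x' + k * v, v).
  by move=> xv; rewrite KE; apply/lens_setE; rewrite /shear /= addrK.
rewrite KE; apply/lens_setE; rewrite KE in q0; move/lens_setE: q0 => q0.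
apply: (@lens_invariant _ (fm s P V) (fM s P V) k a b U L (fun t => th t - k * om t)
  om (fun t => ki s * f_ s (c1 (th t)) (c2 (om t)) (x t)) t1 Lam) => //.
- exact: (fm_lipschitz Vb0 Ppos dom s_ok).
- exact: (fM_lipschitz Vb0 Ppos dom s_ok).
- by move=> y v; have /andP[] := fm_f_fM Vb0 Ppos dom s_ok y v VI; exact: lt_trans.
- move=> t; apply: cvgB; first exact: cth.
  by apply: cvgM; [exact: cvg_cst|exact: com].
- by rewrite !mulr_ge0 ?addr_ge0// ltW.
- by move=> t tI; apply: derive_shear (dth t tI) (dom' t tI).
- by move=> t tI; rewrite -mulNr; exact: dom'.
(* The comparison slope keeps the current x(t) and moves only (theta, omega) to the lens point; VCC
   (x t) <= V places it between the two extrema. *)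
move=> t y v tI yv; exists (ki s * f_ s (y + k * v) v (x t)).
  have [[_ _ [_ Hm]] [_ _ [_ HM']]] :=
    f_extremal Ppos dom (smooth_g s_ok) (smooth_h s_ok) (y + k * v) v VI'.
  by rewrite /fm /fM !ler_pM2l// Hm ?HM' ?xV.
have [p1 p2] := HM _ (inK _ _ yv); have [/= e1 e2] := idc _ (inK _ _ yv).
have xVb : VCC P (x t) <= Vb by apply: le_trans (xV t tI) _; case/andP: VI.
rewrite -mulrBr normrM gtr0_norm// /Lam -mulrA ler_wpM2l ?(ltW ki0)//.
have tI' : 0 <= t <= t1 by case/andP: tI => /ltW -> /ltW ->.
have := HL _ xVb (c1 (th t)) (c2 (om t)) (y + k * v) v.
have N1 (u w : R) : `|u| <= M + 1 -> `|u| <= N by move=> h; rewrite le_max h.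
rewrite (N1 _ v p1) (N1 _ v p2) /N !le_max (HM1 _ tI') (HM2 _ tI') !orbT.
move=> /(_ isT isT isT isT) h; apply: le_trans h _; rewrite -mulrA ler_wpM2l//.
have h1 := lc1 (th t) (y + k * v); have h2 := lc2 (om t) v.
rewrite e1 in h1; rewrite e2 in h2.
have h3 : `|th t - (y + k * v)| <= `|th t - k * om t - y| + `|k| * `|om t - v|.
  have -> : th t - (y + k * v) = (th t - k * om t - y) + k * (om t - v) by ring.
  by rewrite -normrM ler_normD.
move: h1 h2 h3; have := normr_ge0 (th t - k * om t - y); have := normr_ge0 k.
move: `|_ - (y + k * v)| `|c1 _ - _| `|c2 _ - _| `|om t - v| `|k| `|_ - y|.
move=> A1 A2 A3 A4 A5 A6; nra.
Qed.

End Region.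
End Invariance.

(** * Levels of cluster points and convergence *)

Section Convergence.
Context {R : realType}.

Lemma cluster_shear (Y W : R -> R) (k x v : R) : cluster_point Y W x v ->
  cluster_point (fun t => Y t + k * W t) W (x + k * v) v.
Proof.
move=> clp r t r0; pose d := r / (1 + `|k|).
have k0 : 0 < 1 + `|k| by rewrite ltr_pwDl.
have d0 : 0 < d by rewrite divr_gt0.
have dr : d <= r by rewrite ler_pdivrMr// ler_peMr ?(ltW r0)// lerDl.
have [s ts [Ys Ws]] := clp d t d0; exists s => //; split; last exact: lt_le_trans dr.
have -> : Y s + k * W s - (x + k * v) = (Y s - x) + k * (W s - v) by ring.
have -> : r = d + `|k| * d by rewrite -[X in X + _]mul1r -mulrDl mulrC divfK// gt_eqF.
apply: le_lt_trans (ler_normD _ _) _; rewrite normrM ltr_leD//.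
by rewrite ler_wpM2l// ltW.
Qed.

Lemma cluster_closed (th om : R -> R) (A : set (R * R)) (p : R * R) (T : R) :
  closed A -> cluster_point th om p.1 p.2 ->
  (forall t, T <= t -> A (th t, om t)) -> A p.
Proof.
move=> cA clp HA; rewrite closedE in cA; apply: cA => B.
apply: contrapT => nB; have /nbhs_ballP[r /= r0 Hr] : nbhs p (~` A) by [].
have [t Tt [h1 h2]] := clp r T r0.
apply: (Hr (th t, om t)); last exact: HA.
by split; rewrite /ball /= distrC.
Qed.

Lemma cluster_interior (th om : R -> R) (A : set (R * R)) (p : R * R) :
  cluster_point th om p.1 p.2 -> interior A p ->
  forall T, exists2 t, T <= t & A (th t, om t).
Proof.
move=> clp /nbhs_ballP[r /= r0 Hr] T; have [t Tt [h1 h2]] := clp r T r0.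
by exists t => //; apply: Hr; split; rewrite /ball /= distrC.
Qed.

Section Trajectory.
Implicit Types (t r T V : R).
Variables (s : params R) (P : 'M[R]_4) (Vb : R) (C : R -> set (R * R)).
Variable vpll : R * R -> R.
Hypothesis Vb0 : 0 < Vb.
Hypothesis s_ok : admissible s.
Hypothesis P_lyapunov : lyapunov_matrix s P.
Hypothesis C_cycles : limit_cycle_family s P Vb C.
Hypothesis vpllP : is_VPLL C Vb vpll.

Let Ppos : pos_def P. Proof. by case: P_lyapunov. Qed.

Let dom : comparison_defined s P Vb.
Proof. by case: C_cycles => + _ _ _ _; apply; rewrite lexx ltW. Qed.

Let k := kappa s.
Let region V := closed_region (C V).

Let VbI : 0 < Vb <= Vb. Proof. by rewrite Vb0 lexx. Qed.

(** As V^PLL is defined on the whole largest region, each of its points lies on some cycle, and the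
    nesting locates the point with respect to all other levels. *)
Lemma region_level p : region Vb p -> exists2 V', 0 <= V' <= Vb & C V' p /\
  forall V, 0 <= V <= Vb ->
    (V < V' -> ~ region V p) /\ (V' < V -> interior (region V) p).
Proof.
move=> pK; have [VI fp] := (vpllP pK (vpll p)).1 erefl.
case: C_cycles => _ _ _ fr nest.
exists (vpll p) => //; rewrite -(fr _ VI); split=> // V /andP[V0 VVb]; split=> HV.
  move=> pV; case: fp => _; apply.
  by have [_] := nest V (vpll p) V0 HV (proj2 (andP VI)); apply.
have [_] := nest (vpll p) V (proj1 (andP VI)) HV VVb; apply.
by left; rewrite -(fr _ VI).
Qed.

Variables (th om : R -> R) (x : R -> 'cV[R]_4).
Hypothesis cth : continuous th.
Hypothesis com : continuous om.
Hypothesis cx : continuous x.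
Hypothesis dth : forall t, 0 < t ->
  is_derive t 1 th (- kp s * f_ s (th t) (om t) (x t) + om t).
Hypothesis dom' : forall t, 0 < t ->
  is_derive t 1 om (- ki s * f_ s (th t) (om t) (x t)).
Hypothesis dx : forall t, 0 < t -> is_derive t 1 x (A_ s *m x t).
Hypothesis q0 : region Vb (th 0, om 0).
Hypothesis x0 : VCC P (x 0) <= Vb.

Lemma VCC_le t : 0 <= t -> VCC P (x t) <= Vb.
Proof.
move=> t0; apply: (ellipsoid_invariant P_lyapunov (ltW Vb0) cx t0 _ x0).
by move=> r /andP[r0 _]; exact: dx.
Qed.

Lemma VCC_vanish V : 0 < V -> exists2 T : R, 0 <= T & forall t, T <= t -> VCC P (x t) <= V.
Proof.
move=> V0; case: P_lyapunov => _ _ [c c0 nd].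
(* This waiting time comes from exp (c t) >= 1 + c t, in place of a logarithm of Vb / V. *)
have T0 : 0 <= Vb / V / c by rewrite !divr_ge0// ltW.
exists (Vb / V / c) => // t Tt; have t0 := le_trans T0 Tt.
apply: le_trans (lyapunov_decay nd cx t0 _) _ => [r /andP[r0 _]|]; first exact: dx.
apply: le_trans (ler_wpM2r (expR_ge0 _) x0) _.
rewrite mulNr expRN ler_pdivrMr ?expR_gt0// mulrC -ler_pdivrMr//.
apply: le_trans (expR_ge1Dx _); rewrite -[leLHS]add0r lerD//.
by rewrite [c * t]mulrC -ler_pdivrMr.
Qed.

(** The system is autonomous: the invariance from time 0 applies to the trajectory translated by T,
    at any level V that VCC has already reached. *)
Lemma region_from V T : 0 < V <= Vb -> 0 <= T -> region V (th T, om T) ->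
  (forall t, T <= t -> VCC P (x t) <= V) ->
  forall t, T <= t -> region V (th t, om t).
Proof.
move=> VI T0 qT xV t Tt; pose sh (X : Type) (f : R -> X) (r : R) := f (r + T).
have csh (f : R -> R) : continuous f -> continuous (sh R f).
  move=> cf r; have := continuous_affine (c := 1) (d := T) cf (x := r).
  by under eq_fun do rewrite mul1r.
have dsh (f : R -> R) r l : is_derive (r + T) 1 f l -> is_derive r 1 (sh R f) l.
  have := @is_derive_affine _ f 1 T r l; rewrite !mul1r => /[apply].
  by under eq_fun do rewrite mul1r.
have t0 : 0 <= t - T by rewrite subr_ge0.
suff : region V (sh R th (t - T), sh R om (t - T)) by rewrite /sh subrK.
apply: (@region_invariant _ s P Vb C Vb0 s_ok P_lyapunov C_cycles V
  (sh R th) (sh R om) id id (sh _ x) (t - T) VI (csh th cth) (csh om com)).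
- by move=> r; exact: cvg_id.
- by move=> r; exact: cvg_id.
- by [].
- by [].
- by [].
- exact: t0.
- by move=> r /andP[r0 _]; apply: xV; rewrite lerDr ltW.
- by move=> r /andP[r0 _]; apply: dsh; apply: dth; rewrite ltr_pwDl.
- by move=> r /andP[r0 _]; apply: dsh; apply: dom'; rewrite ltr_pwDl.
- by rewrite /sh add0r.
Qed.

Lemma region_stays t : 0 <= t -> region Vb (th t, om t).
Proof. by apply: region_from => //; exact: VCC_le. Qed.

Lemma x_vanish : x t @[t --> +oo] --> (0 : 'cV[R]_4).
Proof.
have [c c0 Hc] := pos_def_bound Ppos.
apply/cvgrPdist_le => e e0.
have V0 : 0 < c * e ^+ 2 by rewrite mulr_gt0// exprn_gt0.
have [T T0 HT] := VCC_vanish V0.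
exists T; split; first exact: num_real.
move=> t Tt; rewrite sub0r normrN /Num.Def.normr/= mx_normrE (bigmax_le _ (ltW e0))//=.
move=> -[i j] _ /=; rewrite ord1.
have := le_trans (Hc (x t) i) (HT t (ltW Tt)).
by rewrite ler_pM2l// -real_normK ?num_real// ler_pXn2r// nnegrE ltW.
Qed.

Let level := [set V | 0 < V <= Vb /\
  exists2 T : R, 0 <= T & forall t, T <= t -> region V (th t, om t)].

Let has_inf_level : has_inf level.
Proof.
split; last by exists 0 => V [/andP[/ltW]].
by exists Vb; split=> //; exists 0 => // t; exact: region_stays.
Qed.

(** If p had a level below the infimum, the region of an intermediate level would contain p in its
    interior, hence be entered after VCC has become small enough to keep the trajectory in it. If
    the level of p were larger, a closed region eventually containing the trajectory would miss
    p. *)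
Lemma cluster_level p : cluster_point th om p.1 p.2 -> C (inf level) p.
Proof.
move=> clp; have clo V : 0 < V <= Vb -> closed (region V).
  move=> /(region_lens Vb0 s_ok P_lyapunov C_cycles)[a [b [U [L [lUL _ KE]]]]].
  by rewrite /region KE; exact: lens_closed lUL.
have pVb : region Vb p.
  by apply: (cluster_closed (T := 0) (clo _ VbI) clp) => t; exact: region_stays.
have [V' V'I [CV' HV']] := region_level pVb.
suff -> : inf level = V' by [].
apply: le_anti; apply/andP; split.
  rewrite leNgt; apply/negP => lt.
  pose V := (V' + inf level) / 2.
  have infb : inf level <= Vb.
    by apply: ge_inf; [case: has_inf_level|split=> //; exists 0 => // t; exact: region_stays].
  have VI : 0 < V <= Vb by rewrite /V; lra.
  have VI' : 0 <= V <= Vb by rewrite /V; lra.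
  have [_ /(_ ltac:(rewrite /V; lra))intV] := HV' V VI'.
  have [T T0 HT] := VCC_vanish (proj1 (andP VI)).
  have [T1 TT1 rT1] := cluster_interior clp intV T.
  have : inf level <= V.
    apply: ge_inf; first by case: has_inf_level.
    split=> //; exists T1; first exact: le_trans TT1.
    apply: region_from => //; first exact: le_trans TT1.
    by move=> t T1t; apply: HT; exact: le_trans T1t.
  by rewrite /V; lra.
rewrite leNgt; apply/negP => lt.
have d0 : 0 < V' - inf level by rewrite subr_gt0.
have [V [VI [T T0 HT]]] := inf_adherent d0 has_inf_level.
rewrite addrC subrK => VV'.
have VI' : 0 <= V <= Vb by case/andP: VI => /ltW -> ->.
have [/(_ VV') + _] := HV' V VI'; apply.
exact: cluster_closed (clo _ VI) clp HT.
Qed.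

Lemma pll_bounded : exists N, forall t, 0 <= t -> `|th t| <= N /\ `|om t| <= N.
Proof.
have [M [_ /(_ (M + 1))HM]] :=
  compact_bounded (region_compact Vb0 s_ok P_lyapunov C_cycles VbI).
exists (M + 1) => t /region_stays qt; have := HM ltac:(by rewrite ltrDl) _ qt.
by rewrite /= prod_normE /= ge_max => /andP[].
Qed.

Lemma f_bounded : exists B, forall t, 0 <= t ->
  `|om t| <= B /\ `|ki s * f_ s (th t) (om t) (x t)| <= B.
Proof.
have [N HN] := pll_bounded.
have N0 : 0 <= N by have [/(le_trans (normr_ge0 _))] := HN 0 (lexx 0).
have [L L0 HL] := f_lipschitz Vb0 Ppos dom (smooth_g s_ok) (smooth_h s_ok) N.
have [[_ _ [_ Hm]] [_ _ [_ HM]]] := f_extremal Ppos dom (smooth_g s_ok)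
  (smooth_h s_ok) 0 0 (ltac:(by rewrite ltW// lexx) : 0 <= Vb <= Vb).
move: (minimum _) (maximum _) Hm HM => m M Hm HM.
pose B0 := L * (N + N) + `|m| + `|M|.
have ki0 := ki_gt0 s_ok.
exists (Num.max N (ki s * B0)) => t t0; have [thN omN] := HN t t0.
rewrite !le_max omN; split=> //; apply/orP; right.
rewrite normrM gtr0_norm// ler_wpM2l ?(ltW ki0)//.
have xV := VCC_le t0.
have h0 : `|0 : R| <= N by rewrite normr0.
have := HL _ xV _ _ _ _ thN omN h0 h0; rewrite !subr0.
have hL : L * (`|th t| + `|om t|) <= L * (N + N) by rewrite ler_wpM2l// lerD.
have := Hm _ xV; have := HM _ xV.
have := ler_norm M; have := ler_norm (- m); rewrite normrN.
have := normr_ge0 M; have := normr_ge0 m.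
by rewrite /B0 !ler_norml; lra.
Qed.

(** Two effects are separated: the Lipschitz bound near (p, q), uniform in x, and the continuity in
    x at the limit x = 0. *)
Lemma f_asymptotic p q e : 0 < e -> exists r T, [/\ 0 < r, 0 <= T & forall t, T < t ->
  `|th t - p| <= r -> `|om t - q| <= r ->
  `|f_ s (th t) (om t) (x t) - f_ s p q 0| < e].
Proof.
move=> e0; have [N0 HN0] := pll_bounded.
pose N := Num.max N0 (Num.max `|p| `|q|).
have [L L0 HL] := f_lipschitz Vb0 Ppos dom (smooth_g s_ok) (smooth_h s_ok) N.
have e20 : 0 < e / 2 by rewrite divr_gt0.
have cf : f_ s p q (x t) @[t --> +oo] --> f_ s p q 0.
  apply: (cvg_comp _ _ x_vanish).
  apply: (@continuous_f _ _ (smooth_g s_ok) (smooth_h s_ok) _ (fun=> p) (fun=> q) id).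
  - exact: cst_continuous.
  - exact: cst_continuous.
  - exact: cvg_id.
  - exact: f_dom0 Vb0 dom.
have /cvgrPdist_lt/(_ _ e20)[T [_ HT]] := cf.
exists (e / 2 / (2 * L + 1)), (Num.max 0 T).
have L1 : 0 < 2 * L + 1 by rewrite ltr_wpDl// mulr_ge0.
split; [by rewrite divr_gt0|by rewrite le_max lexx|].
move=> t; rewrite gt_max => /andP[t0 Tt] tp oq.
have [thN omN] := HN0 t (ltW t0).
have := HL _ (VCC_le (ltW t0)) (th t) (om t) p q.
rewrite /N !le_max thN omN !lexx !orbT => /(_ isT isT isT isT) h1.
have h2 := HT t Tt; rewrite distrC in h2.
have h3 : L * (`|th t - p| + `|om t - q|) <= e / 2.
  have h : `|th t - p| + `|om t - q| <= 2 * (e / 2 / (2 * L + 1)).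
    by rewrite mulr_natl mulr2n lerD.
  apply: le_trans (ler_wpM2l L0 h) _.
  have -> : L * (2 * (e / 2 / (2 * L + 1))) = e / 2 * (2 * L / (2 * L + 1)).
    by field; rewrite gt_eqF.
  by rewrite ler_piMr ?(ltW e20)// ler_pdivrMr// mul1r lerDl.
rewrite (splitr e); apply: le_lt_trans (ler_distD (f_ s p q (x t)) _ _) _.
by apply: ler_ltD h2; exact: le_trans h1 h3.
Qed.

Lemma cluster_exists : exists p, cluster_point th om p.1 p.2.
Proof.
have [t|p _ clp] := compact_cluster_point (Y := th) (W := om)
  (region_compact Vb0 s_ok P_lyapunov C_cycles VbI); last by exists p.
exists (Num.max t 0); first by rewrite le_max lexx.
by apply: region_stays; rewrite le_max lexx orbT.
Qed.

Lemma level_zero : inf level = 0.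
Proof.
have inf0 : 0 <= inf level.
  by apply: lb_le_inf; [case: has_inf_level|move=> V [/andP[/ltW]]].
have infb : inf level <= Vb.
  by apply: ge_inf; [case: has_inf_level|split=> //; exists 0 => // t; exact: region_stays].
apply/eqP; rewrite eq_le inf0 andbT leNgt; apply/negP => infpos.
have VI : 0 < inf level <= Vb by rewrite infpos.
have VI' : 0 <= inf level <= Vb by rewrite inf0.
have [a [b [U [L [lUL CE _]]]]] := region_lens Vb0 s_ok P_lyapunov C_cycles VI.
have [B HB] := f_bounded; have [p clp] := cluster_exists.
have ki0 := ki_gt0 s_ok.
have thE : (fun t => th t - k * om t + k * om t) = th.
  by apply/funext => t; rewrite subrK.
suff st : stalled (fm s P (inf level)) (fM s P (inf level))
    (fun y v => ki s * f_ s (y + k * v) v 0) a b U L (fun t => th t - k * om t) om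
    (fun t => ki s * f_ s (th t) (om t) (x t)) B.
  apply: (not_stalled (x := p.1 + - k * p.2) (v := p.2) st).
  have := cluster_shear (- k) clp.
  by under [X in cluster_point X]eq_fun do rewrite mulNr.
split=> //.
- exact: (fm_lipschitz Vb0 Ppos dom s_ok).
- exact: (fM_lipschitz Vb0 Ppos dom s_ok).
- by move=> y v; exact: (fm_f_fM Vb0 Ppos dom s_ok y v VI).
- move=> t; apply: cvgB; first exact: cth.
  by apply: cvgM; [exact: cvg_cst|exact: com].
- by move=> t t0; apply: (derive_shear s_ok (dth t0) (dom' t0)).
- by move=> t t0; rewrite -mulNr; exact: dom'.
- by move=> t /ltW; exact: HB.
- move=> y v e e0; have ek0 : 0 < e / ki s by rewrite divr_gt0.
  have [r [T [r0 T0 HT]]] := f_asymptotic (y + k * v) v ek0.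
  pose r' := r / (1 + `|k|).
  have k0 : 0 < 1 + `|k| by rewrite ltr_pwDl.
  have r'r : r' <= r by rewrite ler_pdivrMr// ler_peMr ?(ltW r0)// lerDl.
  exists r', T; split=> //; first by rewrite divr_gt0.
  move=> t Tt Yy ov; rewrite -mulrBr normrM gtr0_norm// mulrC -ltr_pdivlMr//.
  apply: HT => //; last exact: le_trans r'r.
  have -> : th t - (y + k * v) = (th t - k * om t - y) + k * (om t - v) by ring.
  have -> : r = r' + `|k| * r'.
    by rewrite -[X in X + _]mul1r -mulrDl mulrC divfK// gt_eqF.
  apply: le_trans (ler_normD _ _) _; rewrite normrM lerD//.
  by rewrite ler_wpM2l.
- move=> y v /(cluster_shear k); rewrite thE => clq.
  have := cluster_level (p := (y + k * v, v)) clq.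
  by rewrite CE /lens_curve /shear /= addrK.
Qed.

(** Otherwise the trajectory returns forever to the compact part |p| >= e of the region and has a
    cluster point there, whereas [C 0] is the origin alone. *)
Lemma pll_vanish e : 0 < e -> exists2 T : R, 0 <= T &
  forall t, T <= t -> `|(th t, om t)| < e.
Proof.
move=> e0; apply: contrapT => nT.
pose K := region Vb `&` [set p | e <= `|p|].
have cK : compact K.
  apply: compact_closedI.
    exact: (region_compact Vb0 s_ok P_lyapunov C_cycles VbI).
  rewrite (_ : [set p | _] = (fun p : R * R => `|p|) @^-1` [set z | e <= z])//.
  by apply: closed_comp; [move=> p _; exact: norm_continuous|exact: closed_ge].
have [t|p [_ pe] clp] := compact_cluster_point (Y := th) (W := om) cK.
  apply: contrapT => nt; apply: nT; exists (Num.max t 0).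
    by rewrite le_max lexx orbT.
  move=> r; rewrite ge_max => /andP[tr r0]; rewrite ltNge; apply/negP => er.
  by apply: nt; exists r => //; split=> //; exact: region_stays.
have := cluster_level clp; rewrite level_zero.
case: C_cycles => _ [-> _] _ _ _ /= p0.
by move: pe; rewrite /= p0 -[(0, 0)]/(0 : R * R) normr0 leNgt e0.
Qed.

End Trajectory.
End Convergence.

(** * Existence of global solutions and lock-in *)

Section LockIn.
Context {R : realType}.

(** Reparametrizing by a continuous map into A replaces continuity within A by continuity
    everywhere, the form in which trajectories are handled. *)
Lemma within_comp (T U V : topologicalType) (A : set U) (z : U -> V) (c : T -> U) :
  {within A, continuous z} -> continuous c -> (forall t, A (c t)) ->
  continuous (z \o c).
Proof.
move=> /subspace_continuousP cz cc cA t.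
apply: (cvg_comp c z _ (cz (c t) (cA t))) => B nB.
have H : nbhs t (c @^-1` [set u | A u -> B u]) := cc t _ nB.
suff : nbhs t (c @^-1` B) by [].
by apply: filterS H => r; apply; exact: cA.
Qed.

Lemma full_field_components (s : params R) (z : R -> R * R * 'cV[R]_4) (t : R) :
  is_derive t 1 z (full_field s (z t)) ->
  [/\ is_derive t 1 (fun t => (z t).1.1)
        (- kp s * f_ s (z t).1.1 (z t).1.2 (z t).2 + (z t).1.2),
      is_derive t 1 (fun t => (z t).1.2) (- ki s * f_ s (z t).1.1 (z t).1.2 (z t).2) &
      is_derive t 1 (fun t => (z t).2) (A_ s *m (z t).2)].
Proof.
move=> /is_derive_pairP[/is_derive_pairP[d1 d2] d3].
by split; [exact: d1|exact: d2|exact: d3].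
Qed.

Lemma linear_flow n (A : 'M[R]_n.+1) (v : 'cV[R]_n.+1) : exists x : R -> 'cV[R]_n.+1,
  [/\ continuous x, x 0 = v & forall t : R, 0 < t -> is_derive t 1 x (A *m x t)].
Proof.
pose F (t : R) (u : 'I_n.+1 -> R) i := \sum_j A i j * u j.
(* S dominates every row sum; S + 1 is used below to have a positive Lipschitz constant. *)
pose S := \sum_i \sum_j `|A i j|.
have S0 : 0 <= S by apply: sumr_ge0 => i _; apply: sumr_ge0.
have [|||||u [cu u0 du]] := @picard R _ F (S + 1)
    (\sum_i `|F 0 (fun j => v j 0) i|) (fun i => v i 0).
- by rewrite ltr_wpDl.
- by apply: sumr_ge0.
- move=> t u w d ud i; rewrite -sumrB.
  have d0 : 0 <= d by apply: le_trans (ud ord0).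
  apply: le_trans (ler_norm_sum _ _ _) _.
  apply: (@le_trans _ _ (S * d)); last by rewrite ler_wpM2r// lerDl.
  apply: (@le_trans _ _ ((\sum_j `|A i j|) * d)).
    rewrite mulr_suml; apply: ler_sum => j _.
    by rewrite -mulrBr normrM ler_wpM2l.
  rewrite ler_wpM2r// /S [X in _ <= X](bigD1 i)//= lerDl; apply: sumr_ge0 => j _.
  exact: sumr_ge0.
- move=> u cu i t; apply: continuous_bigsum => j.
  exact: continuousM (@cst_continuous _ _ _ _) (cu j t).
- move=> t i; rewrite [X in _ <= X](bigD1 i)//= lerDl.
  exact: sumr_ge0.
exists (fun t => \col_i u i t); split.
- move=> t; apply/continuous_colP => i.
  by apply: (@continuous_for_ext _ _ (u i)) => [r|]; [rewrite mxE|exact: cu].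
- by apply/colP => i; rewrite mxE.
move=> t t0; apply/is_derive_colP => i.
have -> : (fun t => (\col_i u i t) i 0) = u i by apply/funext => r; rewrite mxE.
apply: (is_derive_eq (du t i t0)); rewrite mxE; apply: eq_bigr => j _.
by rewrite mxE.
Qed.

Section Existence.
Implicit Types (t r : R).
Variables (s : params R) (P : 'M[R]_4) (Vb : R) (C : R -> set (R * R)).
Hypothesis Vb0 : 0 < Vb.
Hypothesis s_ok : admissible s.
Hypothesis P_lyapunov : lyapunov_matrix s P.
Hypothesis C_cycles : limit_cycle_family s P Vb C.

Let Ppos : pos_def P. Proof. by case: P_lyapunov. Qed.

Let dom : comparison_defined s P Vb.
Proof. by case: C_cycles => + _ _ _ _; apply; rewrite lexx ltW. Qed.

(** The linear x-equation is solved first. The field of (theta, omega) is then truncated to a box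
    containing the region, which makes it globally Lipschitz. As the region is invariant under the
    truncated field, the truncation never acts on the solution. *)
Lemma global_solution (q : R * R * 'cV[R]_4) :
  closed_region (C Vb) q.1 -> VCC P q.2 <= Vb ->
  exists2 z, solution s +oo%E z & z 0 = q.
Proof.
move=> qK qV; have VbI : 0 < Vb <= Vb by rewrite Vb0 lexx.
have [x [cx x0 dx]] := linear_flow (A_ s) q.2.
have xV t : 0 <= t -> VCC P (x t) <= Vb.
  by apply: VCC_le => //; rewrite x0.
have [M [_ /(_ (`|M| + 1))HM]] :=
  compact_bounded (region_compact Vb0 s_ok P_lyapunov C_cycles VbI).
pose N := `|M| + 1.
have N0 : 0 <= N by rewrite addr_ge0.
have KN p : closed_region (C Vb) p -> (- N <= p.1 <= N) /\ (- N <= p.2 <= N).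
  move=> pK; rewrite -!ler_norml.
  have := HM ltac:(by rewrite (le_lt_trans (ler_norm M))// ltrDl) p pK.
  by rewrite /= prod_normE /= ge_max => /andP[].
have NN : - N <= N by rewrite (le_trans _ N0)// oppr_le0.
pose c := clamp (- N) N.
have cN r : `|c r| <= N by rewrite ler_norml clamp_itv.
have cc : continuous c by exact: continuous_clamp.
(* x is controlled only for t >= 0, whereas Picard's theorem needs a field that is continuous and
   Lipschitz for every real t. *)
pose m (t : R) := Num.max t 0.
have m0 t : 0 <= m t by rewrite le_max lexx orbT.
have cm : continuous m.
  by move=> t; apply: continuous_max; [exact: cvg_id|exact: cst_continuous].
(* [true] indexes theta and [false] indexes omega. *)
pose f (t : R) (u : bool -> R) := f_ s (c (u true)) (c (u false)) (x (m t)).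
pose F (t : R) (u : bool -> R) (b : bool) :=
  if b then - kp s * f t u + u false else - ki s * f t u.
have [L L0 HL] := f_lipschitz Vb0 Ppos dom (smooth_g s_ok) (smooth_h s_ok) N.
have ki0 := ki_gt0 s_ok; have kp0 : 0 < kp s by case: s_ok => -[].
pose u0 (b : bool) := if b then q.1.1 else q.1.2.
have [B B0 HB] : exists2 B : R, 0 <= B & forall t, `|f t u0| <= B.
  have [[_ _ [_ Hm]] [_ _ [_ HM']]] := f_extremal Ppos dom (smooth_g s_ok)
    (smooth_h s_ok) (c (u0 true)) (c (u0 false))
    (ltac:(by rewrite ltW// lexx) : 0 <= Vb <= Vb).
  move: (minimum _) (maximum _) Hm HM' => a b Ha Hb.
  exists (`|a| + `|b|) => [|t]; first exact: addr_ge0.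
  have := Ha _ (xV _ (m0 t)); have := Hb _ (xV _ (m0 t)).
  have := ler_norm b; have := ler_norm (- a); rewrite normrN.
  have := normr_ge0 a; have := normr_ge0 b.
  by rewrite /f ler_norml; lra.
have fL t u v d : (forall i, `|u i - v i| <= d) -> `|f t u - f t v| <= L * (d + d).
  move=> uvd; apply: le_trans (HL _ (xV _ (m0 t)) _ _ _ _ (cN _) (cN _) (cN _) (cN _)) _.
  rewrite ler_wpM2l// lerD//; apply: le_trans (uvd _); exact: clamp_lip.
have cf (u : bool -> R -> R) : (forall i, continuous (u i)) ->
    continuous (fun t => f t (u ^~ t)).
  move=> cu t; have ccu b : {for t, continuous (fun t => c (u b t))}.
    exact: (@continuous_comp _ _ _ (u b) c t (cu b t) (cc _)).
  apply: (continuous_f (smooth_g s_ok) (smooth_h s_ok) (ccu true) (ccu false)).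
    exact: (@continuous_comp _ _ _ m x t (cm t) (cx _)).
  exact: dom (xV _ (m0 t)).
(* f varies by at most L (d + d); the last 1 accounts for the summand omega and makes the constant
   positive. *)
have [|||||u [cu uE du]] := @picard R _ F (2 * (kp s + ki s) * L + 1)
    ((kp s + ki s) * B + `|u0 false|) u0.
- by rewrite ltr_wpDl// !mulr_ge0// addr_ge0// ltW.
- by rewrite addr_ge0// mulr_ge0// addr_ge0// ltW.
- move=> t u v d uvd; have d0 : 0 <= d by apply: le_trans (uvd true).
  have h := fL t u v d uvd.
  have hk (e : R) : 0 < e -> `|- e * f t u - - e * f t v| <= 2 * e * L * d.
    move=> e0; rewrite -mulrBr normrM normrN (gtr0_norm e0).
    apply: le_trans (ler_wpM2l (ltW e0) h) _.
    by rewrite le_eqVlt; apply/orP; left; apply/eqP; ring.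
  have kiL : 0 <= ki s * (L * d) by rewrite !mulr_ge0// ltW.
  have kpL : 0 <= kp s * (L * d) by rewrite !mulr_ge0// ltW.
  case; rewrite /F.
    have -> : forall a b a' b' : R, a + b - (a' + b') = (a - a') + (b - b').
      by move=> *; ring.
    apply: le_trans (ler_normD _ _) _; apply: le_trans (lerD (hk _ kp0) (uvd false)) _.
    rewrite -subr_ge0 (_ : _ - _ = 2 * (ki s * (L * d))); last by ring.
    by rewrite mulr_ge0.
  apply: le_trans (hk _ ki0) _.
  rewrite -subr_ge0 (_ : _ - _ = 2 * (kp s * (L * d)) + d); last by ring.
  by rewrite addr_ge0// mulr_ge0.
- move=> u cu [] t; rewrite /F; last first.
    exact: continuousM (@cst_continuous _ _ _ _) (cf u cu t).
  apply: cvgD; last exact: cu.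
  exact: continuousM (@cst_continuous _ _ _ _) (cf u cu t).
- move=> t; have hk (e : R) : 0 < e -> `|- e * f t u0| <= e * B.
    by move=> e0; rewrite normrM normrN (gtr0_norm e0) ler_wpM2l ?(ltW e0).
  have kiB : 0 <= ki s * B by rewrite mulr_ge0// ltW.
  have kpB : 0 <= kp s * B by rewrite mulr_ge0// ltW.
  case; rewrite /F.
    apply: le_trans (ler_normD _ _) _; apply: lerD => //.
    by apply: le_trans (hk _ kp0) _; rewrite mulrDl lerDl.
  apply: le_trans (hk _ ki0) _; rewrite mulrDl -addrA [X in _ <= X]addrCA lerDl.
  exact: addr_ge0.
pose th := u true; pose om := u false.
have mt t : 0 < t -> m t = t by move=> t0; rewrite /m max_l// ltW.
have dth t : 0 < t ->
    is_derive t 1 th (- kp s * f_ s (c (th t)) (c (om t)) (x t) + om t).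
  by move=> t0; have := du t true t0; rewrite /F /f mt.
have dom' t : 0 < t -> is_derive t 1 om (- ki s * f_ s (c (th t)) (c (om t)) (x t)).
  by move=> t0; have := du t false t0; rewrite /F /f mt.
have idc p : closed_region (C Vb) p -> c p.1 = p.1 /\ c p.2 = p.2.
  by move=> /KN[h1 h2]; rewrite /c !clamp_id.
have inv t : 0 <= t -> closed_region (C Vb) (th t, om t).
  move=> t0; apply: (region_invariant Vb0 s_ok P_lyapunov C_cycles (c1 := c)
    (c2 := c) (x := x) VbI) => //.
  - exact: cu.
  - exact: cu.
  - exact: clamp_lip.
  - exact: clamp_lip.
  - by move=> r /andP[/ltW r0 _]; exact: xV.
  - by move=> r /andP[r0 _]; exact: dth.
  - by move=> r /andP[r0 _]; exact: dom'.
  - by rewrite /th /om !uE /u0; case: (q.1) qK.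
exists (fun t => ((th t, om t), x t)); last first.
  by rewrite /th /om !uE x0 /u0; case: (q) => -[].
split.
- apply: continuous_subspaceT => t.
  exact: cvg_pair (cvg_pair (cu true t) (cu false t)) (cx t).
- by move=> t [t0 _]; apply: dom; exact: xV.
- move=> t t0 _; have [/= e1 e2] := idc _ (inv t (ltW t0)).
  have := dth t t0; have := dom' t t0; rewrite e1 e2 => d2 d1.
  by apply/is_derive_pairP; split; [apply/is_derive_pairP|exact: dx].
Qed.

End Existence.

End LockIn.

Lemma derive_clamped (R : realType) (s : params R) (z : R -> R * R * 'cV[R]_4)
    (c : R -> R) (t e : R) :
  0 < e -> (forall r, `|r - t| < e -> c r = r) ->
  is_derive t 1 z (full_field s (z t)) ->
  is_derive t 1 (z \o c) (full_field s ((z \o c) t)).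
Proof.
move=> e0 cE; rewrite /= cE ?subrr ?normr0// !is_derive_cvgP.
apply: cvg_trans; apply: near_eq_cvg; near=> h => /=.
have hc : c (h *: 1 + t) = h *: 1 + t.
  apply: cE; rewrite addrK -[h *: 1]/(h * 1) mulr1.
  by near: h; apply: dnbhs0_lt.
by rewrite hc (cE t)// subrr normr0.
Unshelve. all: by end_near. Qed.

Theorem theorem9 (R : realType) (s : params R) (P : 'M[R]_4) (Vb : R)
    (C : R -> set (R * R)) (vpll : R * R -> R)
    (s_ok : admissible s)
    (P_lyapunov : lyapunov_matrix s P)
    (Vb_gt0 : 0 < Vb)
    (C_cycles : limit_cycle_family s P Vb C)
    (vpllP : is_VPLL C Vb vpll)
    (between_lines : forall p, closed_region (C Vb) p -> - pi <= p.1 <= pi) :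
  lock_in_estimation s
    [set q : R * R * 'cV[R]_4 |
      [/\ closed_region (C Vb) q.1, vpll q.1 <= Vb & VCC P q.2 <= Vb]].
Proof.
have VbI : 0 < Vb <= Vb by rewrite Vb_gt0 lexx.
have vpll_le p : closed_region (C Vb) p -> vpll p <= Vb.
  by move=> pK; have [/andP[_ ->]] := (vpllP p pK (vpll p)).1 erefl.
split.
  move=> tau z [cz _ dz] [z0K _ z0V] t [t0 tt].
  suff : closed_region (C Vb) (z t).1 /\ VCC P (z t).2 <= Vb.
    by move=> [zK zV]; split=> //; exact: vpll_le.
  (* Time is frozen outside [0, t], as z is continuous only on its own interval and the invariance
     lemmas ask for continuity on the whole line. *)
  pose c := clamp 0 t.
  have cid (r : R) : 0 <= r <= t -> c r = r by exact: clamp_id.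
  have c_upto r : upto tau (c r).
    have /andP[c0 ct] := clamp_itv r t0.
    by split=> //; apply: le_lt_trans tt; rewrite lee_fin.
  have czc : continuous (z \o c).
    by apply: within_comp cz _ c_upto; exact: continuous_clamp.
  have dzc (r : R) : 0 < r < t -> is_derive r 1 (z \o c) (full_field s ((z \o c) r)).
    move=> /andP[r0 rt]; have e0 : 0 < Num.min r (t - r) by rewrite lt_min r0 subr_gt0.
    apply: (derive_clamped e0) => [u|].
      by rewrite lt_min !ltr_norml => ur; apply: cid; lra.
    by apply: dz => //; apply: lt_trans tt; rewrite lte_fin.
  have c1 : continuous (fun r => ((z \o c) r).1).
    by move=> r; apply: (@continuous_comp _ _ _ (z \o c) fst); [exact: czc|exact: cvg_fst].
  have c2 : continuous (fun r => ((z \o c) r).2).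
    by move=> r; apply: (@continuous_comp _ _ _ (z \o c) snd); [exact: czc|exact: cvg_snd].
  have z0E : (z \o c) 0 = z 0 by rewrite /= cid// lexx.
  have ztE : (z \o c) t = z t by rewrite /= cid// lexx andbT.
  have xV r : 0 <= r <= t -> VCC P ((z \o c) r).2 <= Vb.
    move=> /andP[r0 rt]; apply: (ellipsoid_invariant P_lyapunov (ltW Vb_gt0) c2 r0).
      move=> u /andP[u0 ur]; have ut : 0 < u < t by rewrite u0 (lt_le_trans ur).
      by have [_ _] := full_field_components (dzc u ut).
    by rewrite z0E.
  rewrite -ztE; split; last by apply: xV; rewrite t0 lexx.
  have := @region_invariant R s P Vb C Vb_gt0 s_ok P_lyapunov C_cycles Vb
    (fun r => ((z \o c) r).1.1) (fun r => ((z \o c) r).1.2) id id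
    (fun r => ((z \o c) r).2) t VbI.
  rewrite -!surjective_pairing z0E; apply=> //.
  - by move=> r; apply: (@continuous_comp _ _ _ (fun r => ((z \o c) r).1) fst);
      [exact: c1|exact: cvg_fst].
  - by move=> r; apply: (@continuous_comp _ _ _ (fun r => ((z \o c) r).1) snd);
      [exact: c1|exact: cvg_snd].
  - by move=> r; exact: cvg_id.
  - by move=> r; exact: cvg_id.
  - by move=> r /andP[/ltW r0 /ltW rt]; apply: xV; rewrite r0.
  - by move=> r /dzc/full_field_components[].
  - by move=> r /dzc/full_field_components[].
move=> q [qK _ qV]; split; first exact: (global_solution Vb_gt0 s_ok P_lyapunov C_cycles).
(* Constant extension to negative times, which does not affect limits at +oo. *)
move=> z [cz _ dz] z0; pose c (t : R) := Num.max t 0.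
have cid (t : R) : 0 <= t -> c t = t by move=> t0; rewrite /c max_l.
have c_upto t : upto +oo%E (c t) by split; [rewrite le_max lexx orbT|exact: ltry].
have cc : continuous c.
  by move=> t; apply: continuous_max; [exact: cvg_id|exact: cst_continuous].
have czc : continuous (z \o c) by apply: within_comp cz cc c_upto.
have dzc (t : R) : 0 < t -> is_derive t 1 (z \o c) (full_field s ((z \o c) t)).
  move=> t0; apply: (derive_clamped t0) => [r|].
    by rewrite ltr_norml => rt; apply: cid; lra.
  by apply: dz => //; exact: ltry.
have c1 : continuous (fun r => ((z \o c) r).1).
  by move=> r; apply: (@continuous_comp _ _ _ (z \o c) fst); [exact: czc|exact: cvg_fst].
have c2 : continuous (fun r => ((z \o c) r).2).
  by move=> r; apply: (@continuous_comp _ _ _ (z \o c) snd); [exact: czc|exact: cvg_snd].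
pose th t := ((z \o c) t).1.1; pose om t := ((z \o c) t).1.2.
have cth : continuous th.
  by move=> r; apply: (@continuous_comp _ _ _ (fun r => ((z \o c) r).1) fst);
    [exact: c1|exact: cvg_fst].
have com : continuous om.
  by move=> r; apply: (@continuous_comp _ _ _ (fun r => ((z \o c) r).1) snd);
    [exact: c1|exact: cvg_snd].
have z0E : (z \o c) 0 = q by rewrite /= cid.
have q0 : closed_region (C Vb) (th 0, om 0).
  by rewrite /th /om -surjective_pairing z0E.
have x0 : VCC P ((z \o c) 0).2 <= Vb by rewrite z0E.
have dth (t : R) : 0 < t -> is_derive t 1 th (- kp s * f_ s (th t) (om t) ((z \o c) t).2 + om t).
  by move=> /dzc/full_field_components[].
have dom' (t : R) : 0 < t -> is_derive t 1 om (- ki s * f_ s (th t) (om t) ((z \o c) t).2).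
  by move=> /dzc/full_field_components[].
have dx (t : R) : 0 < t ->
    is_derive t 1 (fun t => ((z \o c) t).2) (A_ s *m ((z \o c) t).2).
  by move=> /dzc/full_field_components[].
(* No state then lies strictly beyond either line, as a crossing would require. *)
have stay (t : R) : 0 <= t -> - pi <= (z t).1.1 <= pi.
  move=> t0; have := region_stays Vb_gt0 s_ok P_lyapunov C_cycles cth com c2
    dth dom' dx q0 x0 t0.
  by move=> /between_lines; rewrite /th /= cid.
split.
- have cx := x_vanish Vb_gt0 P_lyapunov c2 dx x0.
  have cq : (th t, om t) @[t --> +oo] --> ((0, 0) : R * R).
    apply/cvgrPdist_lt => e e0.
    have [T T0 HT] := pll_vanish Vb_gt0 s_ok P_lyapunov C_cycles vpllP cth com c2
      dth dom' dx q0 x0 e0.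
    exists T; split; first exact: num_real.
    by move=> t /ltW Tt; rewrite -[(0, 0)]/(0 : R * R) sub0r normrN; exact: HT.
  have E : {near +oo, (fun t => ((th t, om t), ((z \o c) t).2)) =1 z}.
    exists 0; split; first exact: num_real.
    by move=> t /ltW t0; rewrite /th /om /= cid// -!surjective_pairing.
  exact: cvg_trans (near_eq_cvg E) (cvg_pair cq cx).
- move=> [t1 [t2 [_ t20 _ lt2]]]; have /andP[_] := stay t2 t20.
  by rewrite leNgt lt2.
- move=> [t1 [t2 [t10 _ lt1 _]]]; have /andP[+ _] := stay t1 t10.
  by rewrite leNgt lt1.
Qed.
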